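(* Let $f$ be a quasiconformal $C^2$ diffeomorphism from the plane domain $\Omega$ with $C^{1,\alpha}$ compact boundary onto the plane domain $G$ with $C^{2,\alpha}$ compact boundary. If there exist constants $M$ and $N$ such that $$|\Delta f(z)|\le M|\nabla f(z)|^2+N,\quad z\in\Omega,$$ then $f$ has bounded partial derivatives in $\Omega$. In particular, $f$ is a Lipschitz mapping in $\Omega$.
   Context: The plane $\mathbb{R}^2$ is identified with $\mathbb{C}$, $z=x+iy$. For a complex-valued $C^2$ function $f$: $\Delta f=f_{xx}+f_{yy}=4f_{z\bar z}$ and $|\nabla f|^2=|f_x|^2+|f_y|^2=2(|f_z|^2+|f_{\bar z}|^2)$. The mapping $f$ is quasiconformal if there is $k\in[0,1)$ with $|f_{\bar z}|\le k|f_z|$ in the domain. A plane domain has $C^{l,\alpha}$ compact boundary if its boundary is a compact $1$-dimensional manifold (curve) of class $C^{l,\alpha}$, i.e. with $l$-th derivatives Hölder continuous with exponent $\alpha$.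
   Formalization: The domain Ω is additionally assumed bounded: for unbounded Ω the claim fails, e.g. f(z)=z|z|² maps {|z|>1} onto itself, is quasiconformal with |Δf|≤|∇f|², and has unbounded partial derivatives. *)

(* Defs.v *)
From HB Require Import structures.
From mathcomp Require Import all_boot all_order all_algebra.
From mathcomp Require Import complex.
From mathcomp Require Import all_classical all_reals all_analysis.

Set Implicit Arguments.
Unset Strict Implicit.
Unset Printing Implicit Defensive.

Import Order.TTheory GRing.Theory Num.Theory.
Import numFieldNormedType.Exports.

Local Open Scope classical_set_scope.
Local Open Scope ring_scope.
Local Open Scope complex_scope.

(* The plane is R * R, which carries the topology and the real normed module
   structure.  Its library norm is the max norm, so Euclidean lengths are taken
   through the identification (x, y) |-> x + i y with R[i]. *)
Definition cplx (R : realType) (p : R * R) : R[i] := p.1 +i* p.2.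

Definition modulus (R : realType) (p : R * R) : R := Normc.normc (cplx p).

Definition dx (R : realType) (f : R * R -> R * R) : R * R -> R * R :=
  'D_((1, 0) : R * R) f.

Definition dy (R : realType) (f : R * R -> R * R) : R * R -> R * R :=
  'D_((0, 1) : R * R) f.

Definition dz (R : realType) (f : R * R -> R * R) (z : R * R) : R[i] :=
  (cplx (dx f z) - 'i%C * cplx (dy f z)) / 2%:R.

Definition dzbar (R : realType) (f : R * R -> R * R) (z : R * R) : R[i] :=
  (cplx (dx f z) + 'i%C * cplx (dy f z)) / 2%:R.

Definition laplacian (R : realType) (f : R * R -> R * R) (z : R * R) : R * R :=
  dx (dx f) z + dy (dy f) z.

Definition sqr_grad (R : realType) (f : R * R -> R * R) (z : R * R) : R :=
  modulus (dx f z) ^+ 2 + modulus (dy f z) ^+ 2.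

(* Meant for open A: the values of dx f and dy f on A then depend only on the
   restriction of f to A. *)
Fixpoint Ck (R : realType) (k : nat) (A : set (R * R)) (f : R * R -> R * R)
    : Prop :=
  match k with
  | 0%N => {in A, continuous f}
  | k'.+1 =>
      [/\ {in A, continuous f},
          (forall z, A z -> derivable f z ((1, 0) : R * R) /\
                            derivable f z ((0, 1) : R * R)),
          Ck k' A (dx f)
        & Ck k' A (dy f)]
  end.

Definition Ck_diffeomorphism (R : realType) (k : nat) (A B : set (R * R))
    (f : R * R -> R * R) : Prop :=
  [/\ set_bij A B f,
      Ck k A f
    & exists2 g : R * R -> R * R,
        Ck k B g & forall z, A z -> g (f z) = z].

Definition quasiconformal (R : realType) (A : set (R * R))
    (f : R * R -> R * R) : Prop :=
  exists2 k : R, 0 <= k < 1 &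
    forall z, A z -> Normc.normc (dzbar f z) <= k * Normc.normc (dz f z).

Definition plane_domain (R : realType) (A : set (R * R)) : Prop :=
  [/\ open A, connected A & A !=set0].

Definition boundary (T : topologicalType) (A : set T) : set T :=
  closure A `\` A°.

Definition holder_on (R : realType) (a : R) (I : set R) (g : R -> R * R)
    : Prop :=
  exists C : R, forall s t, I s -> I t ->
    modulus (g s - g t) <= C * `|s - t| `^ a.

(* A regular arc of class C^{l,a} that parametrizes the part of S in the open
   set U; the chart h is the continuous inverse of c on S `&` U. *)
Definition local_Cla_parametrization (R : realType) (l : nat) (a : R)
    (S U : set (R * R)) (c : R -> R * R) (h : R * R -> R) : Prop :=
  let I := `]-1, 1[%classic : set R in
  [/\ c @` I = S `&` U,
      {within S `&` U, continuous h} /\ (forall t, I t -> h (c t) = t),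
      (forall j t, (j < l)%N -> I t -> derivable (derive1n j c) t 1),
      holder_on a I (derive1n l c)
    & forall t, I t -> derive1n 1 c t != 0].

(* An embedded curve without boundary points: neither isolated points nor
   endpoints of arcs are allowed. *)
Definition Cla_curve (R : realType) (l : nat) (a : R) (S : set (R * R))
    : Prop :=
  forall p, S p -> exists (U : set (R * R)) (c : R -> R * R) (h : R * R -> R),
    [/\ open U, U p & local_Cla_parametrization l a S U c h].

Definition Cla_compact_boundary (R : realType) (l : nat) (a : R)
    (A : set (R * R)) : Prop :=
  compact (boundary A) /\ Cla_curve l a (boundary A).

(* Main.v *)
Require Import Defs.
From HB Require Import structures.
From mathcomp Require Import all_boot all_order all_algebra.
From mathcomp Require Import complex ring lra.
From mathcomp Require Import all_classical all_reals all_analysis.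

Set Implicit Arguments.
Unset Strict Implicit.
Unset Printing Implicit Defensive.

Import Order.TTheory GRing.Theory Num.Theory.
Import numFieldNormedType.Exports.

Local Open Scope classical_set_scope.
Local Open Scope ring_scope.

(* Write S for the boundary of G and Gam for that of Omega. Being a homeomorphism, f leaves every
   compact subset of G near Gam. Hence on each side of a small arc of Gam either f is close to S
   or f tends to infinity, and the latter contradicts a Caccioppoli inequality for log log |f|: its
   energy stays bounded near the arc, so it cannot have infinite values there. In the former case
   let B(c, r) be a ball outside S and tangent to S at a nearest point to f(z). Quasiconformality makes exp(- a |f - c|^2) almost subharmonic for large a, and comparison
   with a barrier at the boundary point below z bounds the distance of f(z) to S by a multiple of
   the height of z over Gam. A Bernstein type argument on squares of that size, in which r^2 - |f - c|^2
   controls the oscillation of f, turns this into a bound on the gradient. Compactness of the closure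
   of Omega makes the bound global. A bounded gradient gives a Lipschitz map because Omega lies on
   only one side of Gam near each boundary point: otherwise the parity of the crossings of Gam would
   be a nonconstant locally constant function on Omega. *)

(** * Partial derivatives and the maximum principle *)
Section Plane.
Variable R : realType.
Implicit Types (z w : R * R) (i : bool) (u v : R * R -> R).

Definition pcoord i z : R := if i then z.1 else z.2.
Definition slide i z (t : R) : R * R := if i then (t, z.2) else (z.1, t).

Lemma slide_pcoord i z : slide i z (pcoord i z) = z.
Proof. by case: i; case: z. Qed.

Definition pd i u z (d : R) : Prop :=
  is_derive (pcoord i z) 1 (fun t => u (slide i z t)) d.

Lemma pd_cst i c z : pd i (fun=> c) z 0.
Proof. exact: is_derive_cst. Qed.

Lemma pd_coord i j z : pd i (pcoord j) z (i == j)%:R.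
Proof.
rewrite /pd; case: i; case: j => /=.
- exact: is_derive_id.
- exact: is_derive_cst.
- exact: is_derive_cst.
- exact: is_derive_id.
Qed.

Lemma pdD i u v z a b : pd i u z a -> pd i v z b -> pd i (fun y => u y + v y) z (a + b).
Proof. by move=> ? ?; exact: is_deriveD. Qed.

Lemma pdB i u v z a b : pd i u z a -> pd i v z b -> pd i (fun y => u y - v y) z (a - b).
Proof. by move=> ? ?; exact: is_deriveB. Qed.

Lemma pd_eq i u z a b : pd i u z a -> a = b -> pd i u z b.
Proof. by move=> ? <-. Qed.

Lemma pdM i u v z a b : pd i u z a -> pd i v z b ->
  pd i (fun y => u y * v y) z (a * v z + u z * b).
Proof.
move=> ua vb; have := is_deriveM ua vb; rewrite slide_pcoord => h.
by apply: pd_eq h _; rewrite /GRing.scale /= addrC; congr (_ + _); rewrite mulrC.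
Qed.

Lemma pd_comp i (phi : R -> R) u z a b : is_derive (u z) 1 phi b -> pd i u z a ->
  pd i (fun y => phi (u y)) z (b * a).
Proof.
move=> pb ua; rewrite -{1}(slide_pcoord i z) in pb.
exact: (is_derive1_comp pb ua).
Qed.


Definition sqr_nbh z (e : R) : set (R * R) :=
  [set w | `|w.1 - z.1| < e /\ `|w.2 - z.2| < e].

Lemma nbhs_sqrP z (A : set (R * R)) :
  nbhs z A <-> exists2 e : R, 0 < e & sqr_nbh z e `<=` A.
Proof.
split.
  move=> /nbhs_ballP[e e0 eA]; exists e => // w [w1 w2]; apply: eA.
  by split; rewrite /= /ball/= distrC.
move=> [e e0 eA]; apply/nbhs_ballP; exists e => // w [].
by rewrite /ball/= => h1 h2; apply: eA; split; rewrite distrC.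
Qed.

Lemma sqr_nbh_refl z e : 0 < e -> sqr_nbh z e z.
Proof. by move=> e0; split; rewrite subrr normr0. Qed.

Lemma sub_sqr_nbh z e e' : e <= e' -> sqr_nbh z e `<=` sqr_nbh z e'.
Proof. by move=> ee' w [w1 w2]; split; exact: lt_le_trans ee'. Qed.

Lemma continuous_sqrP u z : {for z, continuous u} <->
  forall e : R, 0 < e -> exists2 d : R, 0 < d &
    forall w, sqr_nbh z d w -> `|u w - u z| < e.
Proof.
split.
  move=> /cvgrPdist_lt uz e e0; have /nbhs_sqrP[d d0 ud] := uz _ e0.
  by exists d => // w /ud; rewrite /= distrC.
move=> uz; apply/cvgrPdist_lt => e e0; have [d d0 ud] := uz _ e0.
by apply/nbhs_sqrP; exists d => // w /ud; rewrite /= distrC.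
Qed.

Lemma closure_sqrP z (A : set (R * R)) :
  closure A z <-> forall e : R, 0 < e -> exists2 w, A w & sqr_nbh z e w.
Proof.
split.
  move=> Az e e0; have /Az[w [Aw zw]] : nbhs z (sqr_nbh z e).
    by apply/nbhs_sqrP; exists e.
  by exists w.
move=> Az B /nbhs_sqrP[e e0 eB]; have [w Aw zw] := Az _ e0.
by exists w; split => //; exact: eB.
Qed.

Lemma open_sqrP (A : set (R * R)) z : open A -> A z ->
  exists2 e : R, 0 < e & sqr_nbh z e `<=` A.
Proof. by move=> oA Az; apply/nbhs_sqrP; exact: open_nbhs_nbhs. Qed.

Definition box_bounded (A : set (R * R)) :=
  exists B : R, forall z, A z -> `|z.1| <= B /\ `|z.2| <= B.

Lemma compact_closed_bounded (A : set (R * R)) :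
  closed A -> box_bounded A -> compact A.
Proof.
move=> cA [B AB]; apply: (@subclosed_compact _ A (`[-B, B] `*` `[-B, B])%classic) => //.
  by apply: compact_setX; exact: segment_compact.
by move=> z /AB[]; rewrite !ler_norml => z1 z2; split; rewrite /= in_itv.
Qed.

Lemma second_derivative_test (phi dphi : R -> R) (a d e : R) : 0 < e ->
  (forall t, `|t - a| < e -> is_derive t 1 phi (dphi t)) ->
  is_derive a 1 dphi d ->
  (forall t, `|t - a| < e -> phi t <= phi a) -> d <= 0.
Proof.
move=> e0 dph ddph amax; rewrite leNgt; apply/negP => d0.
have da0 : dphi a = 0.
  have aae : a \in `](a - e), (a + e)[ by rewrite in_itv/=; lra.
  have inE' t : t \in `](a - e), (a + e)[ -> `|t - a| < e.
    by rewrite in_itv/= ltr_distl.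
  have h : is_derive a 1 phi 0.
    apply: (@derive1_at_max _ phi (a - e) (a + e) a) => //; first lra.
    - by move=> t /inE' /dph [].
    - by move=> t /inE' /amax.
  have h2 : is_derive a 1 phi (dphi a) by apply: dph; rewrite subrr normr0.
  by rewrite -(@derive_val _ _ _ _ _ _ _ h) -(@derive_val _ _ _ _ _ _ _ h2).
have [dd dv] := ddph.
have /cvgrPdist_lt /(_ d d0) : h^-1 *: (dphi (h *: 1 + a) - dphi a) @[h --> 0^'] --> d.
  by rewrite -dv; exact: dd.
rewrite /dnbhs /= => /nbhs_ballP[r r0 hr].
set s := Num.min r e / 2.
have mre : 0 < Num.min r e by rewrite lt_min r0 e0.
have s0 : 0 < s by rewrite /s; lra.
have sr : s < r by apply: (@lt_le_trans _ _ (Num.min r e)); rewrite ?ge_min ?lexx// /s; lra.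
have se : s < e by apply: (@lt_le_trans _ _ (Num.min r e)); rewrite ?ge_min ?lexx ?orbT// /s; lra.
have dpos t : a < t -> t <= a + s -> 0 < dphi t.
  move=> at_ ts; have := hr (t - a).
  rewrite /ball/= sub0r normrN gtr0_norm ?subr_gt0// da0 subr0.
  have tar : t - a < r by lra.
  move=> /(_ tar); have ta0 : t - a != 0 by rewrite subr_eq0 gt_eqF.
  move=> /(_ ta0); rewrite [_%:A]mulr1 subrK /GRing.scale/= => H.
  have H' : 0 < (t - a)^-1 * dphi t by have := ler_norm (d - (t - a)^-1 * dphi t); lra.
  by move: H'; rewrite pmulr_rgt0// invr_gt0 subr_gt0.
have as_ : a < a + s by lra.
have [||c cas] := @MVT _ phi dphi a (a + s) as_.
- move=> x; rewrite in_itv/= => /andP[x1 x2]; apply: dph.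
  by rewrite ltr_norml; lra.
- apply: derivable_within_continuous => x; rewrite in_itv/= => /andP[x1 x2].
  have [] // : is_derive x 1 phi (dphi x).
  by apply: dph; rewrite ltr_norml; lra.
move=> E; move: cas; rewrite in_itv/= => /andP[c1 c2].
have := dpos c c1 (ltW c2) => dc.
have : phi (a + s) <= phi a by apply: amax; rewrite ltr_norml; lra.
have : 0 < dphi c * (a + s - a) by apply: mulr_gt0 => //; lra.
lra.
Qed.

(* Only pure second partial derivatives are needed for the Laplacian; [true] is the first
   coordinate. *)
Definition jet (A : set (R * R)) u (u1 u2 : bool -> R * R -> R) : Prop :=
  forall i z, A z -> pd i u z (u1 i z) /\ pd i (u1 i) z (u2 i z).

Definition lap (u2 : bool -> R * R -> R) z := u2 true z + u2 false z.

Definition nearly_neg (A : set (R * R)) u (zeta : R * R) : Prop :=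
  forall k : R, 0 < k -> exists2 e : R, 0 < e &
    forall w, sqr_nbh zeta e w -> A w -> u w < k.

Lemma slide_sqr i z e t : 0 < e -> `|t - pcoord i z| < e -> sqr_nbh z e (slide i z t).
Proof. by move=> e0; case: i => /= te; split => //=; rewrite subrr normr0. Qed.

Lemma pcoord_slide i z t : pcoord i (slide i z t) = t.
Proof. by case: i. Qed.

Lemma slide_slide i z s t : slide i (slide i z s) t = slide i z t.
Proof. by case: i. Qed.

Lemma pd_slide i u z t d : pd i u (slide i z t) d ->
  is_derive t 1 (fun s => u (slide i z s)) d.
Proof.
by rewrite /pd pcoord_slide; under eq_fun do rewrite slide_slide.
Qed.

Lemma maximum_principle (A : set (R * R)) u (u1 u2 : bool -> R * R -> R) : open A -> box_bounded A ->
  {in A, continuous u} -> jet A u u1 u2 -> (forall z, A z -> 0 < lap u2 z) ->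
  (forall zeta, closure A zeta -> ~ A zeta -> nearly_neg A u zeta) ->
  forall z, A z -> u z <= 0.
Proof.
move=> oA bA cu ju lapu bd z0 Az0; rewrite leNgt; apply/negP => uz0.
pose E := [set z | A z /\ u z0 <= u z].
have cE : closed E.
  move=> zeta Ezeta.
  have clz : closure A zeta.
    by apply: closure_subset Ezeta => z [].
  have [Az|nAz] := pselect (A zeta); last first.
    have [e e0 eu] := bd zeta clz nAz _ uz0.
    have /closure_sqrP/(_ e e0)[w [Aw uw] zw] := Ezeta.
    by have := eu w zw Aw; rewrite ltNge uw.
  split => //; rewrite leNgt; apply/negP => lt.
  have /continuous_sqrP cz : {for zeta, continuous u} by apply: cu; rewrite inE.
  have [|d d0 du] := cz (u z0 - u zeta); first by rewrite subr_gt0.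
  have /closure_sqrP/(_ d d0)[w [Aw uw] zw] := Ezeta.
  by have := du w zw; rewrite ltNge (le_trans _ (ler_norm _))// lerB.
have bE : box_bounded E by case: bA => B AB; exists B => z [/AB].
have coE : compact E := compact_closed_bounded cE bE.
have [||z1 /[!inE]-[Az1 uz1] mx] := @compact_EVT_max _ _ u E _ coE.
- by exists z0; split.
- apply: continuous_in_subspaceT => z /[!inE] -[Az _]; apply: cu; exact/mem_set.
have [e e0 eA] := open_sqrP oA Az1.
have mx' z : A z -> u z <= u z1.
  move=> Az; have [le|lt] := leP (u z0) (u z); first by apply: mx; rewrite inE.
  by apply: (le_trans (ltW lt)).
have neg i : u2 i z1 <= 0.
  apply: (@second_derivative_test (fun t => u (slide i z1 t))
    (fun t => u1 i (slide i z1 t)) (pcoord i z1) _ e) => //.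
  - move=> t te; apply: pd_slide; apply: (ju i _ _).1.
    by apply: eA; exact: slide_sqr.
  - exact: (ju i _ Az1).2.
  - by move=> t te; rewrite slide_pcoord; apply: mx'; apply: eA; exact: slide_sqr.
have := lapu _ Az1; have := neg true; have := neg false.
by rewrite /lap; lra.
Qed.

End Plane.

Section Jets.
Variable R : realType.
Implicit Types (z w : R * R) (i : bool) (A : set (R * R)) (u v : R * R -> R).
Implicit Types (ui uii vi vii : bool -> R * R -> R).

Lemma jetW A B u ui uii : A `<=` B -> jet B u ui uii -> jet A u ui uii.
Proof. by move=> AB ju i z /AB /ju. Qed.

Lemma jetD A u ui uii v vi vii : jet A u ui uii -> jet A v vi vii ->
  jet A (fun z => u z + v z) (fun i z => ui i z + vi i z)
    (fun i z => uii i z + vii i z).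
Proof.
move=> ju jv i z Az; have [? ?] := ju i z Az; have [? ?] := jv i z Az.
by split; exact: pdD.
Qed.

Lemma jetB A u ui uii v vi vii : jet A u ui uii -> jet A v vi vii ->
  jet A (fun z => u z - v z) (fun i z => ui i z - vi i z)
    (fun i z => uii i z - vii i z).
Proof.
move=> ju jv i z Az; have [? ?] := ju i z Az; have [? ?] := jv i z Az.
by split; exact: pdB.
Qed.

Lemma jet_cst A c : jet A (fun=> c) (fun _ _ => 0) (fun _ _ => 0).
Proof. by move=> i z _; split; exact: pd_cst. Qed.

Lemma jetZ A c u ui uii : jet A u ui uii ->
  jet A (fun z => c * u z) (fun i z => c * ui i z) (fun i z => c * uii i z).
Proof.
move=> ju i z Az; have [a b] := ju i z Az.
by split; [apply: pd_eq (pdM (pd_cst _ _ _) a) _ | apply: pd_eq (pdM (pd_cst _ _ _) b) _];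
  rewrite mul0r add0r.
Qed.

Lemma jet_comp A u ui uii (phi phi1 phi2 : R -> R) :
  (forall z, A z -> is_derive (u z) 1 phi (phi1 (u z)) /\
                    is_derive (u z) 1 phi1 (phi2 (u z))) ->
  jet A u ui uii ->
  jet A (fun z => phi (u z)) (fun i z => phi1 (u z) * ui i z)
    (fun i z => phi2 (u z) * ui i z ^+ 2 + phi1 (u z) * uii i z).
Proof.
move=> dphi ju i z Az; have [a b] := ju i z Az; have [c d] := dphi z Az.
split; first exact: pd_comp.
apply: pd_eq (pdM (pd_comp d a) b) _.
by rewrite expr2 mulrA.
Qed.

Lemma jet_coord A j : jet A (@pcoord R j) (fun i _ => (i == j)%:R) (fun _ _ => 0).
Proof. by move=> i z _; split; [exact: pd_coord|exact: pd_cst]. Qed.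

Lemma is_derive_quadratic (a b c x : R) :
  is_derive x 1 (fun t => a * t ^+ 2 + b * t + c) (2 * a * x + b).
Proof.
have i1 : is_derive x 1 (fun t : R => t) 1 := is_derive_id x 1.
have := is_deriveD (is_deriveD (is_deriveZ a (is_deriveM i1 i1)) (is_deriveZ b i1))
  (is_derive_cst c x 1).
by rewrite /GRing.scale/= !mulr1 addr0 mulrDr -mulr2n mulr_natl mulrnAl.
Qed.

Lemma jet_quadratic A u ui uii a b c : jet A u ui uii ->
  jet A (fun z => a * u z ^+ 2 + b * u z + c)
    (fun i z => (2 * a * u z + b) * ui i z)
    (fun i z => 2 * a * ui i z ^+ 2 + (2 * a * u z + b) * uii i z).
Proof.
apply: (@jet_comp _ _ _ _ (fun t => a * t ^+ 2 + b * t + c)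
  (fun t => 2 * a * t + b) (fun=> 2 * a)) => z _.
split; first exact: is_derive_quadratic.
have := is_derive_quadratic 0 (2 * a) b (u z).
rewrite mulr0 mul0r add0r; congr (is_derive _ _ _ _).
by apply/funext => t; rewrite mul0r add0r.
Qed.

Definition mirror i (c : R) z : R * R := slide i z (2 * c - pcoord i z).

Lemma mirror_slide i c j z t : mirror i c (slide j z t) =
  slide j (mirror i c z) (if j == i then 2 * c - t else t).
Proof. by case: i; case: j. Qed.

Lemma jet_mirror A u ui uii i c : jet A u ui uii ->
  jet [set z | A (mirror i c z)] (fun z => u (mirror i c z))
    (fun j z => (-1) ^+ (j == i) * ui j (mirror i c z))
    (fun j z => uii j (mirror i c z)).
Proof.
move=> ju.
have key v d j z : pd j v (mirror i c z) d ->
    pd j (fun z => v (mirror i c z)) z ((-1) ^+ (j == i) * d).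
  rewrite /pd; under [X in _ -> is_derive _ _ X _]eq_fun do rewrite mirror_slide.
  case: eqP => [->|ji] /=; last first.
    by rewrite mul1r; case: (i) (j) ji => -[].
  rewrite expr1 mulN1r; move=> h.
  have dr : is_derive (pcoord i z) 1 (fun t => 2 * c - t) (-1).
    have := is_derive_quadratic 0 (-1) (2 * c) (pcoord i z).
    rewrite mulr0 mul0r add0r; congr (is_derive _ _ _ _).
    by apply/funext => t; ring.
  have h' : is_derive (2 * c - pcoord i z) 1
     (fun t => v (slide i (mirror i c z) t)) d.
    by move: h; rewrite {1}/mirror pcoord_slide.
  have := @is_derive1_comp _ (fun t => v (slide i (mirror i c z) t))
    (fun t => 2 * c - t) _ _ _ h' dr; rewrite mulrN1 //.
move=> j z /= Az; have [a b] := ju j _ Az; split; first exact: key.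
apply: pd_eq (pdM (pd_cst _ _ _) (key _ _ _ _ b)) _.
by rewrite mul0r add0r mulrA -expr2 sqrr_sign mul1r.
Qed.

Lemma derive_le_linear (h : R -> R) (l B d : R) : 0 < d -> h 0 = 0 ->
  is_derive (0 : R) 1 h l -> (forall t, 0 < t < d -> h t <= B * t) -> l <= B.
Proof.
move=> d0 h0 [dh dv] hB; rewrite leNgt; apply/negP => Bl.
have /cvgrPdist_lt /(_ (l - B)) : t^-1 *: (h (t *: 1 + 0) - h 0) @[t --> 0^'] --> l.
  by rewrite -dv; exact: dh.
rewrite subr_gt0 => /(_ Bl) /nbhs_ballP[r r0 hr].
set s := Num.min r d / 2.
have mre : 0 < Num.min r d by rewrite lt_min r0 d0.
have s0 : 0 < s by rewrite /s; lra.
have sr : s < r by apply: (@lt_le_trans _ _ (Num.min r d)); rewrite ?ge_min ?lexx// /s; lra.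
have sd : s < d by apply: (@lt_le_trans _ _ (Num.min r d)); rewrite ?ge_min ?lexx ?orbT// /s; lra.
have := hr s; rewrite /ball/= sub0r normrN gtr0_norm// => /(_ sr).
rewrite gt_eqF// => /(_ isT); rewrite h0 subr0 addr0 [_%:A]mulr1 /GRing.scale/=.
have := hB s; rewrite s0 sd => /(_ isT) hs.
have : s^-1 * h s <= B by rewrite ler_pdivrMl// mulrC.
by move=> ? /(le_lt_trans (ler_norm _)); lra.
Qed.

End Jets.

(** * Interior gradient estimate *)
Section InteriorGradient.
Variable R : realType.
Implicit Types (z w : R * R) (i : bool) (A : set (R * R)) (u v : R * R -> R).
Implicit Types (ui uii vi vii : bool -> R * R -> R).

Lemma pcoord_continuous i : continuous (@pcoord R i).
Proof. by case: i => z; [exact: cvg_fst|exact: cvg_snd]. Qed.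

Lemma sqr_nbhP i z e w : sqr_nbh z e w <->
  `|pcoord i w - pcoord i z| < e /\ `|pcoord (~~ i) w - pcoord (~~ i) z| < e.
Proof. by case: i => //=; split; case. Qed.

Lemma mirror_continuous i (c : R) : continuous (mirror i c).
Proof.
move=> z.
have cB (j : bool) : {for z, continuous (fun w => 2 * c - pcoord j w)}.
  by apply: cvgB; [exact: cvg_cst|exact: pcoord_continuous].
move: cB; case: i => cB.
  exact: (cvg_pair (cB true) (@pcoord_continuous false z)).
exact: (cvg_pair (@pcoord_continuous true z) (cB false)).
Qed.

Lemma mirror_sqr_nbh i z e w : sqr_nbh z e w -> sqr_nbh z e (mirror i (pcoord i z) w).
Proof.
have E (a b : R) : 2 * a - b - a = - (b - a) by ring.
by case: i => -[w1 w2]; split => //=; rewrite E normrN.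
Qed.

Lemma nearly_neg_continuous A v zeta : {for zeta, continuous v} -> v zeta <= 0 ->
  nearly_neg A v zeta.
Proof.
move=> /continuous_sqrP cv v0 k k0; have [d d0 dv] := cv _ k0.
by exists d => // w /dv h _; have := ler_norm (v w - v zeta); lra.
Qed.

Let derivative_bound u ui uii z0 (d e M N : R) i : 0 < d -> d < e ->
  {in sqr_nbh z0 e, continuous u} -> jet (sqr_nbh z0 e) u ui uii ->
  (forall z, sqr_nbh z0 e z -> `|u z| <= M) ->
  (forall z, sqr_nbh z0 e z -> `|lap uii z| < N) ->
  ui i z0 <= 2 * M / d + N * d / 2.
Proof.
move=> d0 de cu ju uM uN.
have e0 : 0 < e by lra.
have z0e := sqr_nbh_refl z0 e0.
have M0 : 0 <= M := le_trans (normr_ge0 _) (uM _ z0e).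
have N0 : 0 < N := le_lt_trans (normr_ge0 _) (uN _ z0e).
pose c := pcoord i z0; pose c' := pcoord (~~ i) z0.
pose D := [set z | 0 < pcoord i z - c < d /\ `|pcoord (~~ i) z - c'| < d].
pose E := [set z | 0 <= pcoord i z - c <= d /\ `|pcoord (~~ i) z - c'| <= d].
have DE : D `<=` E by move=> z [/andP[? ?] ?]; split; [apply/andP; split|]; exact: ltW.
have Ee : E `<=` sqr_nbh z0 e.
  move=> z [/andP[h1 h2] h3]; apply/(sqr_nbhP i); split.
    by rewrite ger0_norm//; exact: le_lt_trans de.
  exact: le_lt_trans de.
have oD : open D.
  have -> : D = (@pcoord R i @^-1` `]c, c + d[) `&`
      (@pcoord R (~~ i) @^-1` `]c' - d, c' + d[).
    apply/seteqP; split => z; rewrite /D /= !in_itv/= ltr_distl => -[] /andP[a b] /andP[? ?];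
      by split; apply/andP; split; lra.
  by apply: openI; apply: open_comp; try exact: interval_open;
    move=> z _; exact: pcoord_continuous.
have cE : closed E.
  have -> : E = (@pcoord R i @^-1` `[c, c + d]) `&`
      (@pcoord R (~~ i) @^-1` `[c' - d, c' + d]).
    apply/seteqP; split => z; rewrite /E /= !in_itv/= ler_distl => -[] /andP[a b] /andP[? ?];
      by split; apply/andP; split; lra.
  by apply: closedI; apply: closed_comp; try (exact: interval_closed || exact: itv_closed);
    move=> z _; exact: pcoord_continuous.
pose m := M / d ^+ 2.
have m0 : 0 <= m by rewrite /m divr_ge0// exprn_ge0// ltW.
have md2 : m * d ^+ 2 = M by rewrite /m divfK// expf_neq0// gt_eqF.
pose q := 2 * M / d + N * d / 2.
have qE : q = 2 * (m * d) + N * d / 2 by rewrite /q /m expr2; field; rewrite gt_eqF.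
pose a z := pcoord (~~ i) z - c'; pose t z := pcoord i z - c.
pose psi z := (m * a z ^+ 2 + 0 * a z + 0) + ((- m - N / 2) * t z ^+ 2 + q * t z + 0).
pose phi z := 2^-1 * (u z - u (mirror i c z)).
have jphi := jetZ 2^-1 (jetB (jetW Ee ju)
  (@jetW _ E [set z | sqr_nbh z0 e (mirror i c z)] _ _ _
     (fun z Ez => mirror_sqr_nbh i (Ee z Ez)) (@jet_mirror _ _ _ _ _ i c ju))).
have jpsi := jetD
  (@jet_quadratic _ D _ _ _ m 0 0 (jetB (@jet_coord _ D (~~ i)) (@jet_cst _ D c')))
  (@jet_quadratic _ D _ _ _ (- m - N / 2) q 0 (jetB (@jet_coord _ D i) (@jet_cst _ D c))).
have ce z : sqr_nbh z0 e z -> {for z, continuous u} by move=> ?; apply: cu; rewrite inE.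
have cphi z : E z -> {for z, continuous (fun z => phi z - psi z)}.
  move=> Ez; have ct : {for z, continuous t}.
    by apply: cvgB; [exact: pcoord_continuous|exact: cvg_cst].
  have ca : {for z, continuous a}.
    by apply: cvgB; [exact: pcoord_continuous|exact: cvg_cst].
  have cq (x y w : R) v : {for z, continuous v} ->
      {for z, continuous (fun z => x * v z ^+ 2 + y * v z + w)}.
    move=> cv; apply: cvgD; last exact: cvg_cst.
    apply: cvgD; apply: cvgM; try exact: cvg_cst; try exact: cv.
    exact: (cvgM cv cv).
  apply: cvgB; last by apply: cvgD; exact: cq.
  apply: cvgM; first exact: cvg_cst.
  apply: cvgB; first exact: (ce _ (Ee _ Ez)).
  apply: (@cvg_comp _ _ _ (mirror i c) u _ (nbhs (mirror i c z))).
    exact: mirror_continuous.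
  by apply: ce; apply: mirror_sqr_nbh; exact: Ee.
have phile z : E z -> phi z <= M.
  move=> /Ee ez; have := uM _ ez; have := uM _ (mirror_sqr_nbh i ez).
  rewrite !ler_norml /phi /c => /andP[? ?] /andP[? ?]; lra.
have main : forall z, D z -> phi z - psi z <= 0.
  apply: (maximum_principle oD _ _ (jetB (jetW DE jphi) jpsi)).
  - exists (`|z0.1| + `|z0.2| + e) => z /DE/Ee [h1 h2].
    have n1 := ler_normD (z.1 - z0.1) z0.1; have n2 := ler_normD (z.2 - z0.2) z0.2.
    have := normr_ge0 z0.1; have := normr_ge0 z0.2.
    by rewrite !subrK in n1 n2; lra.
  - by move=> z /[!inE] /DE /cphi.
  - move=> z /DE/Ee ez; rewrite /lap /=.
    have /ltr_normlP[h1 h2] := uN _ ez.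
    have /ltr_normlP[h3 h4] := uN _ (mirror_sqr_nbh i ez).
    move: h1 h2 h3 h4; rewrite /lap -/c.
    by case: (i); rewrite /= => h1 h2 h3 h4; lra.
  - move=> zeta clz nD.
    have Ez : E zeta.
      by rewrite (iffLR (closure_id E) cE); apply: closure_subset clz; exact: DE.
    apply: nearly_neg_continuous; first exact: cphi.
    rewrite -[X in X <= 0]/(phi zeta - psi zeta).
    have [/andP[t0 td] ad] := Ez.
    have [tz|tn] := eqVneq (pcoord i zeta) c.
      have -> : phi zeta = 0.
        rewrite /phi (_ : mirror i c zeta = zeta) ?subrr ?mulr0//.
        by rewrite /mirror -tz mulr_natl mulr2n addrK slide_pcoord.
      rewrite /psi /t tz subrr; have := mulr_ge0 m0 (sqr_ge0 (a zeta)); lra.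
    have := phile _ Ez => pM.
    have ta0 : 0 <= t zeta * (d - t zeta) by apply: mulr_ge0 => //; rewrite /t; lra.
    have -> : psi zeta = m * a zeta ^+ 2 + m * (t zeta * (d - t zeta)) + m * d * t zeta
      + N / 2 * (t zeta * (d - t zeta)) by rewrite /psi qE; ring.
    have n1 : 0 <= N / 2 * (t zeta * (d - t zeta)) by apply: mulr_ge0 => //; lra.
    have n2 := mulr_ge0 m0 ta0.
    have n3 := mulr_ge0 m0 (sqr_ge0 (a zeta)).
    have n4 : 0 <= m * d * t zeta by rewrite mulr_ge0// mulr_ge0// ltW.
    have [tz|tn'] := eqVneq (t zeta) d.
      have : m * d * t zeta = M by rewrite tz -mulrA -expr2.
      lra.
    have az : `|a zeta| = d.
      apply/eqP; rewrite eq_le ad /= leNgt; apply/negP => lt; apply: nD; split => //.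
      by rewrite lt_neqAle t0 lt_neqAle td tn' !andbT eq_sym subr_eq0.
    have : m * a zeta ^+ 2 = M by rewrite -real_normK ?num_real// az.
    lra.
pose h s := phi (slide i z0 (c + s)).
rewrite -/q; apply: (@derive_le_linear _ h _ _ d) => //.
- rewrite /h addr0 slide_pcoord /phi (_ : mirror i c z0 = z0) ?subrr ?mulr0//.
  by rewrite /mirror /c mulr_natl mulr2n addrK slide_pcoord.
- have Ez0 : E z0 by split; rewrite subrr ?normr0 ?lexx/= ltW.
  have [] := jphi i z0 Ez0; rewrite /= eqxx expr1.
  rewrite (_ : mirror i c z0 = z0); last first.
    by rewrite /mirror /c mulr_natl mulr2n addrK slide_pcoord.
  rewrite (_ : 2^-1 * _ = ui i z0); last by lra.
  rewrite /pd => dphi _.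
  have dc : is_derive (0 : R) 1 (fun s : R => c + s) 1.
    have := is_derive_quadratic 0 1 c (0 : R).
    rewrite !mulr0 add0r; congr (is_derive _ _ _ _).
    by apply/funext => s; ring.
  have dphi' : is_derive (c + 0) 1 (fun s => phi (slide i z0 s)) (ui i z0).
    by rewrite addr0.
  have := @is_derive1_comp _ (fun s => phi (slide i z0 s)) (fun s => c + s) _ _ _ dphi' dc.
  by rewrite mulr1.
- move=> s /andP[s0 sd].
  have := main (slide i z0 (c + s)).
  have Dz : D (slide i z0 (c + s)).
    split; first by rewrite pcoord_slide; lra.
    suff -> : pcoord (~~ i) (slide i z0 (c + s)) = c' by rewrite subrr normr0.
    by rewrite /c'; case: (i).
  move=> /(_ Dz); rewrite -/(h s).
  have -> : psi (slide i z0 (c + s)) = (- m - N / 2) * s ^+ 2 + q * s.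
    rewrite /psi /t /a pcoord_slide.
    have -> : pcoord (~~ i) (slide i z0 (c + s)) = c' by rewrite /c'; case: (i).
    ring.
  have : 0 <= (m + N / 2) * s ^+ 2 by rewrite mulr_ge0 ?sqr_ge0//; lra.
  lra.
Qed.

Lemma interior_gradient u ui uii z0 (d e M N : R) i : 0 < d -> d < e ->
  {in sqr_nbh z0 e, continuous u} -> jet (sqr_nbh z0 e) u ui uii ->
  (forall z, sqr_nbh z0 e z -> `|u z| <= M) ->
  (forall z, sqr_nbh z0 e z -> `|lap uii z| < N) ->
  `|ui i z0| <= 2 * M / d + N * d / 2.
Proof.
move=> d0 de cu ju uM uN; rewrite ler_norml; apply/andP; split.
  rewrite lerNl -mulN1r.
  apply: (@derivative_bound (fun z => -1 * u z) (fun i z => -1 * ui i z)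
    (fun i z => -1 * uii i z) _ _ e) => //.
  - by move=> z ez; apply: cvgM; [exact: cvg_cst|exact: cu].
  - exact: jetZ.
  - by move=> z ez; rewrite mulN1r normrN; exact: uM.
  - by move=> z ez; rewrite /lap -mulrDr mulN1r normrN; exact: uN.
exact: (derivative_bound i d0 de cu ju uM uN).
Qed.

End InteriorGradient.

(** * Barrier at a boundary point *)
Section Barrier.
Variable R : realType.
Implicit Types (z w q n : R * R) (i : bool) (A : set (R * R)) (u v : R * R -> R).
Implicit Types (ui uii vi vii : bool -> R * R -> R).

Definition nsq z : R := z.1 ^+ 2 + z.2 ^+ 2.
Definition dot z w : R := z.1 * w.1 + z.2 * w.2.

Lemma nsq_ge0 z : 0 <= nsq z.
Proof. by rewrite addr_ge0// sqr_ge0. Qed.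

Lemma nsq_eq0 z : (nsq z == 0) = (z == 0).
Proof.
by case: z => a b; rewrite /nsq paddr_eq0 ?sqr_ge0// !sqrf_eq0/= xpair_eqE.
Qed.

Lemma dot_sqr_le z w : dot z w ^+ 2 <= nsq z * nsq w.
Proof.
rewrite -subr_ge0 (_ : _ - _ = (z.1 * w.2 - z.2 * w.1) ^+ 2) ?sqr_ge0//.
by rewrite /nsq /dot; ring.
Qed.

Lemma is_derive_continuous (phi : R -> R) (x d : R) :
  is_derive x 1 phi d -> {for x, continuous phi}.
Proof. by move=> [/derivable1_diffP/differentiable_continuous]. Qed.

Lemma powR_le_eventually (a e : R) : 0 < a -> 0 < e ->
  exists2 d : R, 0 < d & forall x, 0 <= x -> x <= d -> x `^ a <= e.
Proof.
move=> a0 e0; exists (e `^ a^-1); first exact: powR_gt0.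
move=> x x0 xd; have -> : e = (e `^ a^-1) `^ a.
  by rewrite -powRrM mulVf ?gt_eqF// powRr1// ltW.
by apply: ge0_ler_powR; rewrite ?nnegrE// ltW// ?powR_gt0.
Qed.

Lemma is_derive_powR (a x : R) : 0 < x ->
  is_derive x 1 (fun t => t `^ a) (a * x `^ (a - 1)).
Proof. exact: is_derive1_powR. Qed.

Lemma is_derive_scale (f : R -> R) (a x d : R) : is_derive x 1 f d ->
  is_derive x 1 (fun t => a * f t) (a * d).
Proof. by move=> h; exact: (is_deriveZ a h). Qed.

Lemma jet_nsq A q : jet A (fun z => nsq (z - q))
  (fun i z => 2 * (pcoord i z - pcoord i q)) (fun i z => 2).
Proof.
have H := jetD
  (@jet_quadratic _ A _ _ _ 1 0 0 (jetB (@jet_coord _ A true) (@jet_cst _ A q.1)))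
  (@jet_quadratic _ A _ _ _ 1 0 0 (jetB (@jet_coord _ A false) (@jet_cst _ A q.2))).
have -> : (fun z => nsq (z - q)) = (fun z : R * R =>
    1 * (pcoord true z - q.1) ^+ 2 + 0 * (pcoord true z - q.1) + 0 +
    (1 * (pcoord false z - q.2) ^+ 2 + 0 * (pcoord false z - q.2) + 0)).
  by apply/funext => z; rewrite /nsq /=; ring.
move=> i z Az; have [a b] := H i z Az.
have E : (fun w : R * R => 2 * (pcoord i w - pcoord i q)) =1 (fun w =>
    (2 * 1 * (pcoord true w - q.1) + 0) * ((i == true)%:R - 0) +
    (2 * 1 * (pcoord false w - q.2) + 0) * ((i == false)%:R - 0)).
  by move=> w; case: i {H a b} => /=; ring.
split.
  by apply: pd_eq a _; exact: esym (E z).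
rewrite (funext E).
by apply: pd_eq b _; case: i {H a E} => /=; ring.
Qed.

Lemma jet_dot A q n : jet A (fun z => dot n (z - q))
  (fun i z => pcoord i n) (fun i z => 0).
Proof.
have H := jetD
  (jetZ n.1 (jetB (@jet_coord _ A true) (@jet_cst _ A q.1)))
  (jetZ n.2 (jetB (@jet_coord _ A false) (@jet_cst _ A q.2))).
move=> i z Az; have [a b] := H i z Az; split; last exact: pd_cst.
by apply: pd_eq a _; case: i {H b} => /=; ring.
Qed.

Lemma nsq_continuous q : continuous (fun z => nsq (z - q)).
Proof.
move=> z; apply: cvgD.
  have h : {for z, continuous (fun z : R * R => z.1 - q.1)}.
    by apply: cvgB; [exact: cvg_fst|exact: cvg_cst].
  exact: (cvgM h h).
have h : {for z, continuous (fun z : R * R => z.2 - q.2)}.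
  by apply: cvgB; [exact: cvg_snd|exact: cvg_cst].
exact: (cvgM h h).
Qed.

Lemma dot_continuous q n : continuous (fun z => dot n (z - q)).
Proof.
move=> z.
have h1 : {for z, continuous (fun z : R * R => z.1 - q.1)}.
  by apply: cvgB; [exact: cvg_fst|exact: cvg_cst].
have h2 : {for z, continuous (fun z : R * R => z.2 - q.2)}.
  by apply: cvgB; [exact: cvg_snd|exact: cvg_cst].
by apply: cvgD; [exact: (cvgM (cvg_cst n.1) h1)|exact: (cvgM (cvg_cst n.2) h2)].
Qed.

(* W = t - t^(1 + a/2) with t = n.(z - q) + 2K |z - q|^(1 + a): the concave
   power makes W superharmonic although t itself is subharmonic. *)
Lemma barrier (a K L : R) : 0 < a <= 1 -> 1 <= K -> 1 <= L ->
  exists r c : R, [/\ 0 < r, 0 < c &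
  forall q n A, 1 <= nsq n -> nsq n <= L ^+ 2 ->
  (forall z, A z -> 0 < nsq (z - q) <= r /\
     - (K * nsq (z - q) `^ ((1 + a) / 2)) <= dot n (z - q)) ->
  exists W Wi Wii, [/\ jet A W Wi Wii, {in A, continuous W} &
    forall z, A z -> [/\ lap Wii z <= - c,
      K / 2 * nsq (z - q) `^ ((1 + a) / 2) <= W z &
      W z <= dot n (z - q) + 2 * K * nsq (z - q) `^ ((1 + a) / 2)] ] ].
Proof.
move=> /andP[a0 a1] K1 L1.
have K0 : 0 < K := lt_le_trans ltr01 K1.
have [g gE] : {x : R | x = (1 + a) / 2} by exists ((1 + a) / 2).
have [b bE] : {x : R | x = a / 2} by exists (a / 2).
have [T TE] : {x : R | x = L + 2 * K} by exists (L + 2 * K).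
have T0 : 0 < T by rewrite TE; lra.
have [c cE] : {x : R | x = b / 4 * T `^ (b - 1)} by exists (b / 4 * T `^ (b - 1)).
have b0 : 0 < b by rewrite bE; lra.
have c0 : 0 < c by rewrite cE mulr_gt0 ?powR_gt0//; lra.
have g0 : 0 < g by rewrite gE; lra.
have e1 : 0 < (16 * K ^+ 2 * g)^-1.
  by rewrite invr_gt0 !mulr_gt0 ?exprn_gt0//.
have [r1 r10 r1P] := powR_le_eventually a0 e1.
have [r2 r20 r2P] := @powR_le_eventually b (2^-1) b0 ltac:(lra).
have a4 : 0 < a / 4 by lra.
have e3 : 0 < c / (8 * K * g ^+ 2).
  by rewrite divr_gt0// !mulr_gt0 ?exprn_gt0//.
have [r3 r30 r3P] := powR_le_eventually a4 e3.
pose r := Num.min (Num.min 1 r1) (Num.min ((r2 / T) ^+ 2) r3).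
have r0 : 0 < r.
  by rewrite /r !lt_min ltr01 r10 r30 exprn_gt0// divr_gt0.
exists r, c; split => // q n A n1 nL Aq.
pose rho z := nsq (z - q).
pose t z := dot n (z - q) + 2 * K * rho z `^ g.
have rho0 z : A z -> 0 < rho z by move=> /Aq[/andP[]].
have tlow z : A z -> K * rho z `^ g <= t z.
  by move=> /Aq[_]; rewrite /t -gE -/(rho z); lra.
have t0 z : A z -> 0 < t z.
  move=> Az; apply: lt_le_trans (tlow _ Az); rewrite mulr_gt0//.
  by apply: powR_gt0; exact: rho0.
have jt := jetD (@jet_dot A q n) (jetZ (2 * K) (@jet_comp _ A _ _ _ (fun t => t `^ g)
  (fun t => g * t `^ (g - 1)) (fun t => g * ((g - 1) * t `^ (g - 1 - 1)))
  (fun z Az => conj (is_derive_powR g (rho0 z Az))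
     (is_derive_scale g (is_derive_powR (g - 1) (rho0 z Az)))) (@jet_nsq A q))).
have dW z : A z ->
    is_derive (t z) 1 (fun s => s - s `^ (1 + b)) (1 - (1 + b) * t z `^ b) /\
    is_derive (t z) 1 (fun s => 1 - (1 + b) * s `^ b)
       (- ((1 + b) * (b * t z `^ (b - 1)))).
  move=> Az; split.
    have := is_deriveB (is_derive_id (t z) 1) (is_derive_powR (1 + b) (t0 z Az)).
    by rewrite (addrC 1 b) addrK.
  have := is_deriveB (is_derive_cst (1 : R) (t z) 1)
    (is_derive_scale (1 + b) (is_derive_powR b (t0 z Az))).
  by rewrite sub0r.
have jW := @jet_comp _ A t _ _ (fun s => s - s `^ (1 + b))
  (fun s => 1 - (1 + b) * s `^ b) (fun s => - ((1 + b) * (b * s `^ (b - 1)))) dW jt.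
eexists; eexists; eexists; split; first exact: jW.
  move=> z /[!inE] Az.
  apply: (@continuous_comp _ _ _ t (fun s => s - s `^ (1 + b))); last first.
    exact: is_derive_continuous (dW z Az).1.
  apply: cvgD; first exact: dot_continuous.
  apply: cvgM; first exact: cvg_cst.
  apply: (@continuous_comp _ _ _ rho (fun s => s `^ g)).
    exact: nsq_continuous.
  exact: is_derive_continuous (is_derive_powR g (rho0 z Az)).
move=> z Az.
have rz := rho0 z Az.
have : rho z <= r by case: (Aq z Az) => /andP[].
rewrite /r !le_min => /andP[/andP[zr1 zrr1] /andP[zrr2 zrr3]].
have h1 := r1P _ (ltW rz) zrr1; have h3 := r3P _ (ltW rz) zrr3.
have tup : t z <= T * rho z `^ (1 / 2).
  rewrite div1r powR12_sqrt ?(ltW rz)// /t TE [(L + _) * _]mulrDl; apply: lerD.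
    have s0 : 0 <= L * Num.sqrt (rho z) by rewrite mulr_ge0 ?sqrtr_ge0//; clear -L1; lra.
    have [//|dp] := leP (dot n (z - q)) 0; first by move=> dn; exact: le_trans s0.
    rewrite -(@ler_sqr _ (dot n (z - q))) ?nnegrE// ?(ltW dp)//.
    rewrite exprMn sqr_sqrtr ?(ltW rz)//; apply: le_trans (dot_sqr_le _ _) _.
    by rewrite ler_wpM2r// nsq_ge0.
  rewrite ler_pM2l; last by clear -K0; lra.
  rewrite -powR12_sqrt ?(ltW rz)//; apply: ger_powR; first by rewrite rz zr1.
  by rewrite gE; clear -a0; lra.
have tz := t0 z Az.
have tr2 : t z <= r2.
  apply: le_trans tup _; rewrite mulrC -ler_pdivlMr//.
  rewrite div1r powR12_sqrt ?(ltW rz)//.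
  rewrite -(@ler_sqr _ (Num.sqrt _)) ?nnegrE ?sqrtr_ge0//; last first.
    by rewrite divr_ge0// ltW.
  by rewrite sqr_sqrtr ?(ltW rz).
have tb := r2P _ (ltW tz) tr2.
have tb0 : 0 <= t z `^ b := powR_ge0 _ _.
have tE : t z `^ (1 + b) = t z * t z `^ b.
  by rewrite powRD ?powRr1 ?(ltW tz)// (gt_eqF tz) implybT.
have b1 : b <= 1 / 2 by rewrite bE; clear -a1; lra.
split; last 2 first.
- rewrite -gE -/(rho z); have := tlow z Az; rewrite -/(t z) tE.
  have : 0 <= t z * (1 / 2 - t z `^ b) by rewrite mulr_ge0 ?(ltW tz)// subr_ge0 div1r.
  have := tb; clear; lra.
- rewrite -gE -/(rho z) -/(t z); have := powR_ge0 (t z) (1 + b); clear; lra.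
have g1 : g - 1 = (b - 1) / 2 + a / 4 by rewrite gE bE; clear; lra.
pose P := rho z `^ ((b - 1) / 2).
have P1 : 1 <= P.
  by rewrite -(powRr0 (rho z)); apply: ger_powR; [rewrite rz zr1|clear -b1; lra].
pose X := rho z `^ (g - 1); pose Y := rho z `^ (g - 1 - 1).
pose Q := rho z `^ (a / 4); pose S := t z `^ (b - 1).
have rn0 : rho z != 0 by rewrite gt_eqF.
have XE : X = P * Q by rewrite /X g1 powRD// rn0 implybT.
have YX : Y * rho z = X.
  by rewrite -[in LHS](powRr1 (ltW rz)) /Y -powRD ?rn0 ?implybT// subrK.
have XZ : X * rho z `^ g = rho z `^ a.
  by rewrite /X -powRD ?rn0 ?implybT//; congr (_ `^ _); rewrite gE; clear; lra.
have X0 : 0 <= X := powR_ge0 _ _.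
have SP : T `^ (b - 1) * P <= S.
  have -> : T `^ (b - 1) * P = (T * rho z `^ (1 / 2)) `^ (b - 1).
    rewrite powRM ?powR_ge0 ?ltW// -powRrM /P; congr (_ * _ `^ _); clear; lra.
  have nb (x : R) : x `^ (b - 1) = (x `^ (1 - b))^-1 by rewrite -powRN opprB.
  rewrite /S !nb lef_pV2 ?posrE ?powR_gt0// ?mulr_gt0 ?powR_gt0//.
  by apply: ge0_ler_powR; rewrite ?nnegrE ?mulr_ge0 ?powR_ge0 ?(ltW T0) ?(ltW tz)//; clear -b1; lra.
have S0 : 0 <= S := powR_ge0 _ _.
have cP : 2 * (c * P) <= b / 2 * S.
  rewrite cE (_ : 2 * _ = b / 2 * (T `^ (b - 1) * P)); last by clear; lra.
  by rewrite ler_pM2l//; clear -b0; lra.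
have QX : 8 * K * g ^+ 2 * X <= c * P.
  rewrite XE (mulrC P) mulrA ler_pM2r ?(lt_le_trans _ P1)//.
  rewrite mulrC -ler_pdivlMr// !mulr_gt0 ?exprn_gt0//.
pose x1 := z.1 - q.1; pose x2 := z.2 - q.2.
have rhoE : rho z = x1 ^+ 2 + x2 ^+ 2 by [].
have dE : dot n (z - q) = n.1 * x1 + n.2 * x2 by [].
pose s1 := n.1 + 2 * K * (g * X * (2 * x1)).
pose s2 := n.2 + 2 * K * (g * X * (2 * x2)).
have sge : 1 / 2 <= s1 ^+ 2 + s2 ^+ 2.
  have -> : s1 ^+ 2 + s2 ^+ 2 = nsq n + 8 * K * g * X * dot n (z - q) +
      16 * K ^+ 2 * g ^+ 2 * X ^+ 2 * rho z.
    by rewrite /s1 /s2 /nsq dE rhoE; ring.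
  have k1 : 0 <= 16 * K ^+ 2 * g ^+ 2 * X ^+ 2 * rho z.
    by rewrite !mulr_ge0 ?exprn_ge0 ?(ltW rz) ?(ltW g0) ?(ltW K0)//.
  have k2 : - (8 * K ^+ 2 * g * rho z `^ a) <= 8 * K * g * X * dot n (z - q).
    rewrite -XZ (_ : - _ = 8 * K * g * X * (- (K * rho z `^ g))); last by ring.
    apply: ler_wpM2l; last by rewrite gE; case: (Aq z Az).
    by rewrite !mulr_ge0 ?(ltW g0) ?(ltW K0)//.
  have k3 : 16 * K ^+ 2 * g * rho z `^ a <= 1.
    have k0 : 0 < 16 * K ^+ 2 * g by rewrite !mulr_gt0 ?exprn_gt0//.
    by rewrite mulrC -ler_pdivlMr// mul1r.
  by move: k1 k2 k3 n1; clear; lra.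
pose f1 := 1 - (1 + b) * t z `^ b.
have f10 : 0 <= f1 <= 1.
  apply/andP; split; last by rewrite /f1; have := mulr_ge0 (ltW b0) tb0; move: tb0; clear; lra.
  have : 0 <= (1 / 2 - b) * t z `^ b by rewrite mulr_ge0//; clear -b1; lra.
  rewrite /f1; move: tb; clear; lra.
have -> : lap (fun (i : bool) (z0 : R * R) =>
    - ((1 + b) * (b * t z0 `^ (b - 1))) *
      (pcoord i n + 2 * K * (g * nsq (z0 - q) `^ (g - 1) *
         (2 * (pcoord i z0 - pcoord i q)))) ^+ 2 +
    (1 - (1 + b) * t z0 `^ b) *
    (0 + 2 * K * (g * ((g - 1) * nsq (z0 - q) `^ (g - 1 - 1)) *
       (2 * (pcoord i z0 - pcoord i q)) ^+ 2 + g * nsq (z0 - q) `^ (g - 1) * 2))) z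
  = - ((1 + b) * b * S * (s1 ^+ 2 + s2 ^+ 2)) + f1 * (8 * K * g ^+ 2 * X).
  have -> : 8 * K * g ^+ 2 * X = 2 * K * (g * (g - 1) * 4 * (Y * (x1 ^+ 2 + x2 ^+ 2)) + 4 * g * X).
    by rewrite -rhoE YX; ring.
  rewrite /lap -/(rho z) -/X -/Y -/S -/f1 /s1 /s2 /x1 /x2 /=; ring.
have e1' : f1 * (8 * K * g ^+ 2 * X) <= 8 * K * g ^+ 2 * X.
  rewrite ler_piMl//; last by case/andP: f10.
  by rewrite !mulr_ge0 ?exprn_ge0 ?(ltW g0) ?(ltW K0)//.
have e2 : b / 2 * S <= (1 + b) * b * S * (s1 ^+ 2 + s2 ^+ 2).
  have bS : 0 <= b * S by rewrite mulr_ge0// ltW.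
  have e3' := ler_wpM2l bS sge.
  have e4 : 0 <= b * (b * S * (s1 ^+ 2 + s2 ^+ 2)).
    by rewrite !mulr_ge0 ?addr_ge0 ?sqr_ge0 ?(ltW b0).
  by move: e3' e4; clear; lra.
have e5 : c <= c * P by rewrite ler_peMr// ltW.
by move: e1' e2 e5 cP QX; clear; lra.
Qed.

End Barrier.

(** * Exponentials of the distance to a ball *)
Section DistanceEstimate.
Variable R : realType.
Implicit Types (z w q n c : R * R) (i : bool) (A S : set (R * R)).
Implicit Types (f : R * R -> R * R).
Implicit Types (ui uii vi vii : bool -> R * R -> R).

Definition en z : R := Num.sqrt (nsq z).

Lemma en_ge0 z : 0 <= en z. Proof. exact: sqrtr_ge0. Qed.

Lemma sqr_en z : en z ^+ 2 = nsq z.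
Proof. by rewrite sqr_sqrtr// nsq_ge0. Qed.

Lemma modulusE z : modulus z = en z.
Proof. by []. Qed.

Lemma enN z : en (- z) = en z.
Proof. by rewrite /en /nsq /= !sqrrN. Qed.

Lemma en_distC z w : en (z - w) = en (w - z).
Proof. by rewrite -enN opprB. Qed.

Lemma enD z w : en (z + w) <= en z + en w.
Proof.
rewrite -(@ler_sqr _ (en _)) ?nnegrE ?addr_ge0 ?en_ge0//.
rewrite sqrrD !sqr_en.
have d : dot z w <= en z * en w.
  have [d0|/ltW d0] := leP (dot z w) 0.
    by apply: le_trans d0 _; rewrite mulr_ge0 ?en_ge0.
  rewrite -(@ler_sqr _ (dot z w)) ?nnegrE ?mulr_ge0 ?en_ge0//.
  by rewrite exprMn !sqr_en dot_sqr_le.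
have -> : nsq (z + w) = nsq z + nsq w + 2 * dot z w by rewrite /nsq /dot /=; ring.
move: d; rewrite mulr2n; clear; lra.
Qed.

Lemma en_tri z w v : en (z - v) <= en (z - w) + en (w - v).
Proof. by rewrite (_ : z - v = (z - w) + (w - v)) ?enD// addrA subrK. Qed.

Lemma fst_le_en z : `|z.1| <= en z.
Proof.
rewrite -(@ler_sqr _ `|_|) ?nnegrE ?en_ge0// sqr_en real_normK ?num_real//.
by rewrite /nsq lerDl sqr_ge0.
Qed.

Lemma snd_le_en z : `|z.2| <= en z.
Proof.
rewrite -(@ler_sqr _ `|_|) ?nnegrE ?en_ge0// sqr_en real_normK ?num_real//.
by rewrite /nsq lerDr sqr_ge0.
Qed.

Lemma en_le_sum z : en z <= `|z.1| + `|z.2|.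
Proof.
rewrite -(@ler_sqr _ (en z)) ?nnegrE ?en_ge0 ?addr_ge0// sqr_en sqrrD.
rewrite !real_normK ?num_real// /nsq.
have := mulr_ge0 (normr_ge0 z.1) (normr_ge0 z.2); rewrite mulr2n; clear; lra.
Qed.

Lemma exp_dist_near (a r k : R) : 0 < k ->
  exists2 eta : R, 0 < eta & forall x, 0 <= x -> 0 <= a -> 0 <= r -> r - eta <= x ->
    expR (- a * x ^+ 2) <= expR (- a * r ^+ 2) + k.
Proof.
move=> k0.
have dh : is_derive (0 : R) 1 (fun t : R => - a * t ^+ 2 + (2 * a * r) * t + (- a * r ^+ 2))
   (2 * - a * 0 + 2 * a * r) := is_derive_quadratic _ _ _ _.
have cont : {for (0 : R), continuous
    (fun t : R => expR (- a * t ^+ 2 + 2 * a * r * t + - a * r ^+ 2))}.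
  apply: (@continuous_comp _ _ _ _ expR); first exact: is_derive_continuous dh.
  exact: continuous_expR.
have /cvgrPdist_lt/(_ k k0)/nbhs_ballP[d /= d0 dP] := cont.
exists (d / 2); first by rewrite divr_gt0.
move=> x x0 a0 r0 rx.
have [xr|rx'] := leP r x.
  apply: (@le_trans _ _ (expR (- a * r ^+ 2))); last by rewrite lerDl ltW.
  by rewrite ler_expR !mulNr lerN2 ler_wpM2l// ler_sqr ?nnegrE.
have := dP (r - x); rewrite /ball/= sub0r normrN ger0_norm; last by move: rx'; clear; lra.
have rxd : r - x < d by move: rx d0; clear; lra.
move=> /(_ rxd); rewrite expr0n /= mulr0 mulr0 !add0r distrC => /(le_lt_trans (ler_norm _)).
have -> : - a * (r - x) ^+ 2 + 2 * a * r * (r - x) + - a * r ^+ 2 = - a * x ^+ 2 by ring.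
by clear; lra.
Qed.

Definition grad2 (pi qi : bool -> R * R -> R) z : R :=
  pi true z ^+ 2 + pi false z ^+ 2 + (qi true z ^+ 2 + qi false z ^+ 2).

Definition jac (pi qi : bool -> R * R -> R) z : R :=
  pi true z * qi false z - pi false z * qi true z.

Lemma grad2_ge0 pi qi z : 0 <= grad2 pi qi z.
Proof. by rewrite /grad2 !addr_ge0 ?sqr_ge0. Qed.

Lemma qc_pullback (K : R) pi qi z (a b : R) : 0 <= K ->
  grad2 pi qi z <= K * `|jac pi qi z| ->
  (a ^+ 2 + b ^+ 2) * grad2 pi qi z <=
    K ^+ 2 * ((a * pi true z + b * qi true z) ^+ 2 +
              (a * pi false z + b * qi false z) ^+ 2).
Proof.
move=> K0; set G := grad2 pi qi z; set J := jac pi qi z => GJ.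
set A := a * pi true z + b * qi true z; set B := a * pi false z + b * qi false z.
have G0 : 0 <= G := grad2_ge0 _ _ _.
have AB0 : 0 <= A ^+ 2 + B ^+ 2 by rewrite addr_ge0 ?sqr_ge0.
have [->|Gn] := eqVneq G 0; first by rewrite mulr0 mulr_ge0 ?sqr_ge0.
have Gp : 0 < G by rewrite lt_neqAle eq_sym Gn.
rewrite -(ler_pM2r Gp).
have ab0 : 0 <= a ^+ 2 + b ^+ 2 by rewrite addr_ge0 ?sqr_ge0.
have h1 : (a ^+ 2 + b ^+ 2) * J ^+ 2 <= (A ^+ 2 + B ^+ 2) * G.
  rewrite -subr_ge0 (_ : _ - _ = (A * qi true z + B * qi false z) ^+ 2 +
      (A * pi true z + B * pi false z) ^+ 2); first by rewrite addr_ge0 ?sqr_ge0.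
  by rewrite /A /B /G /J /grad2 /jac; ring.
have h2 : G ^+ 2 <= K ^+ 2 * J ^+ 2.
  by rewrite -exprMn -(real_normK (num_real (K * J))) normrM (ger0_norm K0) ler_sqr
     ?nnegrE ?mulr_ge0.
rewrite -mulrA -expr2; apply: (le_trans (ler_wpM2l ab0 h2)).
by rewrite mulrCA -[X in _ <= X]mulrA ler_wpM2l// sqr_ge0.
Qed.

(* The absolute value of the Jacobian lets the same estimates serve both orientations. *)
Record qcmap A f pi pii qi qii (K M N : R) : Prop := QCMap {
  qc_jet1 : jet A (fun z => (f z).1) pi pii;
  qc_jet2 : jet A (fun z => (f z).2) qi qii;
  qc_cont1 : {in A, continuous (fun z => (f z).1)};
  qc_cont2 : {in A, continuous (fun z => (f z).2)};
  qc_conti1 : forall i, {in A, continuous (pi i)};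
  qc_conti2 : forall i, {in A, continuous (qi i)};
  qc_qc : forall z, A z -> grad2 pi qi z <= K * `|jac pi qi z|;
  qc_lap1 : forall z, A z -> `|lap pii z| <= M * grad2 pi qi z + N;
  qc_lap2 : forall z, A z -> `|lap qii z| <= M * grad2 pi qi z + N;
  qc_K : 1 <= K; qc_M : 0 <= M; qc_N : 0 <= N }.

Lemma qcmapW A B f pi pii qi qii (K M N : R) : B `<=` A ->
  qcmap A f pi pii qi qii K M N -> qcmap B f pi pii qi qii K M N.
Proof.
move=> BA [j1 j2 c1 c2 d1 d2 h1 h2 h3 K1 M0 N0].
split; try (by []); try exact: jetW BA _.
- by move=> z /[!inE] /BA Az; apply: c1; rewrite inE.
- by move=> z /[!inE] /BA Az; apply: c2; rewrite inE.
- by move=> i z /[!inE] /BA Az; apply: d1; rewrite inE.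
- by move=> i z /[!inE] /BA Az; apply: d2; rewrite inE.
- by move=> z /BA; exact: h1.
- by move=> z /BA; exact: h2.
- by move=> z /BA; exact: h3.
Qed.

Section Fixed.
Variables (A : set (R * R)) (f : R * R -> R * R).
Variables (pi pii qi qii : bool -> R * R -> R) (K M N : R).
Hypothesis qcf : qcmap A f pi pii qi qii K M N.

Let G := grad2 pi qi.

Lemma jet_nsq_comp c : jet A (fun z => nsq (f z - c))
  (fun i z => 2 * (((f z).1 - c.1) * pi i z + ((f z).2 - c.2) * qi i z))
  (fun i z => 2 * (pi i z ^+ 2 + qi i z ^+ 2 +
    (((f z).1 - c.1) * pii i z + ((f z).2 - c.2) * qii i z))).
Proof.
have H := jetD
  (@jet_quadratic _ A _ _ _ 1 0 0 (jetB (qc_jet1 qcf) (@jet_cst _ A c.1)))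
  (@jet_quadratic _ A _ _ _ 1 0 0 (jetB (qc_jet2 qcf) (@jet_cst _ A c.2))).
have E0 : (fun z => nsq (f z - c)) = (fun z =>
    1 * ((f z).1 - c.1) ^+ 2 + 0 * ((f z).1 - c.1) + 0 +
    (1 * ((f z).2 - c.2) ^+ 2 + 0 * ((f z).2 - c.2) + 0)).
  by apply/funext => z; rewrite /nsq /=; ring.
have E1 i : (fun z => 2 * (((f z).1 - c.1) * pi i z + ((f z).2 - c.2) * qi i z)) =
   (fun z => (2 * 1 * ((f z).1 - c.1) + 0) * (pi i z - 0) +
             (2 * 1 * ((f z).2 - c.2) + 0) * (qi i z - 0)).
  by apply/funext => z; ring.
rewrite E0 => i z Az; have [a b] := H i z Az; split.
  by apply: pd_eq a _; ring.
by rewrite E1; apply: pd_eq b _; ring.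
Qed.

Lemma lap_nsq_comp_le c (rho : R) z : A z -> nsq (f z - c) <= rho ^+ 2 -> 0 <= rho ->
  `|lap (fun i z => 2 * (pi i z ^+ 2 + qi i z ^+ 2 +
    (((f z).1 - c.1) * pii i z + ((f z).2 - c.2) * qii i z))) z| <=
  (2 + 4 * rho * M) * G z + 4 * rho * N.
Proof.
move=> Az fr rho0.
have er : en (f z - c) <= rho by rewrite -ler_sqr ?nnegrE ?en_ge0// sqr_en.
have h1 : `|((f z).1 - c.1) * lap pii z| <= rho * (M * G z + N).
  rewrite normrM ler_pM//; last exact: (qc_lap1 qcf).
  exact: le_trans (fst_le_en (f z - c)) er.
have h2 : `|((f z).2 - c.2) * lap qii z| <= rho * (M * G z + N).
  rewrite normrM ler_pM//; last exact: (qc_lap2 qcf).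
  exact: le_trans (snd_le_en (f z - c)) er.
have G0 : 0 <= G z := grad2_ge0 _ _ _.
have -> : lap (fun i z => 2 * (pi i z ^+ 2 + qi i z ^+ 2 +
    (((f z).1 - c.1) * pii i z + ((f z).2 - c.2) * qii i z))) z =
   2 * G z + 2 * (((f z).1 - c.1) * lap pii z + ((f z).2 - c.2) * lap qii z).
  by rewrite /lap /G /grad2; ring.
move: h1 h2; set U := _ * lap pii z; set V := _ * lap qii z.
rewrite !ler_norml => /andP[h1 h2] /andP[h3 h4].
by apply/andP; split; move: G0 h1 h2 h3 h4; clear; lra.
Qed.

Lemma jet_exp_dist c (a r rho : R) : 0 < a -> 0 <= rho ->
  (forall z, A z -> r ^+ 2 <= nsq (f z - c) <= rho ^+ 2) ->
  K ^+ 2 * (2 + 4 * rho * M) <= a * (4 * r ^+ 2) ->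
  exists vi vii, jet A (fun z => expR (- a * nsq (f z - c))) vi vii /\
    forall z, A z -> - (a * (4 * rho * N)) <= lap vii z.
Proof.
move=> a0 rho0 fr aK.
have dexp (s : R) : is_derive s 1 (fun t => expR (- a * t)) (- a * expR (- a * s)).
  have := @is_derive1_comp _ expR (fun t => - a * t) s _ _ (is_derive_expR _)
    (is_derive_scale (- a) (is_derive_id s 1)).
  by rewrite mulr1 mulrC.
have J := @jet_comp _ A _ _ _ (fun t => expR (- a * t))
  (fun t => - a * expR (- a * t)) (fun t => - a * (- a * expR (- a * t)))
  (fun z Az => conj (dexp _) (is_derive_scale (- a) (dexp _))) (jet_nsq_comp c).
eexists; eexists; split; first exact: J.
move=> z Az /=.
have /andP[rf fR] := fr z Az.
have lapb := lap_nsq_comp_le Az fR rho0.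
set x := (f z).1 - c.1; set y := (f z).2 - c.2.
have E0 : nsq (f z - c) = x ^+ 2 + y ^+ 2 by [].
pose e := expR (- a * nsq (f z - c)).
pose L := lap (fun i z => 2 * (pi i z ^+ 2 + qi i z ^+ 2 +
    (((f z).1 - c.1) * pii i z + ((f z).2 - c.2) * qii i z))) z.
pose D := (x * pi true z + y * qi true z) ^+ 2 + (x * pi false z + y * qi false z) ^+ 2.
rewrite -/L in lapb.
rewrite [lap _ _](_ : _ = e * (a * (a * (4 * D) - L))); last first.
  by rewrite /L /D /lap -/x -/y -/e; ring.
have K0 : 0 <= K := le_trans ler01 (qc_K qcf).
have := qc_pullback x y K0 (qc_qc qcf Az); rewrite -/D -/(G z) -E0 => GD.
have G0 : 0 <= G z := grad2_ge0 _ _ _.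
have K20 : 0 < K ^+ 2 by rewrite exprn_gt0// (lt_le_trans ltr01 (qc_K qcf)).
have key : (2 + 4 * rho * M) * G z <= a * (4 * D).
  rewrite -(ler_pM2l K20) [X in X <= _]mulrA; apply: (le_trans (ler_wpM2r G0 aK)).
  rewrite (_ : K ^+ 2 * _ = a * 4 * (K ^+ 2 * D)); last by ring.
  rewrite (_ : a * (4 * r ^+ 2) * G z = a * 4 * (r ^+ 2 * G z)); last by ring.
  rewrite ler_pM2l ?mulr_gt0//; apply: le_trans GD.
  by rewrite ler_wpM2r.
have Lb : - (4 * rho * N) <= a * (4 * D) - L.
  by move: lapb key; rewrite ler_norml => /andP[_]; clear; lra.
have N0 : 0 <= a * (4 * rho * N) by rewrite !mulr_ge0 ?(qc_N qcf) ?(ltW a0).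
have e1 : e <= 1.
  rewrite -expR0 ler_expR mulNr oppr_le0 mulr_ge0 ?(ltW a0)//; exact: nsq_ge0.
have e0 : 0 <= e := expR_ge0 _.
have s1 : - (a * (4 * rho * N)) <= a * (a * (4 * D) - L).
  by rewrite -mulrN ler_pM2l.
have s2 : - (a * (4 * rho * N)) <= e * (- (a * (4 * rho * N))).
  by rewrite mulrN lerN2 ler_piMl.
by apply: (le_trans s2); rewrite ler_wpM2l.
Qed.

End Fixed.

End DistanceEstimate.

Section ExpBarrier.
Variable R : realType.
Implicit Types (z w q n c : R * R) (i : bool) (A S : set (R * R)).
Implicit Types (f : R * R -> R * R).
Implicit Types (pi pii qi qii : bool -> R * R -> R).

Lemma exp_nsq_continuous A f (c : R * R) (a : R) :
  {in A, continuous (fun z => (f z).1)} -> {in A, continuous (fun z => (f z).2)} ->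
  {in A, continuous (fun z => expR (- a * nsq (f z - c)))}.
Proof.
move=> c1 c2 z Az.
apply: (@continuous_comp _ _ _ (fun z => - a * nsq (f z - c)) expR); last exact: continuous_expR.
have h1 : {for z, continuous (fun z => (f z).1 - c.1)}.
  by apply: cvgB; [exact: c1|exact: cvg_cst].
have h2 : {for z, continuous (fun z => (f z).2 - c.2)}.
  by apply: cvgB; [exact: c2|exact: cvg_cst].
apply: (cvgM (cvg_cst _)).
by apply: cvgD; [exact: (cvgM h1 h1)|exact: (cvgM h2 h2)].
Qed.

Lemma exp_barrier_estimate (al K0 L : R) : 0 < al <= 1 -> 1 <= K0 -> 1 <= L ->
  exists2 r1 : R, 0 < r1 & forall K M N r rho a r2 : R,
  0 < r -> 0 <= rho -> 0 < a -> K ^+ 2 * (2 + 4 * rho * M) <= a * (4 * (r / 2) ^+ 2) ->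
  0 < r2 -> 0 <= N ->
  exists2 C : R, 0 < C & forall A S f pi pii qi qii q n c,
  open A -> box_bounded A -> qcmap A f pi pii qi qii K M N ->
  1 <= nsq n -> nsq n <= L ^+ 2 ->
  (forall z, A z -> 0 < nsq (z - q) <= r1 /\
     - (K0 * nsq (z - q) `^ ((1 + al) / 2)) <= dot n (z - q)) ->
  (forall z, A z -> (r / 2) ^+ 2 <= nsq (f z - c) <= rho ^+ 2) ->
  (forall s, S s -> r <= en (s - c)) ->
  (forall zeta, closure A zeta -> ~ A zeta -> r2 <= nsq (zeta - q) \/
     forall eta : R, 0 < eta -> exists2 e : R, 0 < e & forall w, sqr_nbh zeta e w -> A w ->
       exists2 s, S s & en (f w - s) < eta) ->
  forall z, A z -> expR (- a * nsq (f z - c)) <= expR (- a * r ^+ 2) +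
    C * (dot n (z - q) + 2 * K0 * nsq (z - q) `^ ((1 + al) / 2)).
Proof.
move=> al01 K01 L1; have [r1 [c0 [r10 c00 bar]]] := barrier al01 K01 L1.
exists r1 => // K M N r rho a r2 r0 rho0 a0 aK r20 N0.
set g := (1 + al) / 2 in bar *.
have K00 : 0 < K0 := lt_le_trans ltr01 K01.
have g0 : 0 <= g by case/andP: al01 => al0 _; rewrite /g divr_ge0// addr_ge0// ltW.
pose Z := K0 * (r2 / 4) `^ g.
have Z0 : 0 < Z by rewrite /Z mulr_gt0// powR_gt0// divr_gt0.
have N1 : 0 < a * (4 * rho * N) + 1.
  by rewrite ltr_wpDl// mulr_ge0 ?(ltW a0)// mulr_ge0// mulr_ge0.
pose C := (a * (4 * rho * N) + 1) / c0 + 2 / Z.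
have C0 : 0 < C by rewrite /C addr_gt0 ?divr_gt0.
exists C => // A S f pi pii qi qii q n c oA bA qcf n1 nL Aq fr Sr bd.
have [W [Wi [Wii [jW cW HW]]]] := bar q n A n1 nL Aq.
have [vi [vii [jv lv]]] := jet_exp_dist qcf a0 rho0 fr aK.
pose om z := expR (- a * nsq (f z - c)) - (expR (- a * r ^+ 2) + C * W z).
have jom := jetB jv (jetD (@jet_cst _ A (expR (- a * r ^+ 2))) (jetZ C jW)).
have ab1 x : 0 <= x -> expR (- a * x) <= 1.
  by move=> x0; rewrite -expR0 ler_expR mulNr oppr_le0 mulr_ge0// ltW.
have W0 z : A z -> 0 <= W z.
  move=> Az; have [_ h _] := HW z Az; apply: le_trans h.
  by rewrite mulr_ge0 ?powR_ge0// divr_ge0// ltW.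
have om0 z : A z -> om z <= 0.
  apply: (maximum_principle oA bA _ jom).
  - move=> y Ay; apply: cvgB.
      exact: (exp_nsq_continuous (qc_cont1 qcf) (qc_cont2 qcf) Ay).
    apply: cvgD; first exact: cvg_cst.
    by apply: (cvgM (cvg_cst C)); exact: cW.
  - move=> y Ay; have [h _ _] := HW y Ay.
    rewrite (_ : lap _ y = lap vii y - C * lap Wii y); last by rewrite /lap; ring.
    have := lv y Ay.
    have : C * lap Wii y <= C * - c0 by rewrite ler_pM2l.
    have : a * (4 * rho * N) + 1 <= C * c0.
      rewrite /C [(_ / c0 + _) * c0]mulrDl divfK ?gt_eqF// lerDl mulr_ge0 ?(ltW c00)//.
      by rewrite divr_ge0// ltW.
    clear; lra.
  - move=> zeta clz nA k k0; have [zq|zS] := bd zeta clz nA.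
      have /continuous_sqrP cn : {for zeta, continuous (fun z => nsq (z - q))}.
        exact: nsq_continuous.
      have [|e e0 eP] := cn (r2 / 2); first by rewrite divr_gt0.
      exists e => // w /eP wz Aw.
      have wq : r2 / 4 <= nsq (w - q).
        move: wz; rewrite ltr_norml => /andP[]; move: zq r20; clear; lra.
      have [_ Wl _] := HW w Aw.
      have CW : 1 <= C * W w.
        apply: (@le_trans _ _ (2 / Z * (Z / 2))).
          by rewrite mulrA divfK ?gt_eqF// divff.
        apply: ler_pM; rewrite ?divr_ge0 ?(ltW Z0)//.
          by rewrite /C lerDr divr_ge0 ?(ltW c00)// ltW.
        apply: le_trans Wl; rewrite /Z mulrAC ler_wpM2l//; first by rewrite divr_ge0// ltW.
        apply: ge0_ler_powR => //; rewrite nnegrE ?nsq_ge0//.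
        by rewrite divr_ge0// ltW.
      have := ab1 _ (nsq_ge0 (f w - c)); have := expR_gt0 (- a * r ^+ 2).
      move: CW k0; clear; lra.
    have k20 : 0 < k / 2 by rewrite divr_gt0.
    have [eta' eta0' etaP'] := @exp_dist_near R a r (k / 2) k20.
    have [e' e0' eP'] := zS eta' eta0'.
    exists e' => // w zw Aw; have [s Ss fs] := eP' w zw Aw.
    have h : r - eta' <= en (f w - c).
      have := en_tri s (f w) c; have := Sr s Ss; rewrite (en_distC s (f w)).
      by move: fs; clear; lra.
    have := etaP' _ (en_ge0 _) (ltW a0) (ltW r0) h; rewrite sqr_en.
    have := mulr_ge0 (ltW C0) (W0 w Aw); move: k0; clear; lra.
move=> z Az; have := om0 z Az; rewrite /om; have [_ _ Wu] := HW z Az.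
have : C * W z <= C * (dot n (z - q) + 2 * K0 * nsq (z - q) `^ g) by rewrite ler_pM2l.
clear; lra.
Qed.

End ExpBarrier.

Section GradientEstimate.
Variable R : realType.
Implicit Types (z w q n c : R * R) (i : bool) (A S : set (R * R)).
Implicit Types (f : R * R -> R * R).
Implicit Types (pi pii qi qii : bool -> R * R -> R).

Lemma mvt_slide i (u ui : R * R -> R) z (a b B : R) :
  (forall t, Num.min a b <= t <= Num.max a b -> pd i u (slide i z t) (ui (slide i z t))) ->
  (forall t, Num.min a b <= t <= Num.max a b -> `|ui (slide i z t)| <= B) ->
  `|u (slide i z b) - u (slide i z a)| <= B * `|b - a|.
Proof.
wlog ab : a b / a <= b.
  move=> H; have /orP[ab|ba] := le_total a b; first exact: H a b ab.
  rewrite minC maxC => h1 h2; rewrite distrC (distrC b).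
  exact: H b a ba h1 h2.
rewrite min_l// max_r// => du uB.
have [||c] := @MVT_segment _ (fun t => u (slide i z t)) (fun t => ui (slide i z t)) a b ab.
- move=> x; rewrite in_itv/= => /andP[ax xb]; apply: pd_slide; apply: du.
  by rewrite !ltW.
- apply: derivable_within_continuous => x; rewrite in_itv/= => xab.
  by have [] := pd_slide (du x xab).
rewrite in_itv/= => cab ->; rewrite normrM ler_wpM2r//; exact: uB.
Qed.

Lemma lipschitz_square (u : R * R -> R) ui z w (e B : R) :
  (forall i z', sqr_nbh z e z' -> pd i u z' (ui i z')) ->
  (forall i z', sqr_nbh z e z' -> `|ui i z'| <= B) -> sqr_nbh z e w ->
  `|u w - u z| <= B * (`|w.1 - z.1| + `|w.2 - z.2|).
Proof.
move=> du uB [w1 w2].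
have e0 : 0 < e := le_lt_trans (normr_ge0 _) w1.
have btw (a b t : R) : `|b - a| < e -> Num.min a b <= t <= Num.max a b -> `|t - a| < e.
  rewrite ltr_distl ge_min le_max ltr_distl => /andP[h1 h2] /andP[/orP h3 /orP h4].
  by apply/andP; split; case: h3; case: h4; move: h1 h2 e0; clear; lra.
have h1 : `|u (w.1, z.2) - u z| <= B * `|w.1 - z.1|.
  have := @mvt_slide true u (ui true) z z.1 w.1 B; rewrite /slide -surjective_pairing.
  by apply=> t /(btw _ _ _ w1) tz; [apply: du|apply: uB]; split; rewrite //= subrr normr0.
have h2 : `|u w - u (w.1, z.2)| <= B * `|w.2 - z.2|.
  have := @mvt_slide false u (ui false) w z.2 w.2 B; rewrite /slide -surjective_pairing.
  by apply=> t /(btw _ _ _ w2) tz; [apply: du|apply: uB]; split.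
rewrite (_ : _ - _ = (u w - u (w.1, z.2)) + (u (w.1, z.2) - u z)); last first.
  by rewrite addrA subrK.
by apply: le_trans (ler_normD _ _) _; rewrite mulrDr addrC lerD.
Qed.

Lemma connected_setX (T U : topologicalType) (A : set T) (B : set U) :
  connected A -> connected B -> connected (A `*` B).
Proof.
move=> cA cB.
have [->|/set0P[[a0 b0] [/= Aa0 Bb0]]] := eqVneq (A `*` B) set0; first exact: connected0.
have -> : A `*` B = \bigcup_(b in B) (((fun a => (a, b)) @` A) `|` ((fun b => (a0, b)) @` B)).
  apply/seteqP; split => [[a b] [/= Aa Bb]|[a b] [b' Bb' /=]].
    by exists b => //; left; exists a.
  by case=> -[x hx [<- <-]]; split.
apply: bigcup_connected.
  by exists (a0, b0) => b Bb; right; exists b0.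
move=> b Bb; apply: connectedU.
- by exists (a0, b); split; [exists a0|exists b].
- apply: connected_continuous_connected => //; apply: continuous_subspaceT => x.
  by apply: cvg_pair => //; exact: cvg_cst.
- apply: connected_continuous_connected => //; apply: continuous_subspaceT => x.
  by apply: cvg_pair => //; exact: cvg_cst.
Qed.

Lemma sqr_nbh_connected z (e : R) : connected (sqr_nbh z e).
Proof.
have -> : sqr_nbh z e = (`]z.1 - e, z.1 + e[ `*` `]z.2 - e, z.2 + e[)%classic.
  by apply/seteqP; split=> w; rewrite /sqr_nbh /= !in_itv/= !ltr_distl => -[].
by apply: connected_setX; apply/connected_intervalP; exact: interval_is_interval.
Qed.

End GradientEstimate.

(** * Gradient estimate at the scale of the distance to the boundary *)
Section Bernstein.
Variable R : realType.
Implicit Types (z w q n c : R * R) (i : bool) (A S E : set (R * R)).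
Implicit Types (f : R * R -> R * R).
Implicit Types (pi pii qi qii : bool -> R * R -> R).

(* The point w lies at depth delta = dist(w, S) in the ball B(c, r), which misses S; a connected set
   avoiding S and containing w leaves this ball at most quadratically. *)
Definition ball_geometry S (r eps C : R) : Prop :=
  forall w, ~ S w -> (exists2 s, S s & en (w - s) < eps) ->
  exists delta c, [/\ 0 <= delta, en (w - c) = r - delta,
    (forall s, S s -> r <= en (s - c)),
    (forall s, S s -> delta <= en (w - s)) /\ (exists2 s, S s & en (w - s) = delta) &
    forall E, connected E -> E w ->
      (forall w', E w' -> ~ S w' /\ en (w' - w) <= eps) ->
      forall w', E w' -> nsq (w' - c) - r ^+ 2 <= C * (en (w' - w) + delta) ^+ 2].

Lemma grad2_comp pi qi i z (B : R) : 0 <= B -> grad2 pi qi z <= B ^+ 2 ->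
  `|pi i z| <= B /\ `|qi i z| <= B.
Proof.
move=> B0 GB; rewrite -!(@ler_sqr _ `|_|) ?nnegrE//.
rewrite !real_normK ?num_real//; move: GB; rewrite /grad2.
have h (j : bool) : 0 <= pi j z ^+ 2 /\ 0 <= qi j z ^+ 2 by rewrite !sqr_ge0.
have [h1 h2] := h true; have [h3 h4] := h false.
by case: i; split; move: h1 h2 h3 h4 GB; clear; lra.
Qed.

Lemma continuous_pair f z : {for z, continuous (fun z => (f z).1)} ->
  {for z, continuous (fun z => (f z).2)} -> {for z, continuous f}.
Proof.
move=> c1 c2; have -> : f = (fun y => ((f y).1, (f y).2)).
  by apply/funext => y; rewrite -surjective_pairing.
exact: (cvg_pair c1 c2).
Qed.

Lemma bernstein_step S r eps C A f pi pii qi qii (K M N : R) z (rho eta t Lam : R) :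
  qcmap A f pi pii qi qii K M N -> ball_geometry S r eps C -> 0 < r -> 0 <= C ->
  (forall z', A z' -> ~ S (f z')) ->
  (forall z', A z' -> exists2 s, S s & en (f z' - s) <= eta) ->
  eta < eps -> eta <= r / 2 -> eta <= 1 -> 0 < t -> t <= 1 / 2 -> 0 <= Lam ->
  0 < rho -> sqr_nbh z (t * rho) `<=` A ->
  (forall z', sqr_nbh z (t * rho) z' -> grad2 pi qi z' <= (2 * Lam / rho) ^+ 2) ->
  grad2 pi qi z = (Lam / rho) ^+ 2 -> 8 * (t * Lam) <= eps -> 8 * (t * Lam) <= r ->
  r * Lam <= 8 * K * ((2 * r + 2 * C) * (eta / t) + 128 * C * (t * Lam ^+ 2)) +
    K / 2 * t * ((8 + 32 * r * M) * Lam ^+ 2 + (8 * r * N + 1) * rho ^+ 2).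
Proof.
move=> qcf geo r0 C0 nS distS etae etar eta1 t0 t2 Lam0 rho0 zA Gle Gz tLe tLr.
have K0 : 0 < K := lt_le_trans ltr01 (qc_K qcf).
have M0 := qc_M qcf; have N0 := qc_N qcf.
have tr0 : 0 < t * rho by rewrite mulr_gt0.
have zz := sqr_nbh_refl z tr0.
have Az := zA _ zz.
have eta0 : 0 <= eta by have [s _] := distS z Az; apply: le_trans; exact: en_ge0.
have [|delta [c [d0 wc Sc [dS _] conE]]] := geo (f z) (nS z Az).
  by have [s Ss fs] := distS z Az; exists s => //; exact: le_lt_trans etae.
have deta : delta <= eta.
  by have [s Ss fs] := distS z Az; apply: le_trans (dS s Ss) fs.
pose Q := sqr_nbh z (t * rho).
have L2 : 0 <= 2 * Lam / rho by rewrite divr_ge0 ?mulr_ge0// ltW.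
have fdist w : Q w -> en (f w - f z) <= 8 * (t * Lam).
  move=> Qw; apply: le_trans (en_le_sum _) _ => /=.
  have h1 := @lipschitz_square _ _ pi z w (t * rho) (2 * Lam / rho)
    (fun i z' Qz' => (qc_jet1 qcf i (zA _ Qz')).1)
    (fun i z' Qz' => (grad2_comp i L2 (Gle _ Qz')).1) Qw.
  have h2 := @lipschitz_square _ _ qi z w (t * rho) (2 * Lam / rho)
    (fun i z' Qz' => (qc_jet2 qcf i (zA _ Qz')).1)
    (fun i z' Qz' => (grad2_comp i L2 (Gle _ Qz')).2) Qw.
  have h3 : 2 * Lam / rho * (`|w.1 - z.1| + `|w.2 - z.2|) <= 4 * (t * Lam).
    have -> : 4 * (t * Lam) = 2 * Lam / rho * (2 * (t * rho)) by field; rewrite gt_eqF.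
    by apply: ler_wpM2l => //; case: Qw => /ltW + /ltW; clear; lra.
  by move: h1 h2 h3; clear; lra.
have fc w : Q w -> en (f w - c) <= 2 * r.
  move=> Qw; have := en_tri (f w) (f z) c; have := fdist w Qw; rewrite wc.
  by move: tLr d0; clear; lra.
have fc2 w : Q w -> nsq (f w - c) <= (2 * r) ^+ 2.
  by move=> Qw; rewrite -sqr_en ler_sqr ?nnegrE ?en_ge0 ?mulr_ge0 ?(ltW r0)// fc.
pose U := (2 * r + 2 * C) * eta + 128 * C * (t * Lam) ^+ 2.
have eta2 : eta ^+ 2 <= eta by rewrite expr2 ler_piMl.
have upper w : Q w -> nsq (f w - c) - r ^+ 2 <= U.
  move=> Qw; have h1 : nsq (f w - c) - r ^+ 2 <= C * (en (f w - f z) + delta) ^+ 2.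
    apply: (conE (f @` Q)).
    - apply: connected_continuous_connected; first exact: sqr_nbh_connected.
      apply: continuous_in_subspaceT => y /[!inE] Qy; apply: continuous_pair.
        by apply: (qc_cont1 qcf); rewrite inE; exact: zA.
      by apply: (qc_cont2 qcf); rewrite inE; exact: zA.
    - by exists z.
    - move=> _ [y Qy <-]; split; first exact/nS/zA.
      exact: le_trans (fdist y Qy) tLe.
    - by exists w.
  apply: (le_trans h1).
  have h2 : (en (f w - f z) + delta) ^+ 2 <= (8 * (t * Lam) + eta) ^+ 2.
    rewrite ler_sqr ?nnegrE ?addr_ge0 ?en_ge0 ?mulr_ge0 ?(ltW t0)//.
    by apply: lerD => //; exact: fdist.
  have h3 : (8 * (t * Lam) + eta) ^+ 2 <= 128 * (t * Lam) ^+ 2 + 2 * eta.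
    have := sqr_ge0 (8 * (t * Lam) - eta); move: eta2; clear.
    by set x := t * Lam; rewrite !sqrrD ?sqrrN ?exprMn; lra.
  apply: (le_trans (ler_wpM2l C0 (le_trans h2 h3))).
  by rewrite /U; have := mulr_ge0 (ltW r0) eta0; clear; lra.
have lower w : A w -> - U <= nsq (f w - c) - r ^+ 2.
  move=> Aw; have [s Ss fs] := distS w Aw.
  have h1 : r - eta <= en (f w - c).
    have := en_tri s (f w) c; have := Sc s Ss; rewrite (en_distC s (f w)).
    by move: fs; clear; lra.
  have h2 : (r - eta) ^+ 2 <= nsq (f w - c).
    rewrite -sqr_en ler_sqr ?nnegrE ?en_ge0//.
    by move: etar r0; clear; lra.
  have h3 : 0 <= C * eta by rewrite mulr_ge0.
  have h4 : 0 <= C * (t * Lam) ^+ 2 by rewrite mulr_ge0// sqr_ge0.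
  have := sqr_ge0 eta.
  by move: h2 h3 h4; rewrite /U sqrrD sqrrN; clear; lra.
have U0 : 0 <= U by have := upper z zz; have := lower z Az; clear; lra.
pose N1 := (2 + 4 * (2 * r) * M) * (2 * Lam / rho) ^+ 2 + 4 * (2 * r) * N + 1.
have r20 : 0 <= 2 * r by rewrite mulr_ge0// ltW.
pose V := 2 * U / (t * rho / 2) + N1 * (t * rho / 2) / 2.
have grad i : `|2 * (((f z).1 - c.1) * pi i z + ((f z).2 - c.2) * qi i z)| <= V.
  have jn := jetW zA (jetB (jet_nsq_comp qcf c) (@jet_cst _ A (r ^+ 2))).
  rewrite -[X in `|X|]subr0.
  apply: (interior_gradient i _ _ _ jn).
  - by rewrite divr_gt0.
  - by move: tr0; clear; lra.
  - move=> y /[!inE] /zA Ay; apply: cvgB; last exact: cvg_cst.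
    have h1 : {for y, continuous (fun z => (f z).1 - c.1)}.
      by apply: cvgB; [apply: (qc_cont1 qcf); rewrite inE|exact: cvg_cst].
    have h2 : {for y, continuous (fun z => (f z).2 - c.2)}.
      by apply: cvgB; [apply: (qc_cont2 qcf); rewrite inE|exact: cvg_cst].
    by apply: cvgD; [exact: (cvgM h1 h1)|exact: (cvgM h2 h2)].
  - by move=> y Qy; rewrite ler_norml lower ?upper//; exact: zA.
  - move=> y Qy.
    have := lap_nsq_comp_le qcf (zA _ Qy) (fc2 _ Qy) r20.
    rewrite (_ : lap _ y = lap (fun i z => 2 * (pi i z ^+ 2 + qi i z ^+ 2 +
      (((f z).1 - c.1) * pii i z + ((f z).2 - c.2) * qii i z)) - 0) y); last first.
      by rewrite /lap !subr0.
    move=> h; apply: (le_lt_trans h); rewrite /N1.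
    have : (2 + 4 * (2 * r) * M) * grad2 pi qi y <= (2 + 4 * (2 * r) * M) * (2 * Lam / rho) ^+ 2.
      apply: ler_wpM2l; last exact: Gle.
      by rewrite addr_ge0// !mulr_ge0// ltW.
    by clear; lra.
have V0 : 0 <= V := le_trans (normr_ge0 _) (grad true).
have ngr : r / 2 <= en (f z - c) by rewrite wc; move: deta etar; clear; lra.
have r40 : 0 <= r / 2 by rewrite divr_ge0// ltW.
have key : (r / 2 * (Lam / rho)) ^+ 2 <= (K * V) ^+ 2.
  rewrite exprMn -Gz.
  have h1 : (r / 2) ^+ 2 <= nsq (f z - c) by rewrite -sqr_en ler_sqr ?nnegrE ?en_ge0.
  apply: (le_trans (ler_wpM2r (grad2_ge0 _ _ _) h1)).
  have := qc_pullback ((f z).1 - c.1) ((f z).2 - c.2) (ltW K0) (qc_qc qcf Az).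
  move=> /le_trans; apply; rewrite exprMn; apply: ler_wpM2l; first exact: sqr_ge0.
  have g i : (((f z).1 - c.1) * pi i z + ((f z).2 - c.2) * qi i z) ^+ 2 <= V ^+ 2 / 4.
    have := grad i; rewrite -(@ler_sqr _ `|_|) ?nnegrE// real_normK ?num_real//.
    by rewrite exprMn; clear; lra.
  by have := g true; have := g false; have := sqr_ge0 V; clear; lra.
have LR0 : 0 <= Lam / rho by rewrite divr_ge0// ltW.
have : r / 2 * (Lam / rho) <= K * V.
  by rewrite -ler_sqr ?nnegrE ?(mulr_ge0 r40 LR0) ?(mulr_ge0 (ltW K0) V0).
have r2pos : 0 < 2 * rho by rewrite mulr_gt0.
rewrite -(ler_pM2l r2pos) (_ : 2 * rho * (r / 2 * _) = r * Lam); last first.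
  by field; rewrite gt_eqF.
move=> /le_trans; apply; rewrite le_eqVlt; apply/orP; left; apply/eqP.
by rewrite /V /U /N1; field; rewrite !gt_eqF.
Qed.

End Bernstein.

Section Bernstein2.
Variable R : realType.
Implicit Types (z w q n c : R * R) (i : bool) (A S E : set (R * R)).
Implicit Types (f : R * R -> R * R).
Implicit Types (pi pii qi qii : bool -> R * R -> R).

Definition l1dist z w : R := `|z.1 - w.1| + `|z.2 - w.2|.

Lemma l1dist_continuous w : continuous (l1dist ^~ w).
Proof.
move=> z.
have h1 : {for z, continuous (fun z : R * R => z.1 - w.1)}.
  by apply: cvgB; [exact: cvg_fst|exact: cvg_cst].
have h2 : {for z, continuous (fun z : R * R => z.2 - w.2)}.
  by apply: cvgB; [exact: cvg_snd|exact: cvg_cst].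
by apply: cvgD; apply: cvg_norm; [exact: h1|exact: h2].
Qed.

Lemma sqrt_grad2_continuous pi qi z : (forall i, {for z, continuous (pi i)}) ->
  (forall i, {for z, continuous (qi i)}) ->
  {for z, continuous (fun z => Num.sqrt (grad2 pi qi z))}.
Proof.
move=> cp cq; apply: (@continuous_comp _ _ _ (grad2 pi qi) (@Num.sqrt R)).
  apply: cvgD; apply: cvgD.
  - exact: (cvgM (cp true) (cp true)).
  - exact: (cvgM (cp false) (cp false)).
  - exact: (cvgM (cq true) (cq true)).
  - exact: (cvgM (cq false) (cq false)).
exact: sqrt_continuous.
Qed.

Lemma bernstein_estimate S (r eps C K M N Cd : R) : ball_geometry S r eps C ->
  0 < r -> 0 < eps -> 0 <= C -> 1 <= K -> 0 <= M -> 0 <= N -> 0 <= Cd ->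
  exists2 dbar : R, 0 < dbar & exists B : R,
  forall f pi pii qi qii z0 (d0 d1 : R), 0 < d0 -> d0 <= dbar -> d0 < d1 ->
  qcmap (sqr_nbh z0 d1) f pi pii qi qii K M N ->
  (forall z, sqr_nbh z0 d1 z -> ~ S (f z)) ->
  (forall z, sqr_nbh z0 d1 z -> exists2 s, S s & en (f z - s) <= Cd * d0) ->
  grad2 pi qi z0 <= B.
Proof.
move=> geo r0 eps0 C0 K1 M0 N0 Cd0.
have K0 : 0 < K := lt_le_trans ltr01 K1.
have [F1 F1E] : {x : R | x = 8 * K * (2 * r + 2 * C) * Cd + K / 2 * (8 * r * N + 1)} by eexists.
have [F2 F2E] : {x : R | x = 1024 * K * C + K / 2 * (8 + 32 * r * M)} by eexists.
have F10 : 0 <= F1.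
  by rewrite F1E addr_ge0// !mulr_ge0 ?addr_ge0 ?invr_ge0 ?mulr_ge0// ltW.
have F20 : 0 < F2.
  have h1 : 0 <= 1024 * K * C := mulr_ge0 (mulr_ge0 (ler0n _ _) (ltW K0)) C0.
  have h2 : 0 <= 32 * r * M := mulr_ge0 (mulr_ge0 (ler0n _ _) (ltW r0)) M0.
  have h3 : 0 <= K / 2 * (32 * r * M) := mulr_ge0 (divr_ge0 (ltW K0) (ler0n _ _)) h2.
  by rewrite F2E; move: h1 h3 K0; clear; lra.
have [l0 l0E] : {x : R | x = Num.min (Num.min r eps / 8) (r / F2)} by eexists.
have mre : 0 < Num.min r eps by rewrite lt_min r0.
have l00 : 0 < l0 by rewrite l0E lt_min !divr_gt0.
have l0re : 8 * l0 <= Num.min r eps.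
  by rewrite mulrC -ler_pdivlMr// l0E ge_min lexx.
have l0r : 8 * l0 <= r by apply: le_trans l0re _; rewrite ge_min lexx.
have l0e : 8 * l0 <= eps by apply: le_trans l0re _; rewrite ge_min lexx orbT.
have l0F : F2 * l0 <= r by rewrite mulrC -ler_pdivlMr// l0E ge_min lexx orbT.
have [m mE] : {x : R | x = Num.min (Num.min (eps / 2) (r / 2)) 1} by eexists.
have m0 : 0 < m by rewrite mE !lt_min !divr_gt0// ?ltr01.
have [dbar dbarE] : {x : R | x = Num.min (Num.min 1 (m / (Cd + 1))) (r * l0 / (8 * F1 + 1))} by eexists.
have Cd1 : 0 < Cd + 1 by rewrite ltr_wpDl.
have F11 : 0 < 8 * F1 + 1 by rewrite ltr_wpDl// mulr_ge0.
exists dbar; first by rewrite dbarE !lt_min ltr01 !divr_gt0// mulr_gt0.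
exists ((8 * F1 / r) ^+ 2) => f pi pii qi qii z0 d0 d1 d00.
rewrite dbarE !le_min => /andP[/andP[d01 d0m] d0l] d0d1 qcf nS distS.
have etam : Cd * d0 <= m.
  apply: le_trans (_ : (Cd + 1) * d0 <= m); first by rewrite ler_wpM2r ?(ltW d00)// lerDl.
  by rewrite mulrC -ler_pdivlMr.
have eta1 : Cd * d0 <= 1 by apply: le_trans etam _; rewrite mE ge_min lexx orbT.
have etar : Cd * d0 <= r / 2.
  by apply: le_trans etam _; rewrite mE !ge_min lexx !orbT.
have etae : Cd * d0 < eps.
  apply: le_lt_trans (_ : eps / 2 < eps); last by move: eps0; clear; lra.
  by apply: le_trans etam _; rewrite mE !ge_min lexx.
have d0F : 8 * F1 * d0 < r * l0.
  have h : (8 * F1 + 1) * d0 <= r * l0 by rewrite mulrC -ler_pdivlMr.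
  by move: h d00; clear; lra.
pose Q := [set z | l1dist z z0 <= d0].
have QA : Q `<=` sqr_nbh z0 d1.
  move=> z; rewrite /Q/= /l1dist => h.
  have h1 := normr_ge0 (z.1 - z0.1); have h2 := normr_ge0 (z.2 - z0.2).
  by split; move: h h1 h2 d0d1; clear; lra.
have cQ : closed Q.
  rewrite (_ : Q = (l1dist ^~ z0) @^-1` [set x | x <= d0])//.
  apply: closed_comp; first by move=> z _; exact: l1dist_continuous.
  exact: closed_le.
have bQ : box_bounded Q.
  exists (`|z0.1| + `|z0.2| + d1) => z /QA[/ltW h1 /ltW h2].
  have n1 := ler_normD (z.1 - z0.1) z0.1; have n2 := ler_normD (z.2 - z0.2) z0.2.
  rewrite !subrK in n1 n2.
  have n3 := normr_ge0 z0.1; have n4 := normr_ge0 z0.2.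
  by split; move: n1 n2 n3 n4 h1 h2; clear; lra.
pose Gam z := Num.sqrt (grad2 pi qi z).
pose rho z := d0 - l1dist z z0.
pose Th z := rho z * Gam z.
have Gam0 z : 0 <= Gam z := sqrtr_ge0 _.
have Gam2 z : Gam z ^+ 2 = grad2 pi qi z by rewrite sqr_sqrtr// grad2_ge0.
have z0Q : Q z0 by rewrite /Q/= /l1dist !subrr !normr0 addr0 ltW.
have cTh : {within Q, continuous Th}.
  apply: continuous_in_subspaceT => z /[!inE] /QA Qz.
  have ct : {for z, continuous rho}.
    by apply: cvgB; [exact: cvg_cst|exact: l1dist_continuous].
  apply: (cvgM ct); apply: sqrt_grad2_continuous => i.
    by apply: (qc_conti1 qcf); rewrite inE.
  by apply: (qc_conti2 qcf); rewrite inE.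
have Q0 : Q !=set0 by exists z0.
have [z1 /[!inE] Qz1 mx] := compact_EVT_max Q0 (compact_closed_bounded cQ bQ) cTh.
set Lam := Th z1 in mx.
have mx' z : Q z -> Th z <= Lam by move=> Qz; apply: mx; rewrite inE.
have rho1 : 0 <= rho z1 by rewrite /rho subr_ge0.
have Lam0 : 0 <= Lam by rewrite /Lam /Th mulr_ge0.
have Thz0 : Th z0 = d0 * Gam z0 by rewrite /Th /rho /l1dist !subrr !normr0 addr0 subr0.
suff LE : Lam <= 8 * F1 / r * d0.
  have : d0 * Gam z0 <= d0 * (8 * F1 / r).
    by rewrite -Thz0 (mulrC d0); apply: le_trans (mx' _ z0Q) LE.
  rewrite ler_pM2l// => h; rewrite -Gam2 ler_sqr ?nnegrE//.
  exact: le_trans h.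
have FB0 : 0 <= 8 * F1 / r * d0 by rewrite !mulr_ge0 ?(ltW d00)// invr_ge0 ltW.
have [->//|Lamn] := eqVneq Lam 0.
have Lamp : 0 < Lam by rewrite lt_neqAle eq_sym Lamn.
have rho1p : 0 < rho z1.
  rewrite lt_neqAle rho1 andbT eq_sym; apply: contra_neq Lamn => h.
  by rewrite /Lam /Th h mul0r.
have rhod : rho z1 <= d0.
  by rewrite /rho gerBl /l1dist addr_ge0.
have step t : 0 < t -> t <= 1 / 4 -> 8 * (t * Lam) <= eps -> 8 * (t * Lam) <= r ->
    r * Lam <= F1 * (d0 / t) + F2 * (t * Lam ^+ 2).
  move=> t0 t4 te tr.
  have sub z : sqr_nbh z1 (t * rho z1) z -> rho z1 / 2 <= rho z.
    move=> [h1 h2].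
    have n1 := ler_normD (z.1 - z1.1) (z1.1 - z0.1).
    have n2 := ler_normD (z.2 - z1.2) (z1.2 - z0.2).
    rewrite !addrA !subrK in n1 n2.
    have h3 : t * rho z1 <= 1 / 4 * rho z1 by rewrite ler_wpM2r.
    by move: n1 n2 h1 h2 h3; rewrite /rho /l1dist; clear; lra.
  have subQ z : sqr_nbh z1 (t * rho z1) z -> Q z.
    by move=> /sub; rewrite /rho /Q /=; move: rho1p; rewrite /rho; clear; lra.
  have := @bernstein_step _ S r eps C (sqr_nbh z0 d1) f pi pii qi qii K M N z1
    (rho z1) (Cd * d0) t Lam qcf geo r0 C0 nS distS etae etar eta1 t0.
  have t2 : t <= 1 / 2 by move: t4; clear; lra.
  move=> /(_ t2 Lam0 rho1p (fun z h => QA _ (subQ z h))).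
  have Gle z : sqr_nbh z1 (t * rho z1) z -> grad2 pi qi z <= (2 * Lam / rho z1) ^+ 2.
    move=> hz; rewrite -Gam2 ler_sqr ?nnegrE ?divr_ge0 ?mulr_ge0//.
    rewrite ler_pdivlMr//; have := mx' z (subQ z hz); rewrite /Th.
    have := ler_wpM2r (Gam0 z) (sub z hz); clear; lra.
  have Gz1 : grad2 pi qi z1 = (Lam / rho z1) ^+ 2.
    by rewrite -Gam2 /Lam /Th mulrAC divff ?mul1r// gt_eqF.
  move=> /(_ Gle Gz1 te tr) /le_trans; apply.
  have h1 : t * rho z1 ^+ 2 <= d0 / t.
    apply: (@le_trans _ _ (1 * d0)).
      apply: ler_pM => //; rewrite ?(ltW t0) ?sqr_ge0//; first by move: t4; clear; lra.
      by rewrite expr2 (le_trans _ rhod)// ler_piMl// (le_trans rhod).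
    rewrite mulrC ler_wpM2l ?(ltW d00)// -[1]invr1 lef_pV2 ?posrE//.
    by move: t4; clear; lra.
  have k0 : 0 <= K / 2 * (8 * r * N + 1).
    by rewrite mulr_ge0 ?divr_ge0 ?(ltW K0)// addr_ge0// !mulr_ge0// ltW.
  have := ler_wpM2l k0 h1.
  rewrite F1E F2E; rewrite -subr_ge0 => h.
  rewrite -subr_ge0; apply: le_trans h _; rewrite le_eqVlt; apply/orP; left; apply/eqP.
  by field; rewrite gt_eqF.
clearbody Lam.
have LE2 (t : R) : t * Lam <= l0 -> F2 * (t * Lam ^+ 2) <= r * Lam.
  move=> tl; rewrite (_ : F2 * _ = F2 * (t * Lam) * Lam); last by ring.
  apply: ler_wpM2r => //.
  by apply: le_trans l0F; rewrite ler_pM2l.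
rewrite -(ler_pM2l r0) (_ : r * (8 * F1 / r * d0) = 8 * F1 * d0); last first.
  by field; rewrite gt_eqF.
have t40 : 0 < 1 / 4 :> R by rewrite divr_gt0.
have [Ll|lL] := leP Lam l0.
  have tl : 8 * (1 / 4 * Lam) <= 8 * l0 by move: Ll l00; clear; lra.
  have := step (1 / 4) t40 (lexx _) (le_trans tl l0e) (le_trans tl l0r).
  have h : F2 * (1 / 4 * Lam ^+ 2) <= r * Lam / 4.
    by have := LE2 1; rewrite !mul1r => /(_ Ll); clear; lra.
  rewrite (_ : d0 / (1 / 4) = 4 * d0); last by field.
  have : 0 <= F1 * d0 by rewrite mulr_ge0 ?(ltW d00).
  by move: h; clear; lra.
exfalso.
pose t := l0 / (4 * Lam).
have t0 : 0 < t by rewrite /t divr_gt0// mulr_gt0.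
have tL : t * Lam = l0 / 4 by rewrite /t; field; rewrite gt_eqF.
have t4 : t <= 1 / 4.
  rewrite /t ler_pdivrMr; last by rewrite mulr_gt0.
  by rewrite mulrA divfK ?mul1r ?ltW.
have tl : 8 * (t * Lam) <= 8 * l0 by rewrite tL; move: l00; clear; lra.
have := step t t0 t4 (le_trans tl l0e) (le_trans tl l0r).
have h : F2 * (t * Lam ^+ 2) <= r * Lam / 4.
  have := LE2 (4 * t); have -> : 4 * t * Lam = l0 by rewrite -mulrA tL; field.
  move=> /(_ (lexx _)) h; rewrite ler_pdivlMr//; apply: le_trans h.
  by rewrite le_eqVlt; apply/orP; left; apply/eqP; ring.
have h2 : l0 * (F1 * (d0 / t)) = 4 * F1 * d0 * Lam.
  by rewrite /t; field; rewrite !gt_eqF.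
have h3 : 4 * F1 * d0 * Lam <= r * l0 / 2 * Lam.
  by rewrite ler_wpM2r//; move: d0F; clear; lra.
rewrite -(ler_pM2l l00) mulrDr h2.
have h4 := ler_wpM2l (ltW l00) h.
have h5 : 0 < r * l0 * Lam := mulr_gt0 (mulr_gt0 r0 l00) Lamp.
by move: h3 h4 h5; clear; lra.
Qed.

End Bernstein2.

(** * Energy estimate excluding infinite boundary values *)
Section IntegralOverSegments.
Variable R : realType.
Local Notation mu := (@lebesgue_measure R).

Lemma continuous_on_segment_integrable (h : R -> R) (c d : R) :
  (forall y, c <= y <= d -> {for y, continuous h}) ->
  mu.-integrable `[c, d] (EFin \o h).
Proof.
move=> ch; apply: continuous_compact_integrable; first exact: segment_compact.
by apply: continuous_in_subspaceT => y; rewrite inE/= in_itv/=; exact: ch.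
Qed.

Lemma exists_antiderivative (h : R -> R) (c d : R) : c < d ->
  (forall y, c <= y <= d -> {for y, continuous h}) ->
  exists P : R -> R, [/\ {within `[c, d], continuous P},
    (forall y, c < y < d -> is_derive y 1 P (h y)) &
    P d - P c = \int[mu]_(y in `[c, d]) h y].
Proof.
move=> cd ch; exists (fun x => \int[mu]_(t in `[c, x]) h t).
have ih := continuous_on_segment_integrable ch.
split.
- exact: (parameterized_integral_continuous (ltW cd) ih).
- move=> y /andP[cy yd].
  have [|dP <-] := @continuous_FTC1_closed _ h c y d yd ih cy.
    by apply: ch; rewrite !ltW.
  by rewrite derive1E; exact/derivableP.
- by rewrite set_itv1 Rintegral_set1 subr0.
Qed.

Lemma increment_le (P p H h : R -> R) (c d a b : R) : c <= a -> a <= b -> b <= d ->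
  {within `[c, d], continuous P} -> (forall y, c < y < d -> is_derive y 1 P (p y)) ->
  (forall y, c <= y <= d -> is_derive y 1 H (h y)) ->
  (forall y, a <= y <= b -> p y <= h y) -> P b - P a <= H b - H a.
Proof.
move=> ca ab bd cP dP dH ph.
have [||x] := @MVT_segment _ (fun y => P y - H y) (fun y => p y - h y) a b ab.
- move=> x; rewrite in_itv/= => /andP[ax xb].
  by apply: is_deriveB; [apply: dP|apply: dH]; apply/andP; split; move: ca bd ax xb; clear; lra.
- have sub : `[a, b] `<=` `[c, d].
    by move=> x /=; rewrite !in_itv/= => /andP[? ?]; apply/andP; split;
      [exact: le_trans ca _|exact: le_trans bd].
  move=> x; apply: continuousB; first exact: (continuous_subspaceW sub cP).
  apply: derivable_within_continuous => y; rewrite in_itv/= => /andP[ay yb].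
  by have [] // := dH y; rewrite (le_trans ca ay) (le_trans yb bd).
rewrite in_itv/= => xab E.
have : (p x - h x) * (b - a) <= 0.
  by rewrite mulr_le0_ge0 ?subr_le0 ?subr_ge0 ?ph.
by rewrite -E; clear; lra.
Qed.

Lemma slice_continuous (V : R * R -> R) x y : {for (x, y), continuous V} ->
  {for y, continuous (fun t => V (x, t))}.
Proof.
move=> /continuous_sqrP cV; apply/cvgrPdist_lt => e e0; have [d d0 dV] := cV e e0.
apply/nbhs_ballP; exists d => // t; rewrite /ball/= => h; rewrite distrC.
by apply: dV; split; rewrite /= ?subrr ?normr0// distrC.
Qed.

Lemma leibniz_segment (V Vx : R * R -> R) (u v c d : R) :
  (forall x y, u <= x <= v -> c <= y <= d -> {for (x, y), continuous V}) ->
  (forall x y, u <= x <= v -> c <= y <= d -> {for (x, y), continuous Vx}) ->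
  (forall x y, u <= x <= v -> c <= y <= d -> pd true V (x, y) (Vx (x, y))) ->
  forall x, u < x < v -> is_derive x 1 (fun x => \int[mu]_(y in `[c, d]) V (x, y))
    (\int[mu]_(y in `[c, d]) Vx (x, y)).
Proof.
move=> cV cVx dV x /andP[ux xv].
have xuv : x \in `]u, v[ by rewrite in_itv/= ux xv.
have oc t : `]u, v[%classic t -> u <= t <= v.
  by rewrite /= in_itv/= => /andP[? ?]; rewrite !ltW.
have iV t : `]u, v[%classic t -> mu.-integrable `[c, d] (EFin \o (fun y => V (t, y))).
  move=> /oc tuv; apply: continuous_on_segment_integrable => y ycd.
  by apply: slice_continuous; exact: cV.
have derV t y : `]u, v[%classic t -> `[c, d]%classic y ->
    is_derive t 1 (fun x => V (x, y)) (Vx (t, y)).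
  by move=> /oc tuv; rewrite /= in_itv/= => ycd; exact: dV.
have [B BV] : exists B : R, forall t y, u <= t <= v -> c <= y <= d -> `|Vx (t, y)| <= B.
  have cQ : compact (`[u, v] `*` `[c, d] : set (R * R)).
    by apply: compact_setX; exact: segment_compact.
  have : bounded_set (Vx @` (`[u, v] `*` `[c, d])).
    apply/compact_bounded/continuous_compact => //.
    apply: continuous_in_subspaceT => -[t y]; rewrite inE/= !in_itv/= => -[tuv ycd].
    exact: cVx.
  move=> [M [_ /(_ (M + 1))]]; rewrite ltrDl ltr01 => /(_ isT) MB.
  exists (M + 1) => t y tuv ycd; apply: MB.
  by apply: imageP; split; rewrite /= in_itv/=.
have iB : mu.-integrable `[c, d] (EFin \o (fun=> `|B|)).
  by apply: continuous_on_segment_integrable => y _; exact: cvg_cst.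
have pE t y : `]u, v[%classic t -> `[c, d]%classic y ->
    partial1of2 (fun x y => V (x, y)) t y = Vx (t, y).
  move=> tuv ycd; rewrite partial1of2E.
  by have [_ ->] := derV t y tuv ycd.
have dV1 t y : `]u, v[%classic t -> `[c, d]%classic y -> derivable (fun x => V (x, y)) t 1.
  by move=> tuv ycd; have [] := derV t y tuv ycd.
have B0 : forall y : R, 0 <= `|B| by [].
have Bub t y : `]u, v[%classic t -> `[c, d]%classic y ->
    `|partial1of2 (fun x y => V (x, y)) t y| <= `|B|.
  move=> tuv ycd; rewrite pE//; apply: le_trans (ler_norm _); apply: BV; first exact: oc.
  by move: ycd; rewrite /= in_itv.
have mcd : measurable (`[c, d]%classic : set R) by [].
have D := @derivable_under_integral R _ _ mu (fun x y => V (x, y)) `[c, d]%classic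
  mcd x u v xuv iV dV1 (fun=> `|B|) B0 iB Bub.
have E := @differentiation_under_integral R _ _ mu (fun x y => V (x, y)) `[c, d]%classic
  mcd x u v xuv iV dV1 (fun=> `|B|) B0 iB Bub.
apply: DeriveDef; first exact: D.
rewrite -derive1E E; apply: eq_Rintegral => y ycd.
by apply: pE => //; move: ycd; rewrite inE.
Qed.

End IntegralOverSegments.

Section Profile.
Variable R : realType.

Definition pos (t : R) : R := Num.max t 0.

Lemma pos_ge0 t : 0 <= pos t.
Proof. by rewrite /pos le_max lexx orbT. Qed.

Lemma pos_ge t : t <= pos t.
Proof. by rewrite /pos le_max lexx. Qed.

Lemma pos_le0 t : t <= 0 -> pos t = 0.
Proof. by move=> t0; rewrite /pos max_r. Qed.

Lemma pos_lip t s : `|pos t - pos s| <= `|t - s|.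
Proof.
rewrite /pos ler_norml; have := ler_norm (t - s); have := ler_norm (s - t).
rewrite (distrC s t); have [t0|t0] := leP t 0; have [s0|s0] := leP s 0.
- by move=> h1 h2; rewrite subrr oppr_le0 normr_ge0.
- by move=> h1 h2; apply/andP; split; move: t0 s0 h1 h2; clear; lra.
- by move=> h1 h2; apply/andP; split; move: t0 s0 h1 h2; clear; lra.
- by move=> h1 h2; apply/andP; split; move: t0 s0 h1 h2; clear; lra.
Qed.

Lemma pos_continuous : continuous pos.
Proof.
move=> t; apply/cvgrPdist_lt => e e0; apply/nbhs_ballP; exists e => // s.
by rewrite /ball/= => ts; apply: le_lt_trans (pos_lip _ _) ts.
Qed.

Lemma is_derive_bound (h : R -> R) (t l C : R) :
  (forall s, `|h s - h t - l * (s - t)| <= C * (s - t) ^+ 2) -> is_derive t 1 h l.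
Proof.
move=> hC; have C0 : 0 <= C.
  have := hC (t + 1); rewrite (addrC t) addrK expr1n (mulr1 C).
  by apply: le_trans; exact: normr_ge0.
suff H : x^-1 *: (h (x *: 1 + t) - h t) @[x --> 0^'] --> l.
  by apply: DeriveDef; [apply/cvg_ex; exists l|exact: cvg_lim].
apply/cvgrPdist_lt => e e0.
have d0 : 0 < e / (C + 1) by rewrite divr_gt0// ltr_wpDl.
apply/nbhs_ballP; exists (e / (C + 1)) => // x.
rewrite /ball/= sub0r normrN => xd x0.
have := hC (x + t); rewrite [_%:A]mulr1 addrK => hx.
rewrite /GRing.scale/=.
have -> : l - x^-1 * (h (x + t) - h t) = - (x^-1 * (h (x + t) - h t - l * x)).
  by field.
rewrite normrN normrM normfV.
have xp : 0 < `|x| by rewrite normr_gt0.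
rewrite mulrC ltr_pdivrMr//; apply: le_lt_trans hx _.
rewrite -real_normK ?num_real// expr2 mulrA ltr_pM2r//.
have : `|x| * (C + 1) < e by rewrite -ltr_pdivlMr ?ltr_wpDl.
by move: xp; clear; lra.
Qed.

Lemma is_derive_possq (t : R) : is_derive t 1 (fun t => pos t ^+ 2) (2 * pos t).
Proof.
apply: (@is_derive_bound _ _ _ 1) => s; rewrite mul1r ler_norml /pos.
have [t0|t0] := leP t 0; have [s0|s0] := leP s 0.
- by rewrite mulr0 mul0r !subr0 expr0n/= subrr oppr_le0 sqr_ge0.
- have h : s * t <= 0 by rewrite mulr_ge0_le0// ltW.
  have := sqr_ge0 t; have := sqr_ge0 (s - t); have := sqr_ge0 s.
  by rewrite !mulr0 !mul0r expr0n/= !sqrrB => *; apply/andP; split; lra.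
- have h : s * t <= 0 by rewrite mulr_le0_ge0// ltW.
  have := sqr_ge0 t; have := sqr_ge0 (s - t); have := sqr_ge0 s.
  by rewrite expr0n/= !sqrrB => *; apply/andP; split; lra.
- by have := sqr_ge0 (s - t); rewrite !sqrrB => *; apply/andP; split; lra.
Qed.

Variable N : R.
Hypothesis N1 : 1 <= N.
Let N0 : 0 < N := lt_le_trans ltr01 N1.

(* 1 / x vanishes logarithmically as x grows: T and Lam are the profiles 1 / x
   and ln x, made constant beyond N in a C^1 way. *)
Definition gap (x : R) : R := pos (x^-1 - N^-1).
Definition Tprof (x : R) : R := x * gap x ^+ 2.
Definition Tprof1 (x : R) : R := gap x ^+ 2 - 2 * gap x * x^-1.
Definition Lprof (x : R) : R := - 2^-1 * ln (gap x ^+ 2 + N^-1 ^+ 2).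
Definition Lprof1 (x : R) : R := gap x * x^-1 ^+ 2 / (gap x ^+ 2 + N^-1 ^+ 2).

Lemma is_derive_inv (x : R) : 0 < x -> is_derive x 1 (fun t => t^-1) (- x^-1 ^+ 2).
Proof.
move=> x0.
have xn : x != 0 by rewrite gt_eqF.
have := is_deriveV xn (is_derive_id x 1).
by rewrite [_ *: 1]mulr1 exprVn.
Qed.

Lemma is_derive_gapsq (x : R) : 0 < x ->
  is_derive x 1 (fun t => gap t ^+ 2) (2 * gap x * - x^-1 ^+ 2).
Proof.
move=> x0.
have h : is_derive x 1 (fun t : R => t^-1 - N^-1) (- x^-1 ^+ 2).
  have := is_deriveB (is_derive_inv x0) (is_derive_cst (N^-1) x 1).
  by rewrite subr0.
exact: (@is_derive1_comp _ (fun t => pos t ^+ 2) _ _ _ _ (is_derive_possq _) h).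
Qed.

Lemma is_derive_Tprof (x : R) : 0 < x -> is_derive x 1 Tprof (Tprof1 x).
Proof.
move=> x0; have := is_deriveM (is_derive_id x 1) (is_derive_gapsq x0).
rewrite /GRing.scale/= mulr1 => h; rewrite /Tprof1.
rewrite (_ : _ - _ = x * (2 * gap x * - x^-1 ^+ 2) + gap x ^+ 2)//.
by field; rewrite gt_eqF.
Qed.

Lemma gap_denom_gt0 x : 0 < gap x ^+ 2 + N^-1 ^+ 2.
Proof. by rewrite ltr_wpDl ?sqr_ge0// exprn_gt0// invr_gt0. Qed.

Lemma is_derive_Lprof (x : R) : 0 < x -> is_derive x 1 Lprof (Lprof1 x).
Proof.
move=> x0.
have h := is_deriveD (is_derive_gapsq x0) (is_derive_cst (N^-1 ^+ 2) x 1).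
have h2 := @is_derive1_comp _ (@ln R) (fun t => gap t ^+ 2 + N^-1 ^+ 2) x _ _
  (is_derive1_ln (gap_denom_gt0 x)) h.
have := is_derive_scale (- 2^-1) h2.
rewrite (_ : _ * (_ * _) = Lprof1 x)//.
rewrite /Lprof1 addr0; have := gap_denom_gt0 x.
move: (gap x ^+ 2 + _) => e e0; by field; rewrite !gt_eqF.
Qed.

Lemma gap_continuous x : 0 < x -> {for x, continuous gap}.
Proof.
move=> x0; apply: (@continuous_comp _ _ _ (fun t : R => t^-1 - N^-1) pos).
  by apply: cvgB; [exact: is_derive_continuous (is_derive_inv x0)|exact: cvg_cst].
exact: pos_continuous.
Qed.

Lemma Tprof1_continuous x : 0 < x -> {for x, continuous Tprof1}.
Proof.
move=> x0; have cg := gap_continuous x0.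
have ci := is_derive_continuous (is_derive_inv x0).
have c2 : {for x, continuous (fun t => 2 * gap t)}.
  by apply: cvgM; [exact: cvg_cst|exact: cg].
by apply: cvgB; [exact: (cvgM cg cg)|exact: (cvgM c2 ci)].
Qed.

Lemma gap_le x : 0 < x -> gap x <= x^-1.
Proof.
move=> x0; rewrite /gap /pos ge_max invr_ge0 (ltW x0) andbT.
by rewrite gerBl invr_ge0 ltW.
Qed.

Lemma gap_sq_le x : 0 < x -> gap x ^+ 2 <= - Tprof1 x.
Proof.
move=> x0; rewrite /Tprof1.
have := ler_wpM2l (pos_ge0 (x^-1 - N^-1)) (gap_le x0); rewrite -/(gap x).
by clear; lra.
Qed.

Lemma Tprof_sq_le x : 0 < x -> Tprof x ^+ 2 <= - Tprof1 x.
Proof.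
move=> x0; apply: le_trans (gap_sq_le x0).
have g0 : 0 <= gap x := pos_ge0 _.
rewrite ler_sqr ?nnegrE ?mulr_ge0 ?(ltW x0)// /Tprof expr2 mulrA ler_piMl//.
by rewrite mulrC -ler_pdivlMr// div1r gap_le.
Qed.

Lemma Lprof1_sq_le x : 0 < x -> Lprof1 x ^+ 2 <= 4 * (- Tprof1 x).
Proof.
move=> x0; apply: (@le_trans _ _ ((2 * gap x) ^+ 2)); last first.
  by have := gap_sq_le x0; rewrite exprMn; clear; lra.
have g0 : 0 <= gap x := pos_ge0 _.
have d0 := gap_denom_gt0 x.
have L0 : 0 <= Lprof1 x.
  by apply: divr_ge0; [rewrite mulr_ge0 ?sqr_ge0|exact: ltW].
rewrite ler_sqr ?nnegrE//; last exact: mulr_ge0.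
rewrite /Lprof1 ler_pdivrMr// -mulrA [2 * _]mulrC -mulrA ler_wpM2l//.
have := sqr_ge0 (gap x - N^-1).
have h : x^-1 ^+ 2 <= (gap x + N^-1) ^+ 2 .
  have xi : 0 <= x^-1 by rewrite invr_ge0 ltW.
  have Ni : 0 <= N^-1 by rewrite invr_ge0 ltW.
  rewrite ler_sqr ?nnegrE ?addr_ge0//.
  by have := pos_ge (x^-1 - N^-1); rewrite -/(gap x); clear; lra.
by move: h; rewrite !sqrrD sqrrN; clear; lra.
Qed.

Lemma gap_eq0 x : N <= x -> gap x = 0.
Proof.
move=> Nx; apply: pos_le0; rewrite subr_le0 lef_pV2 ?posrE//.
exact: lt_le_trans Nx.
Qed.

Lemma Tprof_eq0 x : N <= x -> Tprof x = 0.
Proof. by move=> Nx; rewrite /Tprof gap_eq0// expr0n/= mulr0. Qed.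

Lemma Tprof1_eq0 x : N <= x -> Tprof1 x = 0.
Proof. by move=> Nx; rewrite /Tprof1 gap_eq0// expr0n/= mulr0 mul0r subr0. Qed.

Lemma Lprof_large x : N <= x -> Lprof x = ln N.
Proof.
move=> Nx; rewrite /Lprof gap_eq0// expr0n/= add0r exprVn lnV ?posrE ?exprn_gt0//.
by rewrite lnXn// -mulr_natl; field.
Qed.

Lemma Lprof_le x : 0 < x -> Lprof x <= 2^-1 * ln (2 * x ^+ 2).
Proof.
move=> x0; rewrite /Lprof mulNr -mulrN ler_pM2l ?invr_gt0//.
rewrite lerNl -lnV ?posrE ?mulr_gt0 ?exprn_gt0//.
rewrite ler_ln ?posrE ?gap_denom_gt0 ?invr_gt0 ?mulr_gt0 ?exprn_gt0//.
rewrite invfM -exprVn ler_pdivrMl//.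
have := sqr_ge0 (gap x - N^-1).
have h : x^-1 ^+ 2 <= (gap x + N^-1) ^+ 2 .
  have xi : 0 <= x^-1 by rewrite invr_ge0 ltW.
  have Ni : 0 <= N^-1 by rewrite invr_ge0 ltW.
  rewrite ler_sqr ?nnegrE ?addr_ge0 ?pos_ge0//.
  by have := pos_ge (x^-1 - N^-1); rewrite -/(gap x); clear; lra.
by move: h; rewrite !sqrrD sqrrN; clear; lra.
Qed.

End Profile.

Section Extension.
Variable R : realType.
Implicit Types (z w : R * R) (i : bool) (U : set (R * R)) (u v F : R * R -> R).

Lemma pd_near i u v z d (e : R) : 0 < e ->
  (forall w, sqr_nbh z e w -> u w = v w) -> pd i u z d -> pd i v z d.
Proof.
move=> e0 uv; apply: near_eq_is_derive.
apply/nbhs_ballP; exists e => // t; rewrite /ball/= distrC => h.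
by apply: uv; exact: slide_sqr.
Qed.

Lemma continuous_near u v z (e : R) : 0 < e ->
  (forall w, sqr_nbh z e w -> u w = v w) -> {for z, continuous u} -> {for z, continuous v}.
Proof.
move=> e0 uv cu; rewrite /prop_for /continuous_at -(uv z (sqr_nbh_refl z e0)).
apply: cvg_trans cu; apply: near_eq_cvg.
by apply/nbhs_sqrP; exists e.
Qed.

Definition ext U F (c : R) z : R := if `[< U z >] then F z else c.

Lemma ext_in U F c z : U z -> ext U F c z = F z.
Proof. by move=> Uz; rewrite /ext asboolT. Qed.

Lemma ext_out U F c z : ~ U z -> ext U F c z = c.
Proof. by move=> Uz; rewrite /ext asboolF. Qed.

Definition flat_off U F (c : R) z := exists2 e : R, 0 < e &
  forall w, sqr_nbh z e w -> U w -> F w = c.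

Lemma continuous_ext U F c z : open U -> (U z -> {for z, continuous F}) ->
  (~ U z -> flat_off U F c z) -> {for z, continuous (ext U F c)}.
Proof.
move=> oU cF nF; have [Uz|nUz] := pselect (U z).
  have [e e0 eU] := open_sqrP oU Uz.
  by apply: continuous_near e0 _ (cF Uz) => w /eU Uw; rewrite ext_in.
have [e e0 eU] := nF nUz.
apply: (@continuous_near (fun=> c)) e0 _ _; last exact: cvg_cst.
move=> w /eU h; have [Uw|nUw] := pselect (U w); first by rewrite ext_in ?h.
by rewrite ext_out.
Qed.

Lemma pd_ext i U F Fi c z : open U -> (U z -> pd i F z (Fi z)) ->
  (~ U z -> flat_off U F c z) -> pd i (ext U F c) z (ext U Fi 0 z).
Proof.
move=> oU dF nF; have [Uz|nUz] := pselect (U z).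
  have [e e0 eU] := open_sqrP oU Uz; rewrite (ext_in _ _ Uz).
  by apply: pd_near e0 _ (dF Uz) => w /eU Uw; rewrite ext_in.
have [e e0 eU] := nF nUz; rewrite (ext_out _ _ nUz).
apply: (@pd_near _ (fun=> c)) e0 _ _; last exact: pd_cst.
move=> w /eU h; have [Uw|nUw] := pselect (U w); first by rewrite ext_in ?h.
by rewrite ext_out.
Qed.

End Extension.

Lemma young_weighted (R : realType) (K x y : R) : 0 < K ->
  2 * x * y <= x ^+ 2 / K + K * y ^+ 2.
Proof.
move=> K0; have := sqr_ge0 (x - K * y); rewrite sqrrB exprMn => h.
have hk : K * (x ^+ 2 / K) = x ^+ 2 by field; rewrite gt_eqF.
by rewrite -(ler_pM2l K0) mulrDr hk; move: h; clear; lra.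
Qed.

Section Energy.
Variable R : realType.
Implicit Types (z w : R * R) (i : bool).
Variables (U : set (R * R)) (p q : R * R -> R) (pi qi : bool -> R * R -> R).
Variables (pm qm : R * R -> R) (K : R).
Hypothesis oU : open U.
Hypothesis dp : forall i z, U z -> pd i p z (pi i z).
Hypothesis dq : forall i z, U z -> pd i q z (qi i z).
Hypothesis dpm : forall i z, U z -> pd i (pi (~~ i)) z (pm z).
Hypothesis dqm : forall i z, U z -> pd i (qi (~~ i)) z (qm z).
Hypothesis cp : forall z, U z -> {for z, continuous p}.
Hypothesis cq : forall z, U z -> {for z, continuous q}.
Hypothesis cpi : forall i z, U z -> {for z, continuous (pi i)}.
Hypothesis cqi : forall i z, U z -> {for z, continuous (qi i)}.
Hypothesis cpm : forall z, U z -> {for z, continuous pm}.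
Hypothesis cqm : forall z, U z -> {for z, continuous qm}.
Hypothesis K1 : 1 <= K.
Hypothesis qc : forall z, U z -> grad2 pi qi z <= K * jac pi qi z.
Hypothesis large : forall z, U z -> expR 1 <= p z ^+ 2 + q z ^+ 2.
Variables (a b y1 : R) (N : R).
Hypothesis N1 : 1 <= N.

Let s z := p z ^+ 2 + q z ^+ 2.
Let sg z := ln (s z).
Let si i z := 2 * (p z * pi i z + q z * qi i z).
Let eta z := (z.1 - a) * (b - z.1) * (y1 - z.2).
Let etai i z := if i then (a + b - 2 * z.1) * (y1 - z.2) else - ((z.1 - a) * (b - z.1)).
Let W z := Tprof N (sg z) * (s z)^-1.
Let Wi i z := (Tprof1 N (sg z) - Tprof N (sg z)) * si i z * (s z)^-1 ^+ 2.
Let G i z := p z * qi (~~ i) z - q z * pi (~~ i) z.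
Let Gi i z := pi i z * qi (~~ i) z + p z * qm z - (qi i z * pi (~~ i) z + q z * pm z).
Let V i z := eta z ^+ 2 * W z * G i z.
Let Vi i z := 2 * eta z * etai i z * W z * G i z +
  eta z ^+ 2 * (Wi i z * G i z + W z * Gi i z).

Let s_gt0 z : U z -> 0 < s z.
Proof. by move=> Uz; apply: lt_le_trans (large Uz); exact: expR_gt0. Qed.

Let sg_ge1 z : U z -> 1 <= sg z.
Proof.
by move=> Uz; rewrite -[1]expRK ler_ln ?posrE ?expR_gt0 ?s_gt0//; exact: large.
Qed.

Let sg_gt0 z : U z -> 0 < sg z.
Proof. by move=> Uz; apply: lt_le_trans (sg_ge1 Uz). Qed.

Let ds i z : U z -> pd i s z (si i z).
Proof.
move=> Uz; have h := pdD (pdM (dp i Uz) (dp i Uz)) (pdM (dq i Uz) (dq i Uz)).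
have -> : s = (fun y => p y * p y + q y * q y) by apply/funext => y; rewrite /s !expr2.
by apply: pd_eq h _; rewrite /si; ring.
Qed.

Let dsg i z : U z -> pd i sg z ((s z)^-1 * si i z).
Proof. by move=> Uz; apply: pd_comp (ds i Uz); exact/is_derive1_ln/s_gt0. Qed.

Let dW i z : U z -> pd i W z (Wi i z).
Proof.
move=> Uz; have h := pdM (pd_comp (is_derive_Tprof N (sg_gt0 Uz)) (dsg i Uz))
  (pd_comp (is_derive_inv (s_gt0 Uz)) (ds i Uz)).
by apply: pd_eq h _; rewrite /Wi; ring.
Qed.

Let dG i z : U z -> pd i (G i) z (Gi i z).
Proof.
move=> Uz; exact: (pdB (pdM (dp i Uz) (dqm i Uz)) (pdM (dq i Uz) (dpm i Uz))).
Qed.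

Let deta i z : pd i eta z (etai i z).
Proof.
have h j c := pdB (@pd_coord R i j z) (pd_cst i c z).
have h' j c := pdB (pd_cst i c z) (@pd_coord R i j z).
have := pdM (pdM (h true a) (h' true b)) (h' false y1).
by move=> H; apply: pd_eq H _; rewrite /etai; case: i {h h'} => /=; ring.
Qed.

Let dV i z : U z -> pd i (V i) z (Vi i z).
Proof.
move=> Uz; have h := pdM (pdM (pdM (deta i z) (deta i z)) (dW i Uz)) (dG i Uz).
have -> : V i = (fun y => eta y * eta y * W y * G i y).
  by apply/funext => y; rewrite /V expr2.
by apply: pd_eq h _; rewrite /Vi; ring.
Qed.

Let ceta : continuous eta.
Proof.
move=> z; have h1 c : {for z, continuous (fun z : R * R => z.1 - c)}.
  by apply: cvgB; [exact: cvg_fst|exact: cvg_cst].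
have h2 c : {for z, continuous (fun z : R * R => c - z.1)}.
  by apply: cvgB; [exact: cvg_cst|exact: cvg_fst].
have h3 c : {for z, continuous (fun z : R * R => c - z.2)}.
  by apply: cvgB; [exact: cvg_cst|exact: cvg_snd].
exact: (cvgM (cvgM (h1 a) (h2 b)) (h3 y1)).
Qed.

Let cetai i : continuous (etai i).
Proof.
move=> z; have h1 c : {for z, continuous (fun z : R * R => z.1 - c)}.
  by apply: cvgB; [exact: cvg_fst|exact: cvg_cst].
have h2 c : {for z, continuous (fun z : R * R => c - z.1)}.
  by apply: cvgB; [exact: cvg_cst|exact: cvg_fst].
have h3 c : {for z, continuous (fun z : R * R => c - z.2)}.
  by apply: cvgB; [exact: cvg_cst|exact: cvg_snd].
case: i; last by apply: cvgN; exact: (cvgM (h1 a) (h2 b)).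
apply: cvgM; last exact: h3.
apply: cvgB; first exact: cvg_cst.
by apply: cvgM; [exact: cvg_cst|exact: cvg_fst].
Qed.

Let cs z : U z -> {for z, continuous s}.
Proof.
by move=> Uz; apply: cvgD; [exact: (cvgM (cp Uz) (cp Uz))|exact: (cvgM (cq Uz) (cq Uz))].
Qed.

Let csg z : U z -> {for z, continuous sg}.
Proof.
move=> Uz; apply: (@continuous_comp _ _ _ s (@ln R)); first exact: cs.
exact: is_derive_continuous (is_derive1_ln (s_gt0 Uz)).
Qed.

Let csV z : U z -> {for z, continuous (fun z => (s z)^-1)}.
Proof.
move=> Uz; apply: (@continuous_comp _ _ _ s (fun t => t^-1)); first exact: cs.
exact: is_derive_continuous (is_derive_inv (s_gt0 Uz)).
Qed.

Let cT z : U z -> {for z, continuous (fun z => Tprof N (sg z))}.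
Proof.
move=> Uz; apply: (@continuous_comp _ _ _ sg (Tprof N)); first exact: csg.
exact: is_derive_continuous (is_derive_Tprof N (sg_gt0 Uz)).
Qed.

Let cT1 z : U z -> {for z, continuous (fun z => Tprof1 N (sg z))}.
Proof.
move=> Uz; apply: (@continuous_comp _ _ _ sg (Tprof1 N)); first exact: csg.
exact: Tprof1_continuous (sg_gt0 Uz).
Qed.

Let cW z : U z -> {for z, continuous W}.
Proof. by move=> Uz; exact: (cvgM (cT Uz) (csV Uz)). Qed.

Let cG i z : U z -> {for z, continuous (G i)}.
Proof.
by move=> Uz; apply: cvgB;
  [exact: (cvgM (cp Uz) (@cqi (~~ i) z Uz))|exact: (cvgM (cq Uz) (@cpi (~~ i) z Uz))].
Qed.

Let cV i z : U z -> {for z, continuous (V i)}.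
Proof. by move=> Uz; exact: (cvgM (cvgM (cvgM (@ceta z) (@ceta z)) (cW Uz)) (@cG i z Uz)). Qed.

Let cVi i z : U z -> {for z, continuous (Vi i)}.
Proof.
move=> Uz.
have csi : {for z, continuous (si i)}.
  apply: cvgM; first exact: cvg_cst.
  by apply: cvgD; [exact: (cvgM (cp Uz) (@cpi i z Uz))|exact: (cvgM (cq Uz) (@cqi i z Uz))].
have cWi : {for z, continuous (Wi i)}.
  apply: cvgM; last exact: (cvgM (csV Uz) (csV Uz)).
  apply: cvgM; last exact: csi.
  by apply: cvgB; [exact: cT1|exact: cT].
have cGi : {for z, continuous (Gi i)}.
  apply: cvgB; apply: cvgD.
  - exact: (cvgM (@cpi i z Uz) (@cqi (~~ i) z Uz)).
  - exact: (cvgM (cp Uz) (cqm Uz)).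
  - exact: (cvgM (@cqi i z Uz) (@cpi (~~ i) z Uz)).
  - exact: (cvgM (cq Uz) (cpm Uz)).
have c2 : {for z, continuous (fun z => 2 * eta z)}.
  by apply: cvgM; [exact: cvg_cst|exact: ceta].
apply: cvgD; first exact: (cvgM (cvgM (cvgM c2 (@cetai i z)) (cW Uz)) (@cG i z Uz)).
apply: (cvgM (cvgM (@ceta z) (@ceta z))).
by apply: cvgD; [exact: (cvgM cWi (@cG i z Uz))|exact: (cvgM (cW Uz) cGi)].
Qed.

Let energy z := eta z ^+ 2 * (- Tprof1 N (sg z)) * (s z)^-1 * jac pi qi z.
Let grad_eta2 z := etai true z ^+ 2 + etai false z ^+ 2.

Let K0 : 0 < K. Proof. exact: lt_le_trans K1. Qed.

Let jac_ge0 z : U z -> 0 <= jac pi qi z.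
Proof.
by move=> Uz; have := le_trans (grad2_ge0 _ _ _) (qc Uz); rewrite pmulr_rge0.
Qed.

(* div (V true, - V false): Cauchy-Schwarz absorbs the term with grad eta. *)
Let divergence_le z : U z ->
  Vi true z - Vi false z <= K * grad_eta2 z - energy z.
Proof.
move=> Uz; have sz := s_gt0 Uz; have Jz := jac_ge0 Uz.
have sn : s z != 0 by rewrite gt_eqF.
set T1 := Tprof1 N (sg z); set T := Tprof N (sg z).
have T2 : T ^+ 2 <= - T1 := Tprof_sq_le N1 (sg_gt0 Uz).
set J := jac pi qi z in Jz *.
have E : Vi true z - Vi false z = 2 * eta z ^+ 2 * T1 * (s z)^-1 * J +
    (2 * (eta z * T * (s z)^-1 * G true z) * etai true z -
     2 * (eta z * T * (s z)^-1 * G false z) * etai false z).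
  rewrite /Vi /W /Wi -/T1 -/T /J /jac /G /Gi /si /=.
  have ss : s z = p z ^+ 2 + q z ^+ 2 by [].
  have : s z * (s z)^-1 = 1 by rewrite divff.
  rewrite ss; move: ((p z ^+ 2 + q z ^+ 2)^-1) => t ht.
  apply/eqP; rewrite -subr_eq0; apply/eqP.
  transitivity (2 * eta z ^+ 2 * (T1 - T) * t *
    (pi true z * qi false z - pi false z * qi true z) * ((p z ^+ 2 + q z ^+ 2) * t - 1)).
    by ring.
  by rewrite ht subrr mulr0.
have cs1 x y := @young_weighted R K x y K0.
have := cs1 (eta z * T * (s z)^-1 * G true z) (etai true z).
have := cs1 (- (eta z * T * (s z)^-1 * G false z)) (etai false z).
have GG : G true z ^+ 2 + G false z ^+ 2 <= s z * grad2 pi qi z.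
  rewrite -subr_ge0 (_ : _ - _ = (p z * pi true z + q z * qi true z) ^+ 2 +
    (p z * pi false z + q z * qi false z) ^+ 2); first by rewrite addr_ge0 ?sqr_ge0.
  by rewrite /s /grad2 /G /=; ring.
have GK : (G true z ^+ 2 + G false z ^+ 2) <= s z * (K * J).
  by apply: le_trans GG _; rewrite ler_wpM2l ?(ltW sz) ?qc.
have c0 : 0 <= eta z ^+ 2 * (s z)^-1 ^+ 2 / K.
  by apply: divr_ge0; [rewrite mulr_ge0 ?sqr_ge0|exact: ltW].
have step : eta z ^+ 2 * (s z)^-1 ^+ 2 / K * T ^+ 2 * (G true z ^+ 2 + G false z ^+ 2) <= energy z.
  apply: (@le_trans _ _ (eta z ^+ 2 * (s z)^-1 ^+ 2 / K * (- T1) * (s z * (K * J)))).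
    apply: ler_pM => //; first by rewrite mulr_ge0 ?sqr_ge0.
      by rewrite addr_ge0 ?sqr_ge0.
    by rewrite ler_wpM2l.
  rewrite le_eqVlt; apply/orP; left; apply/eqP; rewrite /energy -/T1 -/J.
  by field; rewrite sn gt_eqF.
move: step; rewrite E /grad_eta2 /energy -/T1 -/J !sqrrN !exprMn.
lra.
Qed.

Let Le z := Lprof N (sg z).
Let Lei i z := Lprof1 N (sg z) * ((s z)^-1 * si i z).

Let dLe i z : U z -> pd i Le z (Lei i z).
Proof. by move=> Uz; exact: pd_comp (is_derive_Lprof N1 (sg_gt0 Uz)) (dsg i Uz). Qed.

Let energy_ge z : U z -> eta z ^+ 2 * Lei false z ^+ 2 <= 16 * K * energy z.
Proof.
move=> Uz; have sz := s_gt0 Uz; have Jz := jac_ge0 Uz.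
have sn : s z != 0 by rewrite gt_eqF.
have L2 := Lprof1_sq_le N1 (sg_gt0 Uz).
have h1 : si false z ^+ 2 <= 4 * (s z * (K * jac pi qi z)).
  apply: (@le_trans _ _ (4 * (s z * grad2 pi qi z))); last first.
    by rewrite ler_pM2l// ler_pM2l// qc.
  rewrite /si exprMn (_ : 2 ^+ 2 = 4); last by ring.
  rewrite ler_pM2l// -subr_ge0 (_ : _ - _ = (p z * qi false z - q z * pi false z) ^+ 2
    + s z * (pi true z ^+ 2 + qi true z ^+ 2)).
    exact: (addr_ge0 (sqr_ge0 _) (mulr_ge0 (ltW sz) (addr_ge0 (sqr_ge0 _) (sqr_ge0 _)))).
  by rewrite /s /grad2; ring.
have e0 : 0 <= eta z ^+ 2 * (s z)^-1 ^+ 2 by rewrite mulr_ge0 ?sqr_ge0.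
rewrite /Lei (_ : eta z ^+ 2 * _ = eta z ^+ 2 * (s z)^-1 ^+ 2 *
   (Lprof1 N (sg z) ^+ 2 * si false z ^+ 2)); last by ring.
apply: (le_trans (ler_wpM2l e0 (ler_pM (sqr_ge0 _) (sqr_ge0 _) L2 h1))).
rewrite le_eqVlt; apply/orP; left; apply/eqP; rewrite /energy.
by field.
Qed.

Let energy_ge0 z : U z -> 0 <= energy z.
Proof.
move=> Uz; have h : 0 < 16 * K by rewrite mulr_gt0.
rewrite -(pmulr_rge0 _ h); apply: le_trans (energy_ge Uz).
by rewrite mulr_ge0 ?sqr_ge0.
Qed.

Variables (u v y0 ym Lmax : R).
Hypothesis (ua : u < a) (ab : a < b) (bv : b < v) (y0m : y0 < ym) (ym1 : ym < y1).
Hypothesis infinite : forall x y, u <= x <= v -> y0 <= y <= y1 -> ~ U (x, y) ->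
  forall B : R, exists2 e : R, 0 < e & forall w, sqr_nbh (x, y) e w -> U w ->
    B <= p w ^+ 2 + q w ^+ 2.
Hypothesis bottom : forall x, u <= x <= v -> ~ U (x, y0).
Hypothesis middle : forall x, a <= x <= b -> U (x, ym).
Hypothesis Lmid : forall x, a <= x <= b ->
  2^-1 * ln (2 * (ln (p (x, ym) ^+ 2 + q (x, ym) ^+ 2)) ^+ 2) <= Lmax.

Let flat F x y (c : R) : u <= x <= v -> y0 <= y <= y1 -> ~ U (x, y) ->
  (forall w, U w -> N <= sg w -> F w = c) -> flat_off U F c (x, y).
Proof.
move=> xuv yy nU Fc; have [e e0 eP] := infinite xuv yy nU (expR N).
exists e => // w hw Uw; apply: Fc => //; rewrite -[N]expRK ler_ln ?posrE ?expR_gt0 ?s_gt0//.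
exact: eP.
Qed.

Let Vflat i w : U w -> N <= sg w -> V i w = 0.
Proof. by move=> Uw h; rewrite /V /W Tprof_eq0// mul0r mulr0 mul0r. Qed.

Let Viflat i w : U w -> N <= sg w -> Vi i w = 0.
Proof.
move=> Uw h; rewrite /Vi /Wi /W Tprof_eq0// Tprof1_eq0// subrr.
by rewrite !(mul0r, mulr0, add0r).
Qed.

Let Lflat w : U w -> N <= sg w -> Le w = ln N.
Proof. by move=> Uw h; rewrite /Le Lprof_large. Qed.

Ltac use_order :=
  have ua' := ua; have ab' := ab; have bv' := bv; have y0m' := y0m; have ym1' := ym1.

Let inside x y := u <= x <= v /\ y0 <= y <= y1.

Let cVe i x y : inside x y -> {for (x, y), continuous (ext U (V i) 0)}.
Proof.
move=> [xuv yy]; apply: continuous_ext => //; first exact: cV.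
by move=> nU; apply: flat => // w; exact: Vflat.
Qed.

Let cVie i x y : inside x y -> {for (x, y), continuous (ext U (Vi i) 0)}.
Proof.
move=> [xuv yy]; apply: continuous_ext => //; first exact: cVi.
by move=> nU; apply: flat => // w; exact: Viflat.
Qed.

Let dVe i x y : inside x y -> pd i (ext U (V i) 0) (x, y) (ext U (Vi i) 0 (x, y)).
Proof.
move=> [xuv yy]; apply: pd_ext => //; first exact: dV.
by move=> nU; apply: flat => // w; exact: Vflat.
Qed.

Let dLee x y : inside x y ->
  pd false (ext U Le (ln N)) (x, y) (ext U (Lei false) 0 (x, y)).
Proof.
move=> [xuv yy]; apply: pd_ext => //; first exact: dLe.
by move=> nU; apply: flat => // w; exact: Lflat.
Qed.

Let kap := K * (((b - a) * (y1 - y0)) ^+ 2 + ((b - a) ^+ 2) ^+ 2).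
Let c0 := (((b - a) / 3) ^+ 2 * (y1 - ym)) ^+ 2 / (16 * K).

Let grad_eta_le x y : a <= x <= b -> y0 <= y <= y1 -> K * grad_eta2 (x, y) <= kap.
Proof. use_order.
move=> /andP[ax xb] /andP[yy0 yy1]; rewrite /kap ler_pM2l// /grad_eta2 /etai /=.
have h1 : `|(a + b - 2 * x) * (y1 - y)| <= (b - a) * (y1 - y0).
  rewrite normrM; apply: ler_pM => //; first by rewrite ler_norml; apply/andP; split; lra.
  by rewrite ger0_norm; lra.
have h2 : `|(x - a) * (b - x)| <= (b - a) ^+ 2.
  rewrite normrM expr2; apply: ler_pM => //; rewrite ger0_norm; lra.
apply: lerD; first by rewrite -real_normK ?num_real// ler_sqr ?nnegrE ?(le_trans _ h1).
by rewrite sqrrN -real_normK ?num_real// ler_sqr ?nnegrE ?(le_trans _ h2).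
Qed.

Let c0_ge0 : 0 <= c0.
Proof. by apply: divr_ge0; [exact: sqr_ge0|rewrite mulr_ge0// ltW]. Qed.

Let eta_mid x y : a + (b - a) / 3 <= x <= b - (b - a) / 3 -> y0 <= y <= ym ->
  16 * K * c0 <= eta (x, y) ^+ 2.
Proof. use_order.
move=> /andP[ax xb] /andP[yy0 yy1].
have K16 : 16 * K != 0 by rewrite gt_eqF// mulr_gt0.
rewrite /c0 mulrC divfK//.
have d0 : 0 <= (b - a) / 3 by rewrite divr_ge0 ?subr_ge0 ?(ltW ab).
have e0 : 0 <= y1 - ym by rewrite subr_ge0 ltW.
have h : ((b - a) / 3) ^+ 2 * (y1 - ym) <= eta (x, y).
  rewrite /eta /= expr2; apply: ler_pM => //; first exact: mulr_ge0.
    by apply: ler_pM => //; lra.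
  by lra.
have h0 : 0 <= ((b - a) / 3) ^+ 2 * (y1 - ym) := mulr_ge0 (sqr_ge0 _) e0.
by rewrite ler_sqr ?nnegrE// (le_trans h0).
Qed.

Let fluxx x y : a <= x <= b -> y0 <= y <= y1 ->
  ext U (Vi true) 0 (x, y) <= ext U (Vi false) 0 (x, y) + kap.
Proof.
move=> xab yy; have gk := grad_eta_le xab yy.
have [Uz|nUz] := pselect (U (x, y)).
  rewrite !ext_in//; have := divergence_le Uz; have := energy_ge0 Uz.
  by move: gk; move: (Vi true _) (Vi false _) (energy _) => A B C; lra.
rewrite !ext_out// add0r; apply: le_trans gk.
exact: mulr_ge0 (ltW K0) (addr_ge0 (sqr_ge0 _) (sqr_ge0 _)).
Qed.

Let fluxx_mid x y : a + (b - a) / 3 <= x <= b - (b - a) / 3 -> y0 <= y <= ym ->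
  ext U (Vi true) 0 (x, y) <= ext U (Vi false) 0 (x, y) + kap +
    c0 * (2 * ext U (Lei false) 0 (x, y) + 1).
Proof. use_order.
move=> xab yy.
have xab' : a <= x <= b by case/andP: xab => ? ?; apply/andP; split; lra.
have yy' : y0 <= y <= y1 by case/andP: yy => ? ?; apply/andP; split; lra.
have gk := grad_eta_le xab' yy'.
have [Uz|nUz] := pselect (U (x, y)); last first.
  have := fluxx xab' yy'; rewrite !ext_out// !(mulr0, add0r, mulr1) => h.
  by apply: le_trans h _; rewrite lerDl.
rewrite !ext_in//; have h1 := divergence_le Uz; have h2 := energy_ge Uz.
have h3 : 16 * K * (c0 * Lei false (x, y) ^+ 2) <= 16 * K * energy (x, y).
  by apply: le_trans h2; rewrite mulrA ler_wpM2r ?sqr_ge0// eta_mid.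
have K16 : 0 < 16 * K by rewrite mulr_gt0.
rewrite (ler_pM2l K16) in h3.
have h4 : 0 <= c0 * (Lei false (x, y) + 1) ^+ 2 := mulr_ge0 c0_ge0 (sqr_ge0 _).
move: h1 h3 h4 gk; rewrite sqrrD.
move: (Vi true _) (Vi false _) (energy _) (Lei _ _) c0 kap (K * _) => A B C D c k k'.
by rewrite mulr1 expr1n !mulrDr; lra.
Qed.

Let mu := @lebesgue_measure R.
Let M x := \int[mu]_(y in `[y0, y1]) ext U (V true) 0 (x, y).
Let Mi x := \int[mu]_(y in `[y0, y1]) ext U (Vi true) 0 (x, y).

Let dM x : u < x < v -> is_derive x 1 M (Mi x).
Proof.
apply: leibniz_segment => x' y hx hy; [exact: cVe|exact: cVie|exact: dVe].
Qed.

Let slice_pd (F : R * R -> R) (d x y : R) : pd false F (x, y) d -> is_derive y 1 (fun y => F (x, y)) d.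
Proof. by []. Qed.

Let ab_uv x : a <= x <= b -> u <= x <= v.
Proof. use_order. by move=> /andP[? ?]; apply/andP; split; lra. Qed.

Let V_bottom x : u <= x <= v -> ext U (V false) 0 (x, y0) = 0.
Proof. by move=> h; rewrite ext_out//; exact: bottom. Qed.

Let V_top (x : R) : ext U (V false) 0 (x, y1) = 0.
Proof.
have [Uz|nUz] := pselect (U (x, y1)); last by rewrite ext_out.
by rewrite ext_in// /V /eta /= subrr mulr0 expr0n/= !mul0r.
Qed.

Let slice_antiderivative (x : R) : a <= x <= b -> exists P : R -> R,
  [/\ {within `[y0, y1], continuous P},
    (forall y, y0 < y < y1 -> is_derive y 1 P (ext U (Vi true) 0 (x, y))) &
    P y1 - P y0 = Mi x].
Proof. use_order.
move=> xab; apply: exists_antiderivative; first exact: lt_trans ym1.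
move=> y hy; apply: slice_continuous; apply: cVie; split => //; exact: ab_uv.
Qed.

Let dH x y : a <= x <= b -> y0 <= y <= y1 ->
  is_derive y 1 (fun y => ext U (V false) 0 (x, y) + kap * y)
    (ext U (Vi false) 0 (x, y) + kap).
Proof.
move=> xab hy; have h := slice_pd (dVe false (conj (ab_uv xab) hy)).
by have := is_deriveD h (is_derive_scale kap (is_derive_id y 1)); rewrite mulr1.
Qed.

Let dH2 x y : a <= x <= b -> y0 <= y <= y1 ->
  is_derive y 1 (fun y => ext U (V false) 0 (x, y) + kap * y +
       c0 * (2 * ext U Le (ln N) (x, y) + y))
    (ext U (Vi false) 0 (x, y) + kap + c0 * (2 * ext U (Lei false) 0 (x, y) + 1)).
Proof.
move=> xab hy; have h := slice_pd (dLee (conj (ab_uv xab) hy)).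
have h2 := is_deriveD (is_derive_scale 2 h) (is_derive_id y 1).
exact: is_deriveD (dH xab hy) (is_derive_scale c0 h2).
Qed.

Let Mi_le x : a <= x <= b -> Mi x <= kap * (y1 - y0).
Proof.
move=> xab; have [P [cP dP <-]] := slice_antiderivative xab.
have y01 : y0 <= y1 by rewrite ltW// (lt_trans y0m).
have := @increment_le R P _ (fun y => ext U (V false) 0 (x, y) + kap * y) _
  y0 y1 y0 y1 (lexx _) y01 (lexx _) cP dP (fun y => @dH x y xab) (fun y => @fluxx x y xab).
rewrite V_top V_bottom; last exact: ab_uv.
by rewrite !add0r -mulrBr.
Qed.

Let Mi_mid x : a + (b - a) / 3 <= x <= b - (b - a) / 3 ->
  Mi x <= kap * (y1 - y0) - c0 * (2 * (ln N - Lmax) - (ym - y0)).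
Proof. use_order.
move=> xmid; have xab : a <= x <= b by case/andP: xmid => ? ?; apply/andP; split; lra.
have [P [cP dP <-]] := slice_antiderivative xab.
have sub y : ym <= y <= y1 -> y0 <= y <= y1.
  by move=> /andP[? ?]; apply/andP; split; lra.
have h1 := @increment_le R P _ _ _
  y0 y1 ym y1 (ltW y0m) (ltW ym1) (lexx _) cP dP (fun y => @dH x y xab)
  (fun y hy => @fluxx x y xab (sub y hy)).
have h2 := @increment_le R P _ _ _
  y0 y1 y0 ym (lexx _) (ltW y0m) (ltW ym1) cP dP (fun y => @dH2 x y xab)
  (fun y => @fluxx_mid x y xmid).
have Lm : ext U Le (ln N) (x, ym) <= Lmax.
  rewrite ext_in; last exact: middle.
  apply: (le_trans _ (Lmid xab)).
  exact: (@Lprof_le R N N1 (sg (x, ym)) (sg_gt0 (middle xab))).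
have := ler_wpM2l c0_ge0 Lm.
move: h1 h2; rewrite V_top V_bottom ?ab_uv// [ext U Le _ (x, y0)]ext_out; last first.
  by apply: bottom; exact: ab_uv.
by move: (ext _ _ _ _) (ext U Le _ _) => A B; lra.
Qed.

Let M_zero x : x = a \/ x = b -> M x = 0.
Proof.
move=> xab; have Z y : ext U (V true) 0 (x, y) = 0.
  have [Uz|nUz] := pselect (U (x, y)); last by rewrite ext_out.
  rewrite ext_in// /V (_ : eta (x, y) = 0); first by rewrite expr0n/= !mul0r.
  by rewrite /eta /=; case: xab => ->; rewrite subrr !(mulr0, mul0r).
by rewrite /M; under eq_Rintegral do rewrite Z; rewrite Rintegral_cst//= mul0r.
Qed.

Lemma energy_inequality :
  (b - a) / 3 * (c0 * (2 * (ln N - Lmax) - (ym - y0))) <= kap * (y1 - y0) * (b - a).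
Proof. use_order.
have [d dE] : {d : R | d = (b - a) / 3} by eexists.
have d0 : 0 <= d by rewrite dE; lra.
have d3 : 3 * d = b - a by rewrite dE; field.
have dM' x : a <= x <= b -> is_derive x 1 M (Mi x).
  by move=> /andP[? ?]; apply: dM; apply/andP; split; lra.
have cM : {within `[a, b], continuous M}.
  apply: derivable_within_continuous => x; rewrite in_itv/= => xab.
  by have [] := dM' x xab.
have dlin (k x : R) : is_derive x 1 (fun x => k * x) k.
  by have := is_derive_scale k (is_derive_id x 1); rewrite mulr1.
have inc (s' t k : R) : a <= s' -> s' <= t -> t <= b ->
    (forall x, s' <= x <= t -> Mi x <= k) -> M t - M s' <= k * t - k * s'.
  move=> h1 h2 h3 h4; apply: (@increment_le R M Mi (fun x => k * x) (fun=> k) a b) => //.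
  by move=> x /andP[? ?]; apply: dM'; rewrite !ltW.
have i1 : M (a + d) - M a <= kap * (y1 - y0) * (a + d) - kap * (y1 - y0) * a.
  apply: inc => //; rewrite ?lerDl//; first lra.
  by move=> x /andP[? ?]; apply: Mi_le; apply/andP; split => //; lra.
have i3 : M b - M (b - d) <= kap * (y1 - y0) * b - kap * (y1 - y0) * (b - d).
  apply: inc => //; rewrite ?gerBl//; first lra.
  by move=> x /andP[? ?]; apply: Mi_le; apply/andP; split => //; lra.
have i2 := inc (a + d) (b - d) (kap * (y1 - y0) - c0 * (2 * (ln N - Lmax) - (ym - y0))).
have {}i2 := i2 ltac:(by rewrite lerDl) ltac:(lra) ltac:(by rewrite gerBl)
  ltac:(by move=> x; rewrite dE; exact: Mi_mid).
have Ma := M_zero (or_introl (erefl a)); have Mb := M_zero (or_intror (erefl b)).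
move: i1 i2 i3; rewrite Ma Mb -dE -d3.
move: (M _) (M _) (kap * _) (c0 * _) => A B k c.
have -> : b = a + 3 * d by lra.
by lra.
Qed.

End Energy.

Section InfiniteCluster.
Variable R : realType.
Implicit Types (z w : R * R) (i : bool).

(* U carries the part of the domain above an arc at which p^2 + q^2 tends to infinity. *)
Lemma no_infinite_cluster (U : set (R * R)) (p q : R * R -> R)
    (pi qi : bool -> R * R -> R) (pm qm : R * R -> R) (K u a b v y0 ym y1 : R) :
  open U ->
  (forall i z, U z -> pd i p z (pi i z)) -> (forall i z, U z -> pd i q z (qi i z)) ->
  (forall i z, U z -> pd i (pi (~~ i)) z (pm z)) ->
  (forall i z, U z -> pd i (qi (~~ i)) z (qm z)) ->
  (forall z, U z -> {for z, continuous p}) -> (forall z, U z -> {for z, continuous q}) ->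
  (forall i z, U z -> {for z, continuous (pi i)}) ->
  (forall i z, U z -> {for z, continuous (qi i)}) ->
  (forall z, U z -> {for z, continuous pm}) -> (forall z, U z -> {for z, continuous qm}) ->
  1 <= K -> (forall z, U z -> grad2 pi qi z <= K * jac pi qi z) ->
  (forall z, U z -> expR 1 <= p z ^+ 2 + q z ^+ 2) ->
  u < a -> a < b -> b < v -> y0 < ym -> ym < y1 ->
  (forall x y, u <= x <= v -> y0 <= y <= y1 -> ~ U (x, y) ->
    forall B : R, exists2 e : R, 0 < e & forall w, sqr_nbh (x, y) e w -> U w ->
      B <= p w ^+ 2 + q w ^+ 2) ->
  (forall x, u <= x <= v -> ~ U (x, y0)) -> (forall x, a <= x <= b -> U (x, ym)) ->
  False.
Proof.
move=> oU dp dq dpm dqm cp cq cpi cqi cpm cqm K1 qc large ua ab bv y0m ym1 inf bot mid.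
pose S (x : R) := p (x, ym) ^+ 2 + q (x, ym) ^+ 2.
have cS : {within `[a, b], continuous S}.
  apply: continuous_in_subspaceT => x; rewrite inE/= in_itv/= => /mid Uz.
  have h F : {for (x, ym), continuous F} -> {for x, continuous (fun x => F (x, ym) : R)}.
    move=> /continuous_sqrP cF; apply/cvgrPdist_lt => e e0; have [d d0 dF] := cF e e0.
    apply/nbhs_ballP; exists d => // t; rewrite /ball/= => ht; rewrite distrC.
    by apply: dF; split; rewrite /= ?subrr ?normr0// distrC.
  by apply: cvgD; [exact: (cvgM (h _ (cp _ Uz)) (h _ (cp _ Uz)))|
    exact: (cvgM (h _ (cq _ Uz)) (h _ (cq _ Uz)))].
have [xm xmab xmmax] := EVT_max (ltW ab) cS.
pose Lmax := 2^-1 * ln (2 * (ln (S xm)) ^+ 2).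
have S1 x : a <= x <= b -> expR 1 <= S x by move=> /mid/large.
have Lmid x : a <= x <= b -> 2^-1 * ln (2 * (ln (p (x, ym) ^+ 2 + q (x, ym) ^+ 2)) ^+ 2) <= Lmax.
  move=> xab; have e1 := expR_gt0 (1 : R).
  have Sx := S1 x xab.
  have l1 : 1 <= ln (S x) by rewrite -[1]expRK ler_ln ?posrE// (lt_le_trans e1).
  have l2 : ln (S x) <= ln (S xm).
    rewrite ler_ln ?posrE ?(lt_le_trans e1)//; first by apply: xmmax; rewrite in_itv.
    by apply: (le_trans Sx); apply: xmmax; rewrite in_itv.
  have l3 : 0 < ln (S x) := lt_le_trans ltr01 l1.
  have l4 : 0 < ln (S xm) := lt_le_trans l3 l2.
  rewrite ler_pM2l ?invr_gt0// ler_ln ?posrE ?mulr_gt0 ?exprn_gt0//.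
  by rewrite ler_pM2l// ler_sqr ?nnegrE// ltW.
have K0 : 0 < K := lt_le_trans ltr01 K1.
pose kap := K * (((b - a) * (y1 - y0)) ^+ 2 + ((b - a) ^+ 2) ^+ 2).
pose c0 := (((b - a) / 3) ^+ 2 * (y1 - ym)) ^+ 2 / (16 * K).
have c00 : 0 < (b - a) / 3 * c0.
  have ba : 0 < b - a by rewrite subr_gt0.
  have ym0 : 0 < y1 - ym by rewrite subr_gt0.
  by rewrite mulr_gt0 ?divr_gt0 ?exprn_gt0 ?mulr_gt0 ?exprn_gt0 ?divr_gt0.
pose X := `|Lmax| + (ym - y0) + `|kap * (y1 - y0) * (b - a) / ((b - a) / 3 * c0)| + 1.
have X0 : 0 <= X.
  rewrite /X; have := normr_ge0 Lmax.
  have := normr_ge0 (kap * (y1 - y0) * (b - a) / ((b - a) / 3 * c0)); move: y0m; clear.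
  by move: `|_| => x; lra.
have N1 : 1 <= expR X by rewrite -expR0 ler_expR.
have := energy_inequality oU dp dq dpm dqm cp cq cpi cqi cpm cqm K1 qc large N1
  ua ab bv y0m ym1 inf bot mid Lmid.
rewrite expRK -/kap -/c0 mulrA -[X in _ <= X](divfK (lt0r_neq0 c00)) mulrC ler_pM2r//.
have := ler_norm Lmax; have := ler_norm (kap * (y1 - y0) * (b - a) / ((b - a) / 3 * c0)).
have : 0 <= `|Lmax| by []. 
have := normr_ge0 (kap * (y1 - y0) * (b - a) / ((b - a) / 3 * c0)).
rewrite /X; move: y0m; clear.
move: (_ / (_ * c0)) => x; lra.
Qed.

End InfiniteCluster.

(** * Charts and tangent balls of boundary curves *)
Section Charts.
Variable R : realType.
Implicit Types (z w p : R * R) (i j : bool) (S U : set (R * R)) (g m : R -> R).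

Record graph_chart S (a K L h : R) j p g m : Prop := GraphChart {
  chart_K : 1 <= K; chart_L : 1 <= L; chart_h : 0 < h;
  chart_mem : forall z, `|pcoord j z - pcoord j p| < h ->
    `|pcoord (~~ j) z - pcoord (~~ j) p| < 2 * L * h ->
    (S z <-> pcoord (~~ j) z = g (pcoord j z));
  chart_center : g (pcoord j p) = pcoord (~~ j) p;
  chart_lip : forall x y, `|x - pcoord j p| < h -> `|y - pcoord j p| < h ->
    `|g y - g x| <= L * `|y - x|;
  chart_slope : forall x, `|x - pcoord j p| < h -> `|m x| <= L;
  chart_holder : forall x y, `|x - pcoord j p| < h -> `|y - pcoord j p| < h ->
    `|g y - g x - m x * (y - x)| <= K * `|y - x| `^ (1 + a) }.

Lemma is_derive_pcoord i (c : R -> R * R) (t : R) (l : R * R) :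
  is_derive t 1 c l -> is_derive t 1 (fun s => pcoord i (c s)) (pcoord i l).
Proof.
move=> [dc cl].
have cv : s^-1 *: (c (s *: 1 + t) - c t) @[s --> 0^'] --> l by rewrite -cl; exact: dc.
have ci : pcoord i (s^-1 *: (c (s *: 1 + t) - c t)) @[s --> 0^'] --> pcoord i l.
  exact: (cvg_comp _ _ cv (@pcoord_continuous R i l)).
have E : (fun s : R => pcoord i (s^-1 *: (c (s *: 1 + t) - c t))) =
    (fun s => s^-1 *: (pcoord i (c (s *: 1 + t)) - pcoord i (c t))).
  by apply/funext => s; case: (i).
rewrite E in ci.
by apply: DeriveDef; [apply/cvg_ex; exists (pcoord i l)|exact: cvg_lim].
Qed.

Lemma pcoord_le_modulus i z : `|pcoord i z| <= modulus z.
Proof. by rewrite modulusE; case: i; [exact: fst_le_en|exact: snd_le_en]. Qed.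

Lemma mvt_abs (u u' : R -> R) (s t B : R) :
  (forall x, Num.min s t <= x <= Num.max s t -> is_derive x 1 u (u' x)) ->
  (forall x, Num.min s t <= x <= Num.max s t -> `|u' x| <= B) ->
  `|u t - u s| <= B * `|t - s|.
Proof.
move=> du uB.
exact: (@mvt_slide R true (fun z => u z.1) (fun z => u' z.1) (0, 0) s t B).
Qed.

Lemma Cla_curve_lipschitz (a : R) S : 0 < a -> Cla_curve 2 a S -> Cla_curve 1 1 S.
Proof.
move=> a0 cS p Sp; have [U [c [h [oU Up [cI ch dc [C hol] c0]]]]] := cS p Sp.
exists U, c, h; split => //; split => //.
  by move=> j t j1; apply: dc; rewrite ltnS ltnW.
pose I : set R := `]-1, 1[%classic.
have d2 t : I t -> is_derive t 1 (derive1n 1 c) (derive1n 2 c t).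
  move=> It; apply: DeriveDef; first exact: (dc 1%N t _ It).
  by rewrite -derive1E.
pose B := modulus (derive1n 2 c 0) + `|C|.
have I0 : I 0 by rewrite /I/= in_itv/= ltrN10 ltr01.
have bd t : I t -> modulus (derive1n 2 c t) <= B.
  move=> It; rewrite !modulusE /B modulusE.
  have := enD (derive1n 2 c t - derive1n 2 c 0) (derive1n 2 c 0); rewrite subrK.
  have := hol t 0 It I0; rewrite modulusE subr0 => h1.
  have t1 : `|t| `^ a <= 1.
    have p1 : (1 : R) `^ a = 1 by rewrite powR1.
    rewrite -p1; apply: ge0_ler_powR; rewrite ?nnegrE ?(ltW a0)//.
    by move: It; rewrite /I/= in_itv/= -ltr_norml => /ltW.
  have h2 : C * `|t| `^ a <= `|C|.
    apply: (@le_trans _ _ (`|C| * `|t| `^ a)); first by rewrite ler_wpM2r ?powR_ge0 ?ler_norm.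
    by rewrite ler_piMr.
  by move=> /le_trans; apply; rewrite addrC lerD2l; exact: le_trans h1 h2.
exists (2 * B) => s t Is It; rewrite powRr1//.
have btw x : Num.min t s <= x <= Num.max t s -> I x.
  rewrite ge_min le_max /I/= => /andP[/orP h1 /orP h2].
  move: Is It; rewrite /I/= !in_itv/= => /andP[s1 s2] /andP[t1 t2].
  by apply/andP; split; case: h1; case: h2; move: s1 s2 t1 t2; clear; lra.
have hi i : `|pcoord i (derive1n 1 c s) - pcoord i (derive1n 1 c t)| <= B * `|s - t|.
  apply: (@mvt_abs (fun t => pcoord i (derive1n 1 c t)) (fun t => pcoord i (derive1n 2 c t))).
    by move=> x /btw Ix; apply: is_derive_pcoord; exact: d2.
  by move=> x /btw Ix; apply: le_trans (pcoord_le_modulus i _) (bd x Ix).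
rewrite modulusE; apply: le_trans (en_le_sum _) _ => /=.
by rewrite (_ : 2 * B * _ = B * `|s - t| + B * `|s - t|); [exact: lerD (hi true) (hi false)|ring].
Qed.

Lemma graph_chart_exists (a : R) S p : 0 < a -> a <= 1 -> Cla_curve 1 a S -> S p ->
  exists K L h j g m, graph_chart S a K L h j p g m.
Proof.
move=> a0 a1 cS Sp; have [U [c [hh [oU Up [cI [ch hc] dc [C0 hol] c0]]]]] := cS p Sp.
pose I : set R := `]-1, 1[%classic.
pose C := Num.max C0 0.
have Cge : 0 <= C by rewrite /C le_max lexx orbT.
have [d dE] : {d : bool -> R -> R | forall i t, d i t = pcoord i (derive1n 1 c t)} by eexists.
have [ci ciE] : {ci : bool -> R -> R | forall i t, ci i t = pcoord i (c t)} by eexists.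
have hold i s t : I s -> I t -> `|d i s - d i t| <= C * `|s - t| `^ a.
  move=> Is It; have -> : d i s - d i t = pcoord i (derive1n 1 c s - derive1n 1 c t).
    by rewrite !dE; case: (i).
  apply: le_trans (pcoord_le_modulus i _) (le_trans (hol s t Is It) _).
  by rewrite ler_wpM2r ?powR_ge0// /C le_max lexx.
have dci i t : I t -> is_derive t 1 (ci i) (d i t).
  move=> It; have -> : ci i = (fun s => pcoord i (c s)) by apply/funext => s; rewrite ciE.
  rewrite dE; apply: is_derive_pcoord; apply: DeriveDef; first exact: (dc 0%N t _ It).
  by rewrite -derive1E.
have [t0 It0 ct0] : (c @` I) p by rewrite cI.
have hp : hh p = t0 by rewrite -ct0 hc.
have [j dj0] : exists j, d j t0 != 0.
  apply: contrapT => /forallNP nd; have := c0 t0 It0; apply/negP/negPn.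
  have e1 := nd true; have e2 := nd false; rewrite !dE/= in e1 e2.
  by move: e1 e2 => /negP/negPn/eqP e1 /negP/negPn/eqP e2; rewrite [X in X == _]surjective_pairing e1 e2.
pose k := `|d j t0|.
have k0 : 0 < k by rewrite normr_gt0.
have C1 : 0 < C + 1 by rewrite ltr_wpDl.
have e0 : 0 < k / 2 / (C + 1) by rewrite !divr_gt0.
have [r r0 rP] := powR_le_eventually a0 e0.
have [b b0 bI] : exists2 b : R, 0 < b & forall t, `|t - t0| <= b -> I t.
  move: It0; rewrite /I/= in_itv/= => /andP[h1 h2].
  exists (Num.min (t0 + 1) (1 - t0) / 2).
    by rewrite divr_gt0// lt_min; apply/andP; split; move: h1 h2; clear; lra.
  move=> t; rewrite ler_distl => /andP[h3 h4]; rewrite /= in_itv/=.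
  have : Num.min (t0 + 1) (1 - t0) <= t0 + 1 by rewrite ge_min lexx.
  have : Num.min (t0 + 1) (1 - t0) <= 1 - t0 by rewrite ge_min lexx orbT.
  by move=> h5 h6; apply/andP; split; move: h1 h2 h3 h4 h5 h6; clear; lra.
pose n := Num.min r b.
have n0 : 0 < n by rewrite lt_min r0.
have nI t : `|t - t0| <= n -> I t.
  by move=> h; apply: bI; apply: le_trans h _; rewrite ge_min lexx orbT.
have nd i t : `|t - t0| <= n -> `|d i t - d i t0| <= k / 2.
  move=> tn; apply: le_trans (hold i t t0 (nI t tn) It0) _.
  have h : `|t - t0| `^ a <= k / 2 / (C + 1).
    by apply: rP => //; apply: le_trans tn _; rewrite ge_min lexx.
  apply: (@le_trans _ _ ((C + 1) * `|t - t0| `^ a)).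
    by rewrite ler_wpM2r ?powR_ge0// lerDl.
  by rewrite mulrC -ler_pdivlMr.
pose J t := `|t - t0| <= n.
have Jbtw s t x : J s -> J t -> Num.min s t <= x <= Num.max s t -> J x.
  rewrite /J !ler_distl ge_min le_max => /andP[s1 s2] /andP[t1 t2] /andP[/orP h1 /orP h2].
  by apply/andP; split; case: h1; case: h2; move: s1 s2 t1 t2; clear; lra.
pose e := Num.sg (d j t0).
have ek : e * d j t0 = k by rewrite /e /k normrEsg.
have e1 : `|e| = 1 by rewrite /e normr_sg dj0.
have dlow t : J t -> k / 2 <= e * d j t.
  move=> Jt; have := nd j t Jt.
  have : `|e * (d j t - d j t0)| <= `|d j t - d j t0| by rewrite normrM e1 mul1r.
  rewrite mulrBr ek ler_norml => /andP[h1 _] h2.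
  by move: h1 h2; clear; lra.
pose B := `|d (~~ j) t0| + k / 2.
have B0 : 0 < B by rewrite /B ltr_wpDl// divr_gt0.
have dup t : J t -> `|d (~~ j) t| <= B.
  move=> Jt; have := nd (~~ j) t Jt.
  have := ler_normD (d (~~ j) t - d (~~ j) t0) (d (~~ j) t0); rewrite subrK /B.
  by clear; lra.
have inc (s t : R) : J s -> J t -> s <= t -> k / 2 * (t - s) <= e * (ci j t - ci j s).
  move=> Js Jt st.
  have dst x : s <= x <= t -> is_derive x 1 (ci j) (d j x).
    by move=> sxt; apply: dci; apply: nI; apply: (Jbtw s t) => //; rewrite min_l// max_r.
  have d1 x : x \in `]s, t[ -> is_derive x 1 (ci j) (d j x).
    by rewrite in_itv/= => /andP[/ltW sx /ltW xt]; apply: dst; rewrite sx.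
  have c1 : {within `[s, t], continuous (ci j)}.
    apply: derivable_within_continuous => x; rewrite in_itv/= => sxt.
    by have [] := dst x sxt.
  have [x] := MVT_segment st d1 c1.
  rewrite in_itv/= => sxt ->; rewrite mulrA ler_wpM2r ?subr_ge0//.
  by apply: dlow; apply: (Jbtw s t) => //; rewrite min_l// max_r.
have inj (s t : R) : J s -> J t -> k / 2 * `|t - s| <= `|ci j t - ci j s|.
  have h (s' t' : R) : J s' -> J t' -> s' <= t' -> k / 2 * `|t' - s'| <= `|ci j t' - ci j s'|.
    move=> Js Jt st; rewrite (ger0_norm (_ : 0 <= t' - s')) ?subr_ge0//.
    apply: le_trans (inc _ _ Js Jt st) _; apply: le_trans (ler_norm _) _.
    by rewrite normrM e1 mul1r.
  move=> Js Jt; have /orP[st|ts] := le_total s t; first exact: h.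
  by rewrite (distrC t) (distrC (ci j t)); exact: h.
have uniq_param (s t : R) : J s -> J t -> ci j s = ci j t -> s = t.
  move=> Js Jt est; have := inj s t Js Jt; rewrite est subrr normr0.
  rewrite pmulr_rle0 ?divr_gt0// normr_le0 subr_eq0 => /eqP ->//.
pose x0 := pcoord j p.
have x0E : ci j t0 = x0 by rewrite ciE ct0.
have Jt0 : J t0 by rewrite /J subrr normr0 ltW.
pose h1 := k / 2 * n.
have h10 : 0 < h1 by rewrite /h1 mulr_gt0// divr_gt0.
have surj (x : R) : `|x - x0| < h1 -> exists2 t, J t & ci j t = x.
  rewrite ltr_distl => /andP[xl xr].
  have Jl : J (t0 - n) by rewrite /J (addrC t0) addrK normrN gtr0_norm.
  have Jr : J (t0 + n) by rewrite /J (addrC t0) addrK gtr0_norm.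
  have nn : t0 - n <= t0 + n by move: n0; clear; lra.
  have cc : {within `[t0 - n, t0 + n], continuous (ci j)}.
    apply: derivable_within_continuous => y; rewrite in_itv/= => yn.
    have [] // : is_derive y 1 (ci j) (d j y).
    by apply: dci; apply: nI; rewrite ler_distl.
  have i1 := inc _ _ Jl Jt0 (_ : t0 - n <= t0); have i2 := inc _ _ Jt0 Jr (_ : t0 <= t0 + n).
  have {}i1 : h1 <= e * (x0 - ci j (t0 - n)).
    by rewrite -x0E; have := i1 ltac:(by rewrite gerBl ltW); rewrite opprB addrC subrK.
  have {}i2 : h1 <= e * (ci j (t0 + n) - x0).
    by rewrite -x0E; have := i2 ltac:(by rewrite lerDl ltW); rewrite (addrC t0 n) addrK.
  have [|t tn tx] := @IVT R (ci j) (t0 - n) (t0 + n) x nn cc.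
    have [ep|en] : e = 1 \/ e = -1.
      rewrite /e; case: (ltrgt0P (d j t0)) => h.
      - by left; rewrite gtr0_sg.
      - by right; rewrite ltr0_sg.
      - by rewrite h eqxx in dj0.
    - by rewrite ep !mul1r in i1 i2; rewrite ge_min le_max; apply/andP; split; apply/orP;
        [left|right]; move: i1 i2 xl xr; clear; lra.
    - by rewrite en !mulN1r in i1 i2; rewrite ge_min le_max; apply/andP; split; apply/orP;
        [right|left]; move: i1 i2 xl xr; clear; lra.
  by exists t => //; rewrite /J ler_distl; move: tn; rewrite in_itv.
have [tau tauP] : {tau : R -> R | forall x, `|x - x0| < h1 -> J (tau x) /\ ci j (tau x) = x}.
  exists (fun x => xget 0 [set t | J t /\ ci j t = x]) => x hx.
  by have [t Jt tx] := surj x hx; case: xgetP => [y -> []|/(_ t)] //; case.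
pose g x := ci (~~ j) (tau x).
pose m x := d (~~ j) (tau x) / d j (tau x).
have dge t : J t -> k / 2 <= `|d j t|.
  by move=> Jt; apply: le_trans (dlow t Jt) _; rewrite -[X in _ <= X]mul1r -e1 -normrM ler_norm.
have tlip (x y : R) : `|x - x0| < h1 -> `|y - x0| < h1 -> `|tau y - tau x| <= 2 / k * `|y - x|.
  move=> hx hy; have [Jx tx] := tauP x hx; have [Jy ty] := tauP y hy.
  have := inj _ _ Jx Jy; rewrite tx ty => h.
  rewrite -(@ler_pM2l _ (k / 2)) ?divr_gt0//; apply: le_trans h _.
  by rewrite mulrA (_ : k / 2 * (2 / k) = 1) ?mul1r//; field; rewrite gt_eqF.
pose L := 1 + 2 * B / k.
have L1 : 1 <= L by rewrite /L lerDl divr_ge0 ?mulr_ge0// ltW.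
have slope (x : R) : `|x - x0| < h1 -> `|m x| <= L.
  move=> hx; have [Jx _] := tauP x hx.
  rewrite /m normrM normfV ler_pdivrMr; last first.
    by apply: lt_le_trans (dge _ Jx); rewrite divr_gt0.
  apply: le_trans (dup _ Jx) _; apply: (@le_trans _ _ (L * (k / 2))); last first.
    by rewrite ler_wpM2l ?dge// (le_trans ler01).
  rewrite /L mulrDl mul1r (_ : 2 * B / k * (k / 2) = B); last by field; rewrite gt_eqF.
  by rewrite lerDr divr_ge0// ltW.
have glip (x y : R) : `|x - x0| < h1 -> `|y - x0| < h1 -> `|g y - g x| <= L * `|y - x|.
  move=> hx hy; have [Jx tx] := tauP x hx; have [Jy ty] := tauP y hy.
  apply: (@le_trans _ _ (B * `|tau y - tau x|)).
    apply: (@mvt_abs (ci (~~ j)) (d (~~ j))) => z /(Jbtw _ _ _ Jx Jy) Jz.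
      by apply: dci; exact: nI.
    exact: dup.
  apply: (le_trans (ler_wpM2l (ltW B0) (tlip x y hx hy))).
  rewrite mulrA ler_wpM2r// /L (_ : B * (2 / k) = 2 * B / k); last by ring.
  by rewrite lerDr.
have taylor i (s t : R) : J s -> J t ->
    `|ci i t - ci i s - d i s * (t - s)| <= C * `|t - s| `^ (1 + a).
  move=> Js Jt.
  have E1 : `|t - s| `^ (1 + a) = `|t - s| `^ a * `|t - s|.
    rewrite mulrC; have [->|ts] := eqVneq (`|t - s|) 0.
      by rewrite mul0r powR0// gt_eqF// addr_gt0.
    by rewrite powRD ?powRr1// ts implybT.
  have := @mvt_abs (fun x => ci i x - d i s * x) (fun x => d i x - d i s) s t
    (C * `|t - s| `^ a).
  rewrite E1 mulrA => H.
  have -> : ci i t - ci i s - d i s * (t - s) = ci i t - d i s * t - (ci i s - d i s * s).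
    by ring.
  apply: H => x xst; have Jx := Jbtw s t x Js Jt xst.
    apply: is_deriveB; first by apply: dci; exact: nI.
    by have := is_derive_scale (d i s) (is_derive_id x 1); rewrite mulr1.
  apply: le_trans (hold i x s (nI x Jx) (nI s Js)) _; rewrite ler_wpM2l//.
  apply: ge0_ler_powR; rewrite ?nnegrE ?(ltW a0)//.
  move: xst; rewrite ge_min le_max => /andP[/orP q1 /orP q2].
  have := ler_norm (t - s); have := ler_norm (s - t); rewrite (distrC s) ler_norml.
  by move=> q3 q4; apply/andP; split; case: q1; case: q2; move: q3 q4; clear; lra.
pose K := 1 + (1 + L) * C * (2 / k) `^ (1 + a).
have K1 : 1 <= K.
  by rewrite /K lerDl !mulr_ge0 ?powR_ge0// addr_ge0// (le_trans ler01).
have ghol (x y : R) : `|x - x0| < h1 -> `|y - x0| < h1 ->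
    `|g y - g x - m x * (y - x)| <= K * `|y - x| `^ (1 + a).
  move=> hx hy; have [Jx tx] := tauP x hx; have [Jy ty] := tauP y hy.
  have dn : d j (tau x) != 0.
    by rewrite -normr_gt0; apply: lt_le_trans (dge _ Jx); rewrite divr_gt0.
  have E : g y - g x - m x * (y - x) =
      (ci (~~ j) (tau y) - ci (~~ j) (tau x) - d (~~ j) (tau x) * (tau y - tau x)) -
      m x * (ci j (tau y) - ci j (tau x) - d j (tau x) * (tau y - tau x)).
    by rewrite ty tx /g /m; field.
  rewrite E; apply: le_trans (ler_normB _ _) _; rewrite normrM.
  have T1 := taylor (~~ j) _ _ Jx Jy; have T2 := taylor j _ _ Jx Jy.
  have T3 := ler_pM (normr_ge0 _) (normr_ge0 _) (slope x hx) T2.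
  have T4 : `|tau y - tau x| `^ (1 + a) <= (2 / k) `^ (1 + a) * `|y - x| `^ (1 + a).
    rewrite -powRM ?divr_ge0 ?(ltW k0)//; apply: ge0_ler_powR.
    - by rewrite addr_ge0// ltW.
    - by rewrite nnegrE.
    - by rewrite nnegrE mulr_ge0// divr_ge0// ltW.
    - exact: tlip.
  have LC : 0 <= (1 + L) * C by rewrite mulr_ge0// addr_ge0// (le_trans ler01).
  have T5 := ler_wpM2l LC T4.
  have T6 : 0 <= `|y - x| `^ (1 + a) := powR_ge0 _ _.
  rewrite /K; move: T1 T3 T5 T6.
  move: (`|tau y - tau x| `^ (1 + a)) (`|y - x| `^ (1 + a)) ((2 / k) `^ (1 + a)) => u v w.
  by clear; lra.
have [q q0 qP] : exists2 q : R, 0 < q & forall z, sqr_nbh p q z -> (S `&` U) z -> `|hh z - t0| < n.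
  have /subspace_continuousP/(_ p (conj Sp Up))/cvgrPdist_lt/(_ n n0) := ch.
  rewrite near_withinE => /nbhs_sqrP[q q0 qP]; exists q => // z zq SUz.
  by rewrite distrC -hp; exact: qP.
have [q' q'0 qU] := open_sqrP oU Up.
pose h := Num.min h1 (Num.min q q' / (2 * L)).
have L0 : 0 < L := lt_le_trans ltr01 L1.
have qq : 0 < Num.min q q' by rewrite lt_min q0.
have h0 : 0 < h by rewrite lt_min h10 divr_gt0// mulr_gt0.
have hh1 x : `|x - x0| < h -> `|x - x0| < h1.
  by move=> hx; apply: lt_le_trans hx _; rewrite ge_min lexx.
have hq : 2 * L * h <= Num.min q q'.
  by rewrite mulrC -ler_pdivlMr ?mulr_gt0// ge_min lexx orbT.
have hL : h <= 2 * L * h.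
  by rewrite ler_peMl ?(ltW h0)//; move: L1; clear; lra.
exists K, L, h, j, g, m; split => //.
- move=> z zj zo; have [Jz tz] := tauP _ (hh1 _ zj).
  have zp : sqr_nbh p (Num.min q q') z.
    apply/(sqr_nbhP j); split; last exact: lt_le_trans hq.
    by apply: lt_le_trans zj _; exact: le_trans hq.
  have zq : sqr_nbh p q z by apply: sub_sqr_nbh zp; rewrite ge_min lexx.
  have zU : U z by apply: qU; apply: sub_sqr_nbh zp; rewrite ge_min lexx orbT.
  split.
    move=> Sz; have := qP z zq (conj Sz zU).
    have [t It tz'] : (c @` I) z by rewrite cI.
    rewrite -tz' hc// => /ltW Jt; rewrite -tz' in Jz tz.
    rewrite /g (uniq_param _ _ Jz Jt); first by rewrite ciE.
    by rewrite tz ciE.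
  move=> zg; have -> : z = c (tau (pcoord j z)).
    by move: zg tz; rewrite /g !ciE; case: (j) => /= e2 e3;
      rewrite [LHS]surjective_pairing [RHS]surjective_pairing; congr (_, _).
  have : (c @` I) (c (tau (pcoord j z))) by exists (tau (pcoord j z)) => //; exact: nI.
  by rewrite cI => -[].
- have x0h : `|x0 - x0| < h1 by rewrite subrr normr0.
  have [Jx tx] := tauP x0 x0h.
  by rewrite /g (uniq_param _ t0 Jx Jt0) ?tx// ciE ct0.
- by move=> x y /hh1 hx /hh1 hy; exact: glip.
- by move=> x /hh1; exact: slope.
- by move=> x y /hh1 hx /hh1 hy; exact: ghol.
Qed.

End Charts.

Section BallGeometry.
Variable R : realType.
Implicit Types (z w p q n : R * R) (i j : bool) (S U E : set (R * R)) (g m : R -> R).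

Lemma uniform_on_compact S (P : R -> R * R -> Prop) : compact S ->
  (forall p, S p -> exists T e : R, 0 < e /\
    forall t q, T <= t -> sqr_nbh p e q -> S q -> P t q) ->
  exists t : R, 1 <= t /\ forall q, S q -> P t q.
Proof.
move=> /compact_near_coveringP cS SP.
have [|N _ HN] := cS nat eventually (fun (k : nat) q => S q -> P k%:R q) _.
  move=> p Sp; have [T [e [e0 TP]]] := SP p Sp.
  exists (sqr_nbh p e, [set k : nat | T <= k%:R]).
    split; first by apply/nbhs_sqrP; exists e.
    exact: nbhs_infty_ger.
  by move=> [q k] /= [hq hk]; exact: TP.
exists (N.+1)%:R; split; first by rewrite ler1n.
by move=> q Sq; apply: (HN N.+1) => //=.
Qed.

Lemma nearest_point S w : compact S -> S !=set0 ->
  exists2 q, S q & forall s, S s -> en (w - q) <= en (w - s).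
Proof.
move=> cS S0.
have ce : {within S, continuous (fun s => nsq (s - w))}.
  by apply: continuous_subspaceT => z; exact: nsq_continuous.
have [q /[!inE] Sq qmin] := compact_EVT_min S0 cS ce.
exists q => // s Ss; rewrite -ler_sqr ?nnegrE ?en_ge0// !sqr_en.
have sym v : nsq (w - v) = nsq (v - w) by rewrite /nsq /=; ring.
by rewrite !sym; apply: qmin; rewrite inE.
Qed.

(* n is a unit normal at q; the third clause keeps a connected set off S on one side of the
   tangent line up to a quadratic error, the fourth says that q is reached from its nearest points along n. *)
Definition flat_at S (K e : R) q : Prop := exists n, [/\ nsq n = 1,
  (forall z, S z -> en (z - q) < e -> `|dot n (z - q)| <= K * nsq (z - q)),
  (forall (b : R) E w w', b ^+ 2 = 1 -> connected E ->
     (forall z, E z -> ~ S z /\ en (z - q) < e) -> E w -> E w' ->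
     K * nsq (w - q) < b * dot n (w - q) -> - (K * nsq (w' - q)) <= b * dot n (w' - q)) &
  (forall w, (forall s, S s -> en (w - q) <= en (w - s)) -> exists l : R, w - q = l *: n)].

Lemma nsq_scale (l : R) n : nsq (l *: n) = l ^+ 2 * nsq n.
Proof. by rewrite /nsq /=; rewrite /GRing.scale/=; ring. Qed.

Lemma pcoordB i z w : pcoord i (z - w) = pcoord i z - pcoord i w.
Proof. by case: i. Qed.

Lemma pcoord_en i z : `|pcoord i z| <= en z.
Proof. by rewrite -modulusE pcoord_le_modulus. Qed.

Lemma nsq_pcoord i z : nsq z = pcoord i z ^+ 2 + pcoord (~~ i) z ^+ 2.
Proof. by case: i; rewrite /nsq /= // addrC. Qed.

Lemma dot_pcoord i n z : dot n z = pcoord i n * pcoord i z + pcoord (~~ i) n * pcoord (~~ i) z.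
Proof. by case: i; rewrite /dot /= // addrC. Qed.

Definition of_pcoords j (x y : R) : R * R := if j then (x, y) else (y, x).

Lemma pcoord_of_pcoords j x y : pcoord j (of_pcoords j x y) = x /\
  pcoord (~~ j) (of_pcoords j x y) = y.
Proof. by case: j. Qed.

Lemma connected_nonzero_sign E (phi : R * R -> R) w w' : connected E ->
  {within E, continuous phi} -> (forall z, E z -> phi z != 0) -> E w -> E w' ->
  0 < phi w -> 0 < phi w'.
Proof.
move=> cE cphi n0 Ew Ew' pw; rewrite ltNge; apply/negP => pw'.
have : is_interval (phi @` E).
  by apply/connected_intervalP; exact: connected_continuous_connected.
move=> H; have [z Ez z0] : (phi @` E) 0.
  by apply: (H (phi w') (phi w)); [exists w'|exists w|rewrite pw' (ltW pw)].
by have := n0 z Ez; rewrite z0 eqxx.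
Qed.

Lemma vanishing_slope (X M h : R) : 0 < h -> 0 <= M ->
  (forall t, `|t| < h -> 2 * t * X <= M * t ^+ 2) -> X = 0.
Proof.
move=> h0 M0 key; apply/eqP; apply: contraT => Xn.
have Xp : 0 < `|X| by rewrite normr_gt0.
have M1 : 0 < M + 1 by move: M0; clear; lra.
have [s [s0 sM sX]] : exists s, [/\ 0 < s, s <= (M + 1)^-1 & s <= h / 2 / `|X|].
  exists (Num.min (M + 1)^-1 (h / 2 / `|X|)).
  by rewrite lt_min invr_gt0 M1 !divr_gt0//=; split=> //; rewrite ge_min lexx ?orbT.
have Ms : s * (M + 1) <= 1 by rewrite -ler_pdivlMr// mul1r.
have Xs : s * `|X| <= h / 2 by rewrite -ler_pdivlMr.
have X2 : 0 < s * X ^+ 2 by rewrite mulr_gt0// -real_normK ?num_real// exprn_gt0.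
have := key (s * X); rewrite normrM (gtr0_norm s0).
have /[swap] /[apply] : s * `|X| < h by move: Xs h0; clear; lra.
have -> : 2 * (s * X) * X = 2 * (s * X ^+ 2) by ring.
have -> : M * (s * X) ^+ 2 = (s * X ^+ 2) * (M * s) by ring.
rewrite mulrC ler_pM2l//; move: Ms s0; clear; lra.
Qed.

Section InChart.
Variables (S : set (R * R)) (a K L h : R) (j : bool) (p : R * R) (g m : R -> R).
Hypothesis ch : graph_chart S a K L h j p g m.

Let L0 : 0 < L. Proof. exact: lt_le_trans (chart_L ch). Qed.
Let h0 : 0 < h. Proof. exact: chart_h ch. Qed.

Lemma graph_in_box x : `|x - pcoord j p| < h -> `|g x - pcoord (~~ j) p| < 2 * L * h.
Proof.
move=> hx; have hp : `|pcoord j p - pcoord j p| < h by rewrite subrr normr0.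
rewrite -(chart_center ch); apply: le_lt_trans (chart_lip ch hp hx) _.
rewrite -mulrA -[X in X < _]mul1r; have := ltW L0 => L0'.
apply: (@le_lt_trans _ _ (1 * (L * h))); first by rewrite !mul1r ler_wpM2l// ltW.
by rewrite ltr_pM2r ?mulr_gt0// ltr1n.
Qed.

Lemma chart_point x : `|x - pcoord j p| < h -> S (of_pcoords j x (g x)).
Proof.
move=> hx; have [e1 e2] := pcoord_of_pcoords j x (g x).
apply/(chart_mem ch); rewrite ?e1 ?e2//; exact: graph_in_box.
Qed.

Definition height z : R := pcoord (~~ j) z - g (pcoord j z).

Lemma height_continuous z : `|pcoord j z - pcoord j p| < h -> {for z, continuous height}.
Proof.
move=> zh; apply: cvgB; first exact: pcoord_continuous.
apply: (@continuous_comp _ _ _ (@pcoord R j) g); first exact: pcoord_continuous.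
apply/cvgrPdist_lt => e e0.
have d0 : 0 < Num.min (e / L) (h - `|pcoord j z - pcoord j p|).
  by rewrite lt_min divr_gt0// subr_gt0.
apply/nbhs_ballP; exists (Num.min (e / L) (h - `|pcoord j z - pcoord j p|)) => // y.
rewrite /ball/= lt_min => /andP[y1 y2].
have yh : `|y - pcoord j p| < h.
  have := ler_normD (y - pcoord j z) (pcoord j z - pcoord j p).
  rewrite addrA subrK (distrC y (pcoord j z)) => y3; apply: (le_lt_trans y3).
  by rewrite -ltrBrDr.
rewrite distrC; apply: le_lt_trans (chart_lip ch zh yh) _.
by rewrite distrC mulrC -ltr_pdivlMr.
Qed.

End InChart.

Lemma flat_near_chart S K L h j p g m q : graph_chart S 1 K L h j p g m ->
  `|pcoord j q - pcoord j p| < h / 2 ->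
  `|pcoord (~~ j) q - pcoord (~~ j) p| < h / 2 -> S q ->
  forall K' e, K <= K' -> e <= h / 2 -> flat_at S K' e q.
Proof.
move=> ch qj qo Sq K' e KK' eh.
have h0 := chart_h ch; have L1 := chart_L ch; have K1 := chart_K ch.
have K'0 : 0 <= K' by apply: le_trans KK'; exact: le_trans K1.
have box z : en (z - q) < e -> `|pcoord j z - pcoord j p| < h /\
    `|pcoord (~~ j) z - pcoord (~~ j) p| < 2 * L * h.
  move=> zq; have := pcoord_en j (z - q); have := pcoord_en (~~ j) (z - q).
  rewrite !pcoordB => h1 h2.
  have := ler_normD (pcoord j z - pcoord j q) (pcoord j q - pcoord j p).
  have := ler_normD (pcoord (~~ j) z - pcoord (~~ j) q) (pcoord (~~ j) q - pcoord (~~ j) p).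
  rewrite !addrA !subrK => h3 h4.
  have h5 : h <= 2 * L * h by rewrite ler_peMl ?(ltW h0)//; move: L1; clear; lra.
  by split; move: zq eh h1 h2 h3 h4 h5 qj qo; clear; lra.
set xq := pcoord j q.
have hq : `|xq - pcoord j p| < h by apply: lt_trans qj _; move: h0; clear; lra.
have gq : pcoord (~~ j) q = g xq.
  apply/(chart_mem ch hq) => //; apply: lt_le_trans qo _.
  have h5 : h <= 2 * L * h by rewrite ler_peMl ?(ltW h0)//; move: L1; clear; lra.
  by move: h0 h5; clear; lra.
pose s := Num.sqrt (1 + m xq ^+ 2).
have s2 : s ^+ 2 = 1 + m xq ^+ 2 by rewrite sqr_sqrtr// addr_ge0// sqr_ge0.
have s1 : 1 <= s.
  rewrite -(@ler_sqr _ 1) ?nnegrE ?sqrtr_ge0// s2 expr1n lerDl sqr_ge0//.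
have s0 : 0 < s := lt_le_trans ltr01 s1.
clearbody s; pose n := of_pcoords j (- m xq / s) (1 / s).
have [n1 n2] := pcoord_of_pcoords j (- m xq / s) (1 / s).
have dotE z : s * dot n (z - q) = pcoord (~~ j) z - g xq - m xq * (pcoord j z - xq).
  rewrite (dot_pcoord j) n1 n2 !pcoordB gq -/xq; move: (pcoord j z) (pcoord (~~ j) z) (g xq) => X Y Z.
  by field; rewrite gt_eqF.
have hold z : `|pcoord j z - pcoord j p| < h ->
    `|g (pcoord j z) - g xq - m xq * (pcoord j z - xq)| <= K * nsq (z - q).
  move=> zh; have := chart_holder ch hq zh.
  rewrite (_ : 1 + 1 = 2%:R) ?powR_mulrn// real_normK ?num_real// => h1.
  apply: (le_trans h1); rewrite ler_wpM2l ?(le_trans ler01)//.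
  by rewrite (nsq_pcoord j) !pcoordB -/xq lerDl sqr_ge0.
have nq0 z : 0 <= nsq (z - q) := nsq_ge0 _.
have K0 : 0 <= K := le_trans ler01 K1.
have KK z : K * nsq (z - q) <= K' * nsq (z - q) by rewrite ler_wpM2r.
exists n; split.
- rewrite (nsq_pcoord j) n1 n2 !expr_div_n sqrrN expr1n -mulrDl addrC -s2 divff//.
  by rewrite expf_neq0// gt_eqF.
- move=> z Sz /box[zj zo].
  have := (chart_mem ch zj zo).1 Sz => zg.
  have h1 : `|s * dot n (z - q)| <= K * nsq (z - q) by rewrite dotE zg; exact: hold.
  apply: le_trans (KK z); apply: le_trans h1.
  by rewrite normrM (ger0_norm (ltW s0)) ler_peMl.
- move=> b E w w' b2 cE EP Ew Ew' wpos.
  have b1 : `|b| = 1 by apply/eqP; rewrite -(@eqrXn2 _ 2)// real_normK ?num_real// b2 expr1n.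
  have cH : {within E, continuous (fun z => b * height j g z)}.
    apply: continuous_in_subspaceT => z /[!inE] /EP[_ /box[zj _]].
    by apply: cvgM; [exact: cvg_cst|exact: (height_continuous ch)].
  have Hn z : E z -> b * height j g z != 0.
    move=> /EP[nSz /box[zj zo]]; rewrite mulf_neq0//; first by rewrite -normr_gt0 b1.
    by rewrite subr_eq0; apply/eqP => zg; apply: nSz; apply/(chart_mem ch).
  have aux z : E z -> `|b * (s * dot n (z - q)) - b * height j g z| <= K * nsq (z - q).
    move=> /EP[_ /box[zj _]]; rewrite -mulrBr normrM b1 mul1r dotE /height.
    by rewrite (_ : _ - _ - _ - _ = g (pcoord j z) - g xq - m xq * (pcoord j z - xq)); [exact: hold|ring].
  have hw : 0 < b * height j g w.
    have := aux w Ew; rewrite ler_norml => /andP[_ h1].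
    have h2 : K * nsq (w - q) < b * (s * dot n (w - q)).
      rewrite mulrCA; apply: le_lt_trans (KK w) _; apply: (lt_le_trans wpos).
      rewrite ler_peMl//; apply: ltW; apply: le_lt_trans wpos; rewrite mulr_ge0//.
    by move: h1 h2; clear; lra.
  have hw' := connected_nonzero_sign cE cH Hn Ew Ew' hw.
  have := aux w' Ew'; rewrite ler_norml => /andP[h1 _].
  have h2 : - (K * nsq (w' - q)) <= b * (s * dot n (w' - q)) by move: h1 hw'; clear; lra.
  have [d0|d0] := leP 0 (b * dot n (w' - q)).
    by apply: le_trans d0; rewrite oppr_le0 mulr_ge0.
  have h3 : b * (s * dot n (w' - q)) <= b * dot n (w' - q).
    by rewrite mulrCA; rewrite -subr_ge0 -[X in X - _]mul1r -mulrBl mulr_le0// ?subr_le0// ltW.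
  by apply: (@le_trans _ _ (- (K * nsq (w' - q)))); [rewrite lerN2|exact: le_trans h3].
- move=> w wmin.
  pose A := pcoord j (w - q); pose B := pcoord (~~ j) (w - q).
  pose X := A + m xq * B; pose M := 1 + L ^+ 2 + 2 * `|B| * K.
  have M0 : 0 <= M.
    by rewrite /M; have := mulr_ge0 (normr_ge0 B) K0; have := sqr_ge0 L; clear; lra.
  have key t : `|t| < h / 2 -> 2 * t * X <= M * t ^+ 2.
    move=> th; have xt : `|xq + t - pcoord j p| < h.
      have := ler_normD (xq - pcoord j p) t; rewrite addrAC.
      by move: th qj; rewrite -/xq; clear; lra.
    have Sz := chart_point ch xt.
    have [e1 e2] := pcoord_of_pcoords j (xq + t) (g (xq + t)).
    have := wmin _ Sz; rewrite -[en _ <= _]ler_sqr ?nnegrE ?en_ge0// !sqr_en !(nsq_pcoord j).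
    have -> : pcoord j (w - of_pcoords j (xq + t) (g (xq + t))) = A - t.
      by rewrite pcoordB e1 /A pcoordB -/xq; ring.
    pose G := g (xq + t) - g xq.
    have -> : pcoord (~~ j) (w - of_pcoords j (xq + t) (g (xq + t))) = B - G.
      by rewrite pcoordB e2 /B pcoordB gq /G; ring.
    rewrite -/A -/B => h1.
    have h2 : `|G| <= L * `|t|.
      by have := chart_lip ch hq xt; rewrite (addrC xq t) addrK -(addrC xq t).
    have h3 : `|G - m xq * t| <= K * t ^+ 2.
      have := chart_holder ch hq xt; rewrite (addrC xq t) addrK -(addrC xq t).
      by rewrite (_ : 1 + 1 = 2%:R) ?powR_mulrn// real_normK ?num_real.
    have h4 : G ^+ 2 <= L ^+ 2 * t ^+ 2.
      rewrite -exprMn -(real_normK (num_real G)) -(real_normK (num_real (L * t))).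
      by rewrite ler_sqr ?nnegrE// normrM (ger0_norm (le_trans ler01 L1)).
    have h5 : `|B * (G - m xq * t)| <= `|B| * (K * t ^+ 2).
      by rewrite normrM ler_wpM2l.
    move: h5; rewrite ler_norml => /andP[h5 _].
    have alg (a b c d e' v k l : R) : a ^+ 2 + b ^+ 2 <= (a - d) ^+ 2 + (b - c) ^+ 2 ->
        c ^+ 2 <= l ^+ 2 * d ^+ 2 -> - (v * (k * d ^+ 2)) <= b * (c - e' * d) ->
        2 * d * (a + e' * b) <= (1 + l ^+ 2 + 2 * v * k) * d ^+ 2 by clear; lra.
    exact: (alg _ _ _ _ _ _ _ _ h1 h4 h5).
  have X0 : X = 0 by apply: (vanishing_slope _ M0 key); rewrite divr_gt0.
  exists (B * s).
  have AE : A = - (m xq * B) by move: X0; rewrite /X; clear; lra.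
  have sn : s != 0 by rewrite gt_eqF.
  suff : pcoord j (w - q) = pcoord j ((B * s) *: n) /\
         pcoord (~~ j) (w - q) = pcoord (~~ j) ((B * s) *: n).
    by move: (w - q) (_ *: n) => [u1 u2] [v1 v2]; case: (j) => /= -[-> ->].
  have pZ i : pcoord i ((B * s) *: n) = B * s * pcoord i n by case: i.
  rewrite !pZ n1 n2 -/A -/B AE; split; field => //.
Qed.

Lemma ball_geometry_exists S : Cla_curve 1 1 S -> compact S ->
  exists r eps C : R, [/\ 0 < r, 0 < eps, 0 <= C & ball_geometry S r eps C].
Proof.
move=> cS coS.
have [t [t1 flat]] : exists t : R, 1 <= t /\ forall q, S q -> flat_at S t t^-1 q.
  apply: uniform_on_compact => // p Sp.
  have [K [L [h [j [g [m ch]]]]]] := graph_chart_exists ltr01 (lexx 1) cS Sp.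
  have h0 := chart_h ch; have K1 := chart_K ch.
  exists (Num.max K (2 / h)), (h / 2); split; first by rewrite divr_gt0.
  move=> t q; rewrite ge_max => /andP[Kt ht] qp Sq.
  have t0 : 0 < t by apply: lt_le_trans Kt; exact: lt_le_trans K1.
  have [qj qo] := (sqr_nbhP j p (h / 2) q).1 qp.
  apply: (flat_near_chart ch) => //.
  by rewrite -[h / 2]invrK lef_pV2 ?posrE ?invr_gt0 ?divr_gt0// invf_div.
have t0 : 0 < t := lt_le_trans ltr01 t1.
pose r := (4 * t)^-1; pose eps := (8 * t)^-1.
have t4 : 0 < 4 * t by rewrite mulr_gt0.
have t8 : 0 < 8 * t by rewrite mulr_gt0.
have r0 : 0 < r by rewrite invr_gt0.
have eps0 : 0 < eps by rewrite invr_gt0.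
have tr : t * r = 1 / 4 by rewrite /r; field; rewrite gt_eqF.
have te : t * eps = 1 / 8 by rewrite /eps; field; rewrite gt_eqF.
have er : r = 2 * eps by rewrite /r /eps; field; rewrite gt_eqF.
have et : t^-1 = 8 * eps by rewrite /eps; field; rewrite gt_eqF.
clearbody r eps.
exists r, eps, 2; split => // w nSw [s0 Ss0 ws0].
have [q Sq qmin] := @nearest_point S w coS (ex_intro _ s0 Ss0).
have [n [n1 ball side nrm]] := flat q Sq.
have [l wl] := nrm w qmin.
have qw := qmin s0 Ss0.
pose delta := en (w - q).
have d0 : 0 <= delta := en_ge0 _.
have de : delta < eps by apply: le_lt_trans qw ws0.
have d2 : delta ^+ 2 = l ^+ 2 by rewrite /delta sqr_en wl nsq_scale n1 mulr1.
have ln0 : l != 0.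
  apply: contra_notN nSw => /eqP l0; move: wl; rewrite l0 scale0r => /eqP.
  by rewrite subr_eq0 => /eqP ->.
pose b := Num.sg l.
have bl : b * l = delta.
  have : `|l| = delta by apply/eqP; rewrite -(@eqrXn2 _ 2)// real_normK ?num_real// d2.
  by rewrite normrEsg.
have b2 : b ^+ 2 = 1 by rewrite /b sqr_sg ln0.
have bn : `|b| = 1 by rewrite /b normr_sg ln0.
clearbody b.
have lE : l = b * delta by rewrite -bl mulrA -expr2 b2 mul1r.
have dn z : dot (b *: n) z = b * dot n z.
  by rewrite /dot /=; rewrite /GRing.scale/=; ring.
pose c := q + r *: (b *: n).
have zc z : nsq (z - c) = nsq (z - q) - 2 * r * (b * dot n (z - q)) + r ^+ 2.
  have -> : r ^+ 2 = r ^+ 2 * (b ^+ 2 * nsq n) by rewrite n1 b2 !mulr1.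
  by rewrite /c /nsq /dot /= /GRing.scale/=; ring.
have wd : b * dot n (w - q) = delta.
  have dsc : dot n (l *: n) = l * nsq n by rewrite /dot /nsq /= /GRing.scale/=; ring.
  by rewrite wl dsc n1 mulr1.
exists delta, c; split => //; [|  |by split=> //; exists q|].
- have : nsq (w - c) = (r - delta) ^+ 2.
    by rewrite zc wd -sqr_en -/delta; ring.
  move=> h; rewrite /en h sqrtr_sqr ger0_norm//.
  by rewrite er; move: de d0 eps0; clear; lra.
- move=> z Sz; rewrite -ler_sqr ?nnegrE ?en_ge0 ?(ltW r0)// sqr_en.
  have [zq|zq] := ltP (en (z - q)) t^-1; last first.
    rewrite -sqr_en ler_sqr ?nnegrE ?en_ge0 ?(ltW r0)//.
    have := en_tri z c q; have -> : en (c - q) = r.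
      rewrite /c (addrC q) addrK /en !nsq_scale n1 b2 !mulr1 sqrtr_sqr ger0_norm// ltW//.
    by move: zq er eps0; rewrite et; clear; lra.
  have := ball z Sz zq => h; rewrite zc.
  have h1 : b * dot n (z - q) <= t * nsq (z - q).
    apply: le_trans (ler_norm _) _; rewrite normrM bn mul1r//.
  have h2 : 2 * r * (b * dot n (z - q)) <= 2 * r * (t * nsq (z - q)).
    by rewrite ler_wpM2l// mulr_ge0// ltW.
  have h3 : 2 * r * (t * nsq (z - q)) = 1 / 2 * nsq (z - q).
    by rewrite (_ : 2 * r * _ = 2 * (t * r) * nsq (z - q)); [rewrite tr; field|ring].
  by have := nsq_ge0 (z - q); move: h2 h3; clear; lra.
- move=> E cE Ew EP w' Ew'.
  have near z : E z -> en (z - q) <= en (z - w) + delta by move=> _; exact: en_tri.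
  have EP' z : E z -> ~ S z /\ en (z - q) < t^-1.
    move=> Ez; have [nS zw] := EP z Ez; split=> //.
    by rewrite et; have := near z Ez; move: zw de eps0; clear; lra.
  have hw : t * nsq (w - q) < b * dot n (w - q).
    rewrite wd -sqr_en -/delta expr2 mulrA -[X in _ < X]mul1r ltr_pM2r//; last first.
      by rewrite lt_neqAle d0 andbT eq_sym -sqrf_eq0 d2 sqrf_eq0.
    have : t * delta < t * eps by rewrite ltr_pM2l.
    by rewrite te; clear; lra.
  have h1 := side b E w w' b2 cE EP' Ew Ew' hw.
  rewrite zc addrK.
  have h2 : 2 * r * - (t * nsq (w' - q)) <= 2 * r * (b * dot n (w' - q)).
    by rewrite ler_wpM2l// mulr_ge0// ltW.
  have h3 : 2 * r * - (t * nsq (w' - q)) = - (1 / 2 * nsq (w' - q)).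
    by rewrite (_ : 2 * r * _ = - (2 * (t * r) * nsq (w' - q))); [rewrite tr; field|ring].
  have h4 : nsq (w' - q) <= (en (w' - w) + delta) ^+ 2.
    by rewrite -sqr_en ler_sqr ?nnegrE ?en_ge0 ?addr_ge0 ?en_ge0//; exact: near.
  have := nsq_ge0 (w' - q); move: h2 h3 h4; clear; lra.
Qed.

End BallGeometry.

(** * Components of a quasiconformal map *)
Section Bridge.
Variable R : realType.
Implicit Types (z w : R * R) (i : bool) (A : set (R * R)) (f : R * R -> R * R).

Definition dir i (f : R * R -> R * R) : R * R -> R * R := if i then dx f else dy f.

Definition dirv i : R * R := if i then (1, 0) else (0, 1).

Lemma pd_of_derivable i f z : derivable f z (dirv i) ->
  pd i (fun z => (f z).1) z (dir i f z).1 /\ pd i (fun z => (f z).2) z (dir i f z).2.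
Proof.
move=> df.
have dE : dir i f z = 'D_(dirv i) f z by case: i df.
have sE (h : R) : slide i z (h *: 1 + pcoord i z) = h *: dirv i + z.
  clear df dE; case: i; apply: injective_projections; rewrite /= ?scaler0 ?add0r//;
    by rewrite /GRing.scale/= !mulr1.
have dc : is_derive (pcoord i z) 1 (fun t => f (slide i z t)) (dir i f z).
  have E : (fun h : R => h^-1 *: (f (slide i z (h *: 1 + pcoord i z)) -
      f (slide i z (pcoord i z)))) = (fun h => h^-1 *: (f (h *: dirv i + z) - f z)).
    by apply/funext => h; rewrite sE slide_pcoord.
  split; first by rewrite /derivable E.
  by rewrite dE /derive E.
by split; [exact: (@is_derive_pcoord R true)|exact: (@is_derive_pcoord R false)].
Qed.

Lemma mixed_difference i (u ui uij : R * R -> R) z (e h : R) : 0 < h -> h < e ->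
  (forall w, sqr_nbh z e w -> pd i u w (ui w)) ->
  (forall w, sqr_nbh z e w -> pd (~~ i) ui w (uij w)) ->
  exists2 w, sqr_nbh z e w &
    u (z.1 + h, z.2 + h) - u (z.1 + h, z.2) - u (z.1, z.2 + h) + u z = h ^+ 2 * uij w.
Proof.
move=> h0 he du dui.
pose o t := slide (~~ i) z t.
pose y := pcoord (~~ i) z; pose x := pcoord i z.
pose pt s t := slide i (slide (~~ i) z t) s.
have ptin s t : x <= s <= x + h -> y <= t <= y + h -> sqr_nbh z e (pt s t).
  rewrite /pt /x /y => /andP[s1 s2] /andP[t1 t2].
  have hs : `|s - pcoord i z| < e by rewrite ltr_norml; move: s1 s2 h0 he; clear; lra.
  have ht : `|t - pcoord (~~ i) z| < e by rewrite ltr_norml; move: t1 t2 h0 he; clear; lra.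
  by move: hs ht; clear; case: i => /= hs ht; split.
have hxx : x <= x <= x + h by rewrite lexx lerDl ltW.
have hyy : y <= y <= y + h by rewrite lexx lerDl ltW.
have hxh : x <= x + h <= x + h by rewrite lexx lerDl ltW.
have hyh : y <= y + h <= y + h by rewrite lexx lerDl ltW.
have pti s t : pcoord i (pt s t) = s by rewrite /pt pcoord_slide.
have ptS s t s' : slide i (pt s t) s' = pt s' t by rewrite /pt slide_slide.
have ptO s t t' : slide (~~ i) (pt s t) t' = pt s t' by rewrite /pt; case: (i).
have pto s t : pcoord (~~ i) (pt s t) = t by rewrite /pt; case: (i).
have dF s : x <= s <= x + h -> is_derive s 1 (fun s => u (pt s (y + h)) - u (pt s y))
    (ui (pt s (y + h)) - ui (pt s y)).
  move=> hs; apply: is_deriveB.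
    have := du _ (ptin s (y + h) hs hyh); rewrite /pd pti.
    by under eq_fun do rewrite ptS.
  have := du _ (ptin s y hs hyy); rewrite /pd pti.
  by under eq_fun do rewrite ptS.
have [|||s sI sE] := @MVT R (fun s => u (pt s (y + h)) - u (pt s y))
    (fun s => ui (pt s (y + h)) - ui (pt s y)) x (x + h).
- by rewrite ltrDl.
- by move=> s; rewrite in_itv/= => /andP[s1 s2]; apply: dF; rewrite !ltW.
- apply: derivable_within_continuous => s; rewrite in_itv/= => hs.
  by have [] := dF s hs.
have {sI} sI : x <= s <= x + h by move: sI; rewrite in_itv/= => /andP[s1 s2]; rewrite !ltW.
have dG t : y <= t <= y + h -> is_derive t 1 (fun t => ui (pt s t)) (uij (pt s t)).
  move=> ht; have := dui _ (ptin s t sI ht); rewrite /pd pto.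
  by under eq_fun do rewrite ptO.
have [|||t tI tE] := @MVT R (fun t => ui (pt s t)) (fun t => uij (pt s t)) y (y + h).
- by rewrite ltrDl.
- by move=> t; rewrite in_itv/= => /andP[t1 t2]; apply: dG; rewrite !ltW.
- apply: derivable_within_continuous => t; rewrite in_itv/= => ht.
  by have [] := dG t ht.
exists (pt s t).
  by apply: ptin => //; move: tI; rewrite in_itv/= => /andP[t1 t2]; rewrite !ltW.
have addK (a : R) : a + h - a = h by ring.
move: sE; rewrite tE !addK => sE.
have -> : h ^+ 2 * uij (pt s t) = uij (pt s t) * h * h by ring.
rewrite -sE /pt /x /y; clear; case: z => a b; case: i => /=; ring.
Qed.

Lemma mixed_partials_eq (u : R * R -> R) (ui : bool -> R * R -> R) (v1 v2 : R * R -> R) z (e : R) :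
  0 < e -> (forall i w, sqr_nbh z e w -> pd i u w (ui i w)) ->
  (forall w, sqr_nbh z e w -> pd false (ui true) w (v1 w)) ->
  (forall w, sqr_nbh z e w -> pd true (ui false) w (v2 w)) ->
  {for z, continuous v1} -> {for z, continuous v2} -> v1 z = v2 z.
Proof.
move=> e0 du d1 d2 /continuous_sqrP c1 /continuous_sqrP c2.
apply/eqP; rewrite -subr_eq0; apply: contraT; rewrite -normr_gt0 => D0.
have D2 : 0 < `|v1 z - v2 z| / 2 by rewrite divr_gt0.
have [e1 e10 h1] := c1 _ D2; have [e2 e20 h2] := c2 _ D2.
have [d [d0 de de1 de2]] : exists d, [/\ 0 < d, d <= e, d <= e1 & d <= e2].
  exists (Num.min e (Num.min e1 e2)).
  by rewrite !lt_min e0 e10 e20 !ge_min !lexx ?orbT.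
have dh : d / 2 < d by rewrite gtr_pMr// invf_lt1// ltr1n.
have dh0 : 0 < d / 2 by rewrite divr_gt0.
have sub w : sqr_nbh z d w -> sqr_nbh z e w by apply: sub_sqr_nbh.
have [w1 zw1 E1] := @mixed_difference true u (ui true) v1 z d _ dh0 dh
  (fun w hw => du true w (sub w hw)) (fun w hw => d1 w (sub w hw)).
have [w2 zw2 E2] := @mixed_difference false u (ui false) v2 z d _ dh0 dh
  (fun w hw => du false w (sub w hw)) (fun w hw => d2 w (sub w hw)).
have vv : v1 w1 = v2 w2.
  by move: E2; rewrite E1 => /mulfI; apply; rewrite sqrf_eq0 gt_eqF.
have := h1 w1 (sub_sqr_nbh de1 zw1); have := h2 w2 (sub_sqr_nbh de2 zw2).
rewrite vv; have := ler_distD (v2 w2) (v1 z) (v2 z).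
by rewrite (distrC (v1 z) (v2 w2)); clear; lra.
Qed.

Lemma normcE (x : R[i]) : Normc.normc x ^+ 2 = complex.Re x ^+ 2 + complex.Im x ^+ 2.
Proof. by case: x => a b /=; rewrite sqr_sqrtr// addr_ge0 ?sqr_ge0. Qed.

Lemma normc_ge0 (x : R[i]) : 0 <= Normc.normc x.
Proof. by case: x => a b; exact: sqrtr_ge0. Qed.

Lemma normc_half (x y : R[i]) (k : R) :
  Normc.normc (x / 2%:R) <= k * Normc.normc (y / 2%:R) -> Normc.normc x <= k * Normc.normc y.
Proof.
rewrite !Normc.normcM mulrA ler_pM2r// lt_neqAle normc_ge0 andbT eq_sym.
apply/eqP => /Normc.eq0_normc /eqP; rewrite invr_eq0 pnatr_eq0//.
Qed.

Lemma quasiconformal_grad2 A f : quasiconformal A f -> exists2 K : R, 1 <= K &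
  forall z, A z -> 
  let pi i z := (dir i f z).1 in let qi i z := (dir i f z).2 in
  0 <= jac pi qi z /\ grad2 pi qi z <= K * jac pi qi z.
Proof.
case=> k /andP[k0 k1] kf.
have k2 : 0 < 1 - k ^+ 2 by rewrite subr_gt0 expr_lt1.
exists (2 * (1 + k ^+ 2) / (1 - k ^+ 2)).
  by rewrite ler_pdivlMr// mul1r; have := sqr_ge0 k; clear; lra.
move=> z Az; rewrite /jac /grad2 /=; have := normc_half (kf z Az).
rewrite -ler_sqr ?nnegrE ?mulr_ge0 ?normc_ge0// exprMn !normcE.
move: (dx f z) (dy f z) => [a b] [c d] /=.
rewrite !(mul0r, mul1r, add0r, sub0r, subr0, addr0, opprK) => h.
have [G GE] : {x : R | x = a ^+ 2 + c ^+ 2 + (b ^+ 2 + d ^+ 2)} by eexists.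
have [J JE] : {x : R | x = a * d - c * b} by eexists.
have G0 : 0 <= G by rewrite GE !addr_ge0 ?sqr_ge0.
have h2 : G - 2 * J <= k ^+ 2 * (G + 2 * J).
  rewrite (_ : G - 2 * J = (a - d) ^+ 2 + (b + c) ^+ 2); last by rewrite GE JE; ring.
  rewrite (_ : G + 2 * J = (a + d) ^+ 2 + (b - c) ^+ 2); last by rewrite GE JE; ring.
  exact: h.
rewrite -JE -GE.
have h3 : (1 - k ^+ 2) * G <= 2 * (1 + k ^+ 2) * J by move: h2; clear; lra.
have J0 : 0 <= J.
  have : 0 <= 2 * (1 + k ^+ 2) * J by apply: le_trans h3; rewrite mulr_ge0// ltW.
  by rewrite pmulr_rge0// mulr_gt0// ltr_wpDr ?sqr_ge0.
by split=> //; rewrite mulrAC ler_pdivlMr// mulrC.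
Qed.

Lemma Ck2E A f : Ck 2 A f -> [/\ {in A, continuous f},
  (forall i z, A z -> derivable f z (dirv i)), (forall i, {in A, continuous (dir i f)}),
  (forall i j z, A z -> derivable (dir i f) z (dirv j)) &
  (forall i j, {in A, continuous (dir j (dir i f))})].
Proof.
move=> [cf df [cx dx1 cxx cxy] [cy dy1 cyx cyy]]; split; first exact: cf.
- by move=> i z Az; have [h1 h2] := df z Az; case: i; [exact: h1|exact: h2].
- by move=> i; case: i; [exact: cx|exact: cy].
- move=> i j z Az; have [h1 h2] := dx1 z Az; have [h3 h4] := dy1 z Az.
  by case: i; case: j; [exact: h1|exact: h2|exact: h3|exact: h4].
- by move=> i j; case: i; case: j; [exact: cxx|exact: cxy|exact: cyx|exact: cyy].
Qed.

Lemma continuous_pcoord_comp f z i : {for z, continuous f} ->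
  {for z, continuous (fun z => pcoord i (f z))}.
Proof. by move=> cf; apply: (continuous_comp cf); exact: pcoord_continuous. Qed.

Record smooth_qc A f pi pii pm qi qii qm (K M N : R) : Prop := SmoothQC {
  smooth_qcmap : qcmap A f pi pii qi qii K M N;
  smooth_jac : forall z, A z -> 0 <= jac pi qi z;
  smooth_mixed1 : forall i z, A z -> pd i (pi (~~ i)) z (pm z);
  smooth_mixed2 : forall i z, A z -> pd i (qi (~~ i)) z (qm z);
  smooth_contm1 : forall z, A z -> {for z, continuous pm};
  smooth_contm2 : forall z, A z -> {for z, continuous qm} }.

Lemma grad2_dir f z :
  grad2 (fun i z => (dir i f z).1) (fun i z => (dir i f z).2) z = sqr_grad f z.
Proof.
rewrite /grad2 /dir /sqr_grad; move: (dx f z) (dy f z) => a b.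
by rewrite !modulusE !sqr_en /nsq; ring.
Qed.

Lemma smooth_qc_exists A f : open A -> Ck 2 A f -> quasiconformal A f ->
  (exists M N : R, forall z, A z -> modulus (laplacian f z) <= M * sqr_grad f z + N) ->
  exists K M N, smooth_qc A f (fun i z => (dir i f z).1) (fun i z => (dir i (dir i f) z).1)
    (fun z => (dir true (dir false f) z).1) (fun i z => (dir i f z).2)
    (fun i z => (dir i (dir i f) z).2) (fun z => (dir true (dir false f) z).2) K M N.
Proof.
move=> oA /Ck2E[cf df cdf ddf cddf] /quasiconformal_grad2[K K1 qcf] [M [N lapf]].
have lapc i z : A z -> `|pcoord i (laplacian f z)| <= `|M| *
    grad2 (fun i z => (dir i f z).1) (fun i z => (dir i f z).2) z + `|N|.
  move=> Az; apply: le_trans (pcoord_le_modulus _ _) _.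
  apply: (le_trans (lapf z Az)); rewrite grad2_dir lerD ?ler_norm// ler_wpM2r ?ler_norm//.
  by rewrite -grad2_dir grad2_ge0.
have mixed i : forall z, A z -> pcoord i (dir false (dir true f) z) =
    pcoord i (dir true (dir false f) z).
  move=> z Az; have [e e0 zA] := open_sqrP oA Az.
  apply: (@mixed_partials_eq (fun z => pcoord i (f z)) (fun j z => pcoord i (dir j f z))
    (fun z => pcoord i (dir false (dir true f) z)) (fun z => pcoord i (dir true (dir false f) z))
    z e e0).
  - move=> j w /zA Aw; have [h1 h2] := pd_of_derivable (df j w Aw).
    by case: i.
  - move=> w /zA Aw; have [h1 h2] := pd_of_derivable (ddf true false w Aw).
    by case: i.
  - move=> w /zA Aw; have [h1 h2] := pd_of_derivable (ddf false true w Aw).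
    by case: i.
  - by apply: continuous_pcoord_comp; apply: cddf; rewrite inE.
  - by apply: continuous_pcoord_comp; apply: cddf; rewrite inE.
exists K, `|M|, `|N|; split; first split => //.
- move=> i z Az; have [h1 _] := pd_of_derivable (df i z Az).
  by have [h2 _] := pd_of_derivable (ddf i i z Az).
- move=> i z Az; have [_ h1] := pd_of_derivable (df i z Az).
  by have [_ h2] := pd_of_derivable (ddf i i z Az).
- by move=> z Az; exact: (@continuous_pcoord_comp f z true (cf z Az)).
- by move=> z Az; exact: (@continuous_pcoord_comp f z false (cf z Az)).
- by move=> i z Az; exact: (@continuous_pcoord_comp (dir i f) z true (cdf i z Az)).
- by move=> i z Az; exact: (@continuous_pcoord_comp (dir i f) z false (cdf i z Az)).
- by move=> z Az; have [J0 h] := qcf z Az; rewrite ger0_norm.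
- by move=> z Az; exact: (lapc true).
- by move=> z Az; exact: (lapc false).
- by move=> z Az; have [] := qcf z Az.
- move=> i z Az; case: i => /=.
    by have [] := pd_of_derivable (ddf false true z Az).
  have [h1 _] := pd_of_derivable (ddf true false z Az); exact: pd_eq h1 (mixed true z Az).
- move=> i z Az; case: i => /=.
    by have [] := pd_of_derivable (ddf false true z Az).
  have [_ h1] := pd_of_derivable (ddf true false z Az); exact: pd_eq h1 (mixed false z Az).
- move=> z Az; apply: (@continuous_pcoord_comp (dir true (dir false f)) z true).
  by apply: cddf; rewrite inE.
- move=> z Az; apply: (@continuous_pcoord_comp (dir true (dir false f)) z false).
  by apply: cddf; rewrite inE.
Qed.

End Bridge.

(** * Sides of the boundary and properness *)
Section Sides.
Variable R : realType.
Implicit Types (z w p q : R * R) (i j : bool) (A E G S Om : set (R * R)) (g m : R -> R).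

Definition side j g (b x1 r : R) : set (R * R) :=
  [set z | `|pcoord j z - x1| < r /\ 0 < b * height j g z < r].

Lemma connected_off_boundary Om E : open Om -> connected E ->
  (forall z, E z -> ~ boundary Om z) -> E `<=` Om \/ (forall z, E z -> ~ Om z).
Proof.
move=> oO cE Eb; have [[z0 [Ez0 Oz0]]|H] := pselect (exists z, E z /\ Om z); last first.
  by right => z Ez Oz; apply: H; exists z.
left; suff : E `&` Om = E by move=> <- z [].
apply: cE; first by exists z0.
- by exists Om.
- exists (closure Om); first exact: closed_closure.
  apply/seteqP; split=> z [Ez Oz]; split=> //; first exact: subset_closure.
  apply: contrapT => nO; apply: (Eb z Ez); split=> //.
  by rewrite (interior_id Om).1.
Qed.

Lemma notin_boundary Om z : open Om -> boundary Om z -> ~ Om z.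
Proof. by move=> /interior_id oO []; rewrite oO. Qed.

Section InChart.
Variables (S : set (R * R)) (a K L h : R) (j : bool) (p : R * R) (g m : R -> R).
Hypothesis ch : graph_chart S a K L h j p g m.

Lemma height_lip z w : `|pcoord j z - pcoord j p| < h -> `|pcoord j w - pcoord j p| < h ->
  `|height j g w - height j g z| <=
    `|pcoord (~~ j) w - pcoord (~~ j) z| + L * `|pcoord j w - pcoord j z|.
Proof.
move=> hz hw; rewrite /height.
rewrite (_ : _ - _ = (pcoord (~~ j) w - pcoord (~~ j) z) - (g (pcoord j w) - g (pcoord j z))).
  by apply: le_trans (ler_normB _ _) _; rewrite lerD2l; exact: (chart_lip ch).
by ring.
Qed.

Lemma height_center : height j g p = 0.
Proof. by rewrite /height (chart_center ch) subrr. Qed.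

Lemma on_graph z : `|pcoord j z - pcoord j p| < h -> `|height j g z| < h ->
  (S z <-> height j g z = 0).
Proof.
move=> zj zh; have h0 := chart_h ch; have L1 := chart_L ch.
have zo : `|pcoord (~~ j) z - pcoord (~~ j) p| < 2 * L * h.
  have -> : pcoord (~~ j) z - pcoord (~~ j) p = height j g z + (g (pcoord j z) - g (pcoord j p)).
    by rewrite /height (chart_center ch); ring.
  apply: le_lt_trans (ler_normD _ _) _.
  have hp : `|pcoord j p - pcoord j p| < h by rewrite subrr normr0.
  have h1 := chart_lip ch hp zj.
  have h2 : L * `|pcoord j z - pcoord j p| <= L * h.
    by rewrite ler_wpM2l ?ltW// (lt_le_trans _ L1).
  have h3 : h <= L * h by rewrite ler_peMl// ltW.
  by rewrite -mulrA mulr2n mulrDl mul1r; apply: ltr_leD; [exact: lt_le_trans zh h3|exact: le_trans h2].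
rewrite (chart_mem ch zj zo) /height; split=> [->|/eqP]; first by rewrite subrr.
by rewrite subr_eq0 => /eqP.
Qed.

Variable b : R.
Hypothesis b1 : `|b| = 1.

Let bb : b * b = 1.
Proof. by rewrite -expr2 -real_normK ?num_real// b1 expr1n. Qed.

Lemma normb x : `|b * x| = `|x|. Proof. by rewrite normrM b1 mul1r. Qed.

Variables (x1 r : R).
Hypothesis xr : `|x1 - pcoord j p| + r <= h.

Lemma side_in z : side j g b x1 r z -> `|pcoord j z - pcoord j p| < h.
Proof.
move=> [zx _]; apply: lt_le_trans xr.
rewrite (_ : _ - _ = (pcoord j z - x1) + (x1 - pcoord j p)); last by ring.
by apply: le_lt_trans (ler_normD _ _) _; rewrite addrC ltrD2l.
Qed.

Lemma side_height z : side j g b x1 r z -> `|height j g z| < r.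
Proof. by move=> [_ /andP[h1 h2]]; rewrite -normb gtr0_norm. Qed.

Lemma side_off z : side j g b x1 r z -> ~ S z.
Proof.
move=> sz; have hz := side_in sz; have hh := side_height sz.
have rh : r <= h by apply: le_trans xr; rewrite lerDr.
move=> /(on_graph hz (lt_le_trans hh rh)) h0; case: sz => _.
by rewrite h0 mulr0 ltxx.
Qed.

Lemma side_dist z : 0 < r -> side j g b x1 r z -> `|pcoord (~~ j) z - g x1| < (1 + L) * r.
Proof.
move=> r0 sz; have hz := side_in sz; have hh := side_height sz.
have hx : `|x1 - pcoord j p| < h by apply: lt_le_trans xr; rewrite ltrDl.
rewrite (_ : _ - _ = height j g z + (g (pcoord j z) - g x1)); last by rewrite /height; ring.
apply: le_lt_trans (ler_normD _ _) _; rewrite mulrDl mul1r; apply: ltr_leD => //.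
apply: le_trans (chart_lip ch hx hz) _; rewrite ler_wpM2l// ?ltW//; last by case: sz.
exact: lt_le_trans (chart_L ch).
Qed.

Lemma side_open : open (side j g b x1 r).
Proof.
rewrite openE => z sz; have [zx /andP[z0 zr]] := sz.
have hz := side_in sz; have L0 : 0 < L := lt_le_trans ltr01 (chart_L ch).
have cH : {for z, continuous (fun z => b * height j g z)}.
  by apply: cvgM; [exact: cvg_cst|exact: (height_continuous ch)].
have cX : {for z, continuous (fun z => `|pcoord j z - x1|)}.
  by apply: cvg_norm; apply: cvgB; [exact: pcoord_continuous|exact: cvg_cst].
rewrite /interior; near=> w; split.
  by near: w; apply: (cvgr_lt _ cX).
by apply/andP; split; near: w; [exact: (cvgr_gt _ cH)|exact: (cvgr_lt _ cH)].
Unshelve. all: by end_near. Qed.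

Lemma side_connected : connected (side j g b x1 r).
Proof.
have -> : side j g b x1 r = (fun u : R * R => of_pcoords j u.1 (g u.1 + b * u.2)) @`
    (`]x1 - r, x1 + r[ `*` `]0, r[)%classic.
  apply/seteqP; split=> z.
    move=> [zx zh]; exists (pcoord j z, b * height j g z).
      by split; rewrite /= in_itv//= -ltr_distl.
    rewrite /= mulrA bb mul1r /height addrC subrK.
    by case: z {zx zh} => z1 z2; case: (j).
  move=> [[x s] [/= xI sI] <-]; have [e1 e2] := pcoord_of_pcoords j x (g x + b * s).
  move: xI sI; rewrite !in_itv/= -ltr_distl => xI sI.
  by split; rewrite ?/height ?e1 ?e2// addrC addKr mulrA bb mul1r.
apply: connected_continuous_connected.
  by apply: connected_setX; apply/connected_intervalP; exact: interval_is_interval.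
apply: continuous_in_subspaceT => -[x s]; rewrite inE => -[/= xI _].
have xh : `|x - pcoord j p| < h.
  apply: lt_le_trans xr; rewrite (_ : x - _ = (x - x1) + (x1 - pcoord j p)); last by ring.
  apply: le_lt_trans (ler_normD _ _) _; rewrite addrC ltrD2l.
  by move: xI; rewrite in_itv/= -ltr_distl.
have [e1 e2] := pcoord_of_pcoords j x (g x).
have cgx : {for x, continuous g}.
  have := @height_continuous _ _ _ _ _ _ _ _ _ _ ch (of_pcoords j x (g x)).
  rewrite e1 => /(_ xh) cH.
  have cO : {for x, continuous (fun t => of_pcoords j t (g x))}.
    have c1 : (fun t : R => t) @ x --> x by exact: cvg_id.
    have c2 : (fun t : R => g x) @ x --> g x by exact: cvg_cst.
    by rewrite /of_pcoords; case: (j); [exact: (cvg_pair c1 c2)|exact: (cvg_pair c2 c1)].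
  have cc := continuous_comp cO cH.
  have -> : g = (fun t => g x - (height j g \o (fun t => of_pcoords j t (g x))) t).
    apply/funext => t; rewrite /height /=.
    by have [-> ->] := pcoord_of_pcoords j t (g x); ring.
  by apply: cvgB; [exact: cvg_cst|exact: cc].
have cg : {for (x, s), continuous (fun u : R * R => g u.1 + b * u.2)}.
  apply: cvgD; last by apply: cvgM; [exact: cvg_cst|exact: cvg_snd].
  have c1 : {for (x, s), continuous (@fst R R)} by exact: cvg_fst.
  exact: (@continuous_comp _ _ _ (@fst R R) g (x, s) c1 cgx).
have c1 : {for (x, s), continuous (@fst R R)} by exact: cvg_fst.
by rewrite /of_pcoords; case: (j); [exact: (cvg_pair c1 cg)|exact: (cvg_pair cg c1)].
Qed.

Lemma side_dichotomy Om : open Om -> S = boundary Om ->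
  side j g b x1 r `<=` Om \/ (forall z, side j g b x1 r z -> ~ Om z).
Proof.
move=> oO SO; apply: connected_off_boundary => //; first exact: side_connected.
by move=> z sz; rewrite -SO; exact: side_off.
Qed.

End InChart.

Lemma near_chart_center S (a K L h : R) j p g m (r : R) z :
  graph_chart S a K L h j p g m -> 0 < r -> r <= h -> sqr_nbh p (r / (2 * L)) z -> ~ S z ->
  exists2 b : R, `|b| = 1 & side j g b (pcoord j p) r z.
Proof.
move=> ch r0 rh zp nS; have L1 := chart_L ch.
have L0 : 0 < L := lt_le_trans ltr01 L1.
have [zj zo] := (sqr_nbhP j p (r / (2 * L)) z).1 zp.
have e1 : r / (2 * L) = (r / 2) / L by field; rewrite gt_eqF.
have e2 : L * (r / (2 * L)) = r / 2 by field; rewrite gt_eqF.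
have e3 : r / (2 * L) <= r / 2 by rewrite e1 ler_pdivrMr// ler_peMr// divr_ge0// ltW.
have zjr : `|pcoord j z - pcoord j p| < r by move: zj e3 r0; clear; lra.
have zr : `|height j g z| < r.
  have hp : `|pcoord j p - pcoord j p| < h.
    by rewrite subrr normr0; exact: lt_le_trans rh.
  have := height_lip ch hp (lt_le_trans zjr rh).
  rewrite (height_center ch) subr0.
  have : L * `|pcoord j z - pcoord j p| < L * (r / (2 * L)) by rewrite ltr_pM2l.
  by rewrite e2; move: zo e3; clear; lra.
have h0 : height j g z != 0.
  apply: contra_notN nS => /eqP hz.
  by apply/(on_graph ch (lt_le_trans zjr rh) (lt_le_trans zr rh)).
exists (Num.sg (height j g z)); first by rewrite normr_sg h0.
by split=> //; rewrite -normrEsg normr_gt0 h0.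
Qed.

Lemma side_sub_sqr S (a K L h : R) j p g m (r b : R) z :
  graph_chart S a K L h j p g m -> `|b| = 1 -> 0 < r -> r <= h ->
  side j g b (pcoord j p) r z -> sqr_nbh p (2 * L * r) z.
Proof.
move=> ch b1 r0 rh sz; have L1 := chart_L ch; apply/(sqr_nbhP j).
have xr : `|pcoord j p - pcoord j p| + r <= h by rewrite subrr normr0 add0r.
have := side_dist ch b1 xr r0 sz; rewrite (chart_center ch) => zo.
have h1 : r <= L * r by rewrite ler_peMl// ltW.
have [zj _] := sz; split; first by move: zj h1 r0; rewrite -mulrA; clear; lra.
by move: zo h1; rewrite mulrDl -mulrA; clear; lra.
Qed.

End Sides.

Section Proper.
Variable R : realType.
Implicit Types (z w p q s : R * R).
Variables (Om G : set (R * R)) (f f' : R * R -> R * R).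
Hypotheses (oO : open Om) (oG : open G) (fG : forall z, Om z -> G (f z))
  (fK : forall z, Om z -> f' (f z) = z) (fS : forall w, G w -> exists2 z, Om z & f z = w)
  (cf' : {in G, continuous f'}).

Lemma leaves_compact (C : set (R * R)) p : compact C -> C `<=` G -> ~ Om p ->
  exists2 e : R, 0 < e & forall z, sqr_nbh p e z -> Om z -> ~ C (f z).
Proof.
move=> cC CG nO.
have c1 : compact (f' @` C).
  apply: continuous_compact => //; apply: continuous_in_subspaceT => w.
  by rewrite inE => Cw; apply: cf'; rewrite inE; exact: CG.
have cl : closed (f' @` C) by apply: compact_closed.
have np : (~` (f' @` C)) p.
  move=> [w Cw wp]; have [z Oz zw] := fS (CG w Cw); apply: nO.
  by rewrite -wp -zw fK.
have [e e0 eC] := open_sqrP (closed_openC cl) np; exists e => // z pz Oz Cz.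
by apply: (eC z pz); exists (f z) => //; exact: fK.
Qed.

Lemma compact_inner (B eps : R) : 0 < eps ->
  compact [set w | [/\ closure G w, nsq w <= B & forall s, boundary G s -> eps <= en (w - s)]].
Proof.
move=> eps0; apply: compact_closed_bounded; last first.
  exists (1 + `|B|) => w [_ wB _].
  have : en w <= 1 + `|B|.
    rewrite -ler_sqr ?nnegrE ?en_ge0 ?addr_ge0// sqr_en; apply: (le_trans wB).
    by have := ler_norm B; have := normr_ge0 B; rewrite sqrrD; have := sqr_ge0 `|B|; lra.
  by have := fst_le_en w; have := snd_le_en w; split; apply: le_trans; eauto.
have -> : [set w | [/\ closure G w, nsq w <= B & forall s, boundary G s -> eps <= en (w - s)]] =
  closure G `&` ((fun w => nsq (w - 0)) @^-1` [set x | x <= B]) `&`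
  \bigcap_(s in boundary G) ((fun w => nsq (w - s)) @^-1` [set x | eps ^+ 2 <= x]).
  apply/seteqP; split=> w.
    move=> [w1 w2 w3]; split; first by split=> //=; rewrite subr0.
    by move=> s Gs /=; rewrite -sqr_en ler_sqr ?nnegrE ?en_ge0 ?(ltW eps0)//; exact: w3.
  move=> [[w1 /= w2] w3]; split=> //; first by rewrite subr0 in w2.
  move=> s Gs; rewrite -ler_sqr ?nnegrE ?en_ge0 ?(ltW eps0)// sqr_en; exact: w3.
apply: closedI; first (apply: closedI; first exact: closed_closure).
- apply: preimage_closed => [w _|]; [exact: nsq_continuous|exact: closed_le].
- apply: closed_bigI => s _.
  apply: preimage_closed => [w _|]; [exact: nsq_continuous|exact: closed_ge].
Qed.

Lemma near_boundary p (B eps : R) : ~ Om p -> 0 < eps ->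
  exists2 e : R, 0 < e & forall z, sqr_nbh p e z -> Om z ->
    (exists2 s, boundary G s & en (f z - s) < eps) \/ B < nsq (f z).
Proof.
move=> nO eps0; have [|e e0 H] := leaves_compact (@compact_inner B eps eps0) _ nO.
  move=> w [cw _ ws]; apply: contrapT => nG.
  have : eps <= en (w - w) by apply: ws; split=> //; rewrite (interior_id G).1.
  rewrite subrr; have -> : en (0 : R * R) = 0 by rewrite /en /nsq /= !expr0n addr0 sqrtr0.
  by rewrite leNgt eps0.
exists e => // z pz Oz; have [|nB] := ltP B (nsq (f z)); first by right.
left; apply: contrapT => H1; apply: (H z pz Oz); split=> //.
  by apply: subset_closure; exact: fG.
by move=> s Gs; rewrite leNgt; apply/negP => H2; apply: H1; exists s.
Qed.

End Proper.

Section NoInfinity.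
Variable R : realType.
Implicit Types (z w p q s : R * R) (i j : bool) (S Om : set (R * R)) (g m : R -> R).

Definition straighten j (b : R) w : R * R := of_pcoords j w.1 (b * w.2).

Lemma pcoord_straighten j b w : pcoord j (straighten j b w) = w.1 /\
  pcoord (~~ j) (straighten j b w) = b * w.2.
Proof. exact: pcoord_of_pcoords. Qed.

Lemma straighten_continuous j b : continuous (straighten j b).
Proof.
move=> w; have c1 : {for w, continuous (@fst R R)} by exact: cvg_fst.
have c2 : {for w, continuous (fun w : R * R => b * w.2)}.
  by apply: cvgM; [exact: cvg_cst|exact: cvg_snd].
by rewrite /straighten/of_pcoords; case: (j); [exact: (cvg_pair c1 c2)|exact: (cvg_pair c2 c1)].
Qed.

Lemma pd_straighten i j b (u : R * R -> R) w (d : R) :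
  pd (if i then j else ~~ j) u (straighten j b w) d ->
  pd i (fun w => u (straighten j b w)) w ((if i then 1 else b) * d).
Proof.
have [e1 e2] := pcoord_straighten j b w.
case: i; rewrite /pd.
  rewrite e1 mul1r => h.
  have -> : (fun t => u (straighten j b (slide true w t))) =
    (fun t => u (slide j (straighten j b w) t)) by apply/funext => t; case: (j).
  exact: h.
rewrite e2 => h.
have -> : (fun t => u (straighten j b (slide false w t))) =
    (fun t => u (slide (~~ j) (straighten j b w) t)) \o (fun t => b * t).
  by apply/funext => t; case: (j).
have db : is_derive (pcoord false w) (1 : R) (fun t : R => b * t) b.
  have := @is_deriveM R R (cst b) id (pcoord false w) 1 0 1.
  have h1 : is_derive (pcoord false w) (1 : R) (cst b) 0 by exact: is_derive_cst.
  have h2 : is_derive (pcoord false w) (1 : R) id (1 : R) by exact: is_derive_id.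
  move=> /(_ h1 h2); rewrite /GRing.scale/= mulr1 mulr0 addr0//.
by have := is_derive1_comp h db; rewrite mulrC.
Qed.

Lemma no_infinity_at_graph Om f pi pii pm qi qii qm (Kf M N : R)
    S (a K L h : R) j p g m (b r : R) :
  smooth_qc Om f pi pii pm qi qii qm Kf M N ->
  graph_chart S a K L h j p g m -> `|b| = 1 -> 0 < r -> r <= h ->
  side j g b (pcoord j p) r `<=` Om ->
  (forall z, side j g b (pcoord j p) r z -> expR 1 <= nsq (f z)) ->
  (forall z, S z -> forall B : R, exists2 e : R, 0 < e & forall w, sqr_nbh z e w ->
     side j g b (pcoord j p) r w -> B <= nsq (f w)) -> False.
Proof.
move=> [qcf J0 mx1 mx2 cm1 cm2] ch b1 r0 rh sO large inf.
have bb : b * b = 1 by rewrite -expr2 -real_normK ?num_real// b1 expr1n.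
have L1 := chart_L ch; have L0 : 0 < L := lt_le_trans ltr01 L1.
have xr : `|pcoord j p - pcoord j p| + r <= h by rewrite subrr normr0 add0r.
pose T := straighten j b; pose D := side j g b (pcoord j p) r.
pose U := T @^-1` D; pose sg : R := (if j then 1 else -1) * b.
have sg2 : sg * sg = 1 by rewrite /sg mulrACA bb mulr1; case: (j); rewrite ?mulr1 ?mulrNN ?mulr1.
have sgb : sg * b = if j then 1 else -1 by rewrite /sg -mulrA bb mulr1.
clearbody sg.
have oD : open D by exact: (side_open ch).
have oU : open U by apply: open_comp oD => w _; exact: straighten_continuous.
pose s i := if i then j else ~~ j; pose k i : R := if i then 1 else b.
pose P w := (f (T w)).1; pose Q w := sg * (f (T w)).2.
pose Pi i w := k i * pi (s i) (T w); pose Qi i w := sg * (k i * qi (s i) (T w)).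
pose Pm w := b * pm (T w); pose Qm w := sg * (b * qm (T w)).
have dT i u w d : pd (s i) u (T w) d -> pd i (fun w => u (T w)) w (k i * d).
  exact: pd_straighten.
have scale i u w (c d : R) : pd i u w d -> pd i (fun w => c * u w) w (c * d).
  by move=> dh; apply: pd_eq (pdM (pd_cst i c w) dh) _; rewrite mul0r add0r.
have cT (u : R * R -> R) w : {for T w, continuous u} -> {for w, continuous (fun w => u (T w))}.
  by move=> cu; exact: (continuous_comp (@straighten_continuous j b w) cu).
have cS (u : R * R -> R) w (c : R) : {for w, continuous u} -> {for w, continuous (fun w => c * u w)}.
  by move=> cu; apply: cvgM => //; exact: cvg_cst.
have kk i : k i * k (~~ i) = b by rewrite /k; case: i; rewrite ?mul1r ?mulr1.
have ss i : ~~ s i = s (~~ i) by rewrite /s; case: i => //=; rewrite negbK.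
have Om_in w : U w -> T w \in Om by rewrite inE => /sO.
pose x0 := pcoord j p; pose y0 := b * pcoord (~~ j) p; pose W := r / (8 * L).
have W0 : 0 < W by rewrite divr_gt0// mulr_gt0.
have LW : L * W = r / 8 by rewrite /W; field; rewrite gt_eqF.
have Wr : W < r.
  have : W <= L * W by rewrite ler_peMl// ltW.
  by rewrite LW; move: r0; clear; lra.
have bg x : `|x - x0| <= W -> `|b * g x - y0| <= r / 8.
  move=> xW; rewrite /y0 -mulrBr (normb b1) -(chart_center ch) -LW.
  have h1 : `|pcoord j p - pcoord j p| < h by rewrite subrr normr0; exact: lt_le_trans rh.
  have h2 : `|x - pcoord j p| < h by apply: le_lt_trans xW _; exact: lt_le_trans rh.
  by apply: le_trans (chart_lip ch h1 h2) _; rewrite ler_wpM2l// ltW.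
have hT x y : b * height j g (T (x, y)) = y - b * g x.
  rewrite /height; have [-> ->] := pcoord_straighten j b (x, y).
  by rewrite mulrBr mulrA bb mul1r.
have UE x y : U (x, y) <-> `|x - x0| < r /\ 0 < y - b * g x < r.
  by rewrite /U /D /side /= hT; have [-> _] := pcoord_straighten j b (x, y).
clearbody W.
apply: (@no_infinite_cluster R U P Q Pi Qi Pm Qm Kf (x0 - W) (x0 - W / 2) (x0 + W / 2) (x0 + W)
  (y0 - r / 4) (y0 + r / 4) (y0 + r / 2)).
- exact: oU.
- move=> i w Uw; have [h1 _] := qc_jet1 qcf (s i) (sO _ Uw).
  exact: (dT i (fun z => (f z).1) w _ h1).
- move=> i w Uw; have [h1 _] := qc_jet2 qcf (s i) (sO _ Uw).
  exact: (scale i _ w sg _ (dT i (fun z => (f z).2) w _ h1)).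
- move=> i w Uw; have := mx1 (s i) _ (sO _ Uw); rewrite ss => h1.
  apply: (pd_eq (scale i _ w (k (~~ i)) _ (dT i _ _ _ h1))).
  by rewrite mulrA mulrC (mulrC (k (~~ i))) kk mulrC.
- move=> i w Uw; have := mx2 (s i) _ (sO _ Uw); rewrite ss => h1.
  apply: (pd_eq (scale i _ w sg _ (scale i _ w (k (~~ i)) _ (dT i _ _ _ h1)))).
  by rewrite /Qm; congr (sg * _); rewrite mulrA (mulrC (k (~~ i))) kk.
- by move=> w Uw; apply: (cT (fun z => (f z).1)); exact: (qc_cont1 qcf (Om_in _ Uw)).
- move=> w Uw; apply: (cS _ w); apply: (cT (fun z => (f z).2)).
  exact: (qc_cont2 qcf (Om_in _ Uw)).
- by move=> i w Uw; apply: (cS _ w); apply: (cT _ w); exact: (qc_conti1 qcf (Om_in _ Uw)).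
- by move=> i w Uw; apply: (cS _ w); apply: (cS _ w); apply: (cT _ w); exact: (qc_conti2 qcf (Om_in _ Uw)).
- by move=> w Uw; apply: (cS _ w); apply: (cT _ w); exact: cm1 (sO _ Uw).
- by move=> w Uw; apply: (cS _ w); apply: (cS _ w); apply: (cT _ w); exact: cm2 (sO _ Uw).
- exact: qc_K qcf.
- move=> w Uw; have := qc_qc qcf (sO _ Uw); rewrite ger0_norm ?J0//; last exact: sO.
  have -> : grad2 Pi Qi w = grad2 pi qi (T w).
    have sq (c x : R) : c * c = 1 -> (c * x) ^+ 2 = x ^+ 2 by move=> c2; rewrite exprMn expr2 c2 mul1r.
    rewrite /grad2 /Pi /Qi /k /s !mul1r !(sq sg)// !(sq b)//.
    by clear; case: (j) => /=; ring.
  suff -> : jac Pi Qi w = jac pi qi (T w) by [].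
  transitivity (sg * b * (pi (s true) (T w) * qi (s false) (T w) -
    pi (s false) (T w) * qi (s true) (T w))).
    by rewrite /jac /Pi /Qi /k; ring.
  by rewrite sgb /s /jac; clear; case: (j) => /=; ring.
- by move=> w Uw; have := large _ Uw; rewrite /P /Q exprMn (expr2 sg) sg2 mul1r.
- by move: W0; clear -W x0; lra.
- by move: W0; clear -W x0; lra.
- by move: W0; clear -W x0; lra.
- by move: r0; clear -r y0; lra.
- by move: r0; clear -r y0; lra.
- move=> x y /andP[x1 x2] /andP[y1 y2] nU B.
  have xW : `|x - x0| <= W by rewrite ler_distl x1 x2.
  have := bg x xW; rewrite ler_distl => /andP[h1 h2].
  have xin : `|x - x0| < r := le_lt_trans xW Wr.
  have yr : y - b * g x < r by move: h1 h2 y2 r0; clear -r y0 b g x y; lra.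
  have yle : y - b * g x <= 0.
    by rewrite leNgt; apply/negP => h3; apply: nU; apply/UE; rewrite h3 yr.
  have [e1 _] := pcoord_straighten j b (x, y).
  have zj : `|pcoord j (T (x, y)) - pcoord j p| < h by rewrite e1; exact: lt_le_trans rh.
  have Tsqr e w : sqr_nbh (x, y) e w -> sqr_nbh (T (x, y)) e (T w).
    move=> [w1 w2]; apply/(sqr_nbhP j); have [-> ->] := pcoord_straighten j b (x, y).
    have [-> ->] := pcoord_straighten j b w.
    by split=> //; rewrite -mulrBr (normb b1).
  move: yle; rewrite le_eqVlt => /orP[/eqP yE|ylt].
    have ST : S (T (x, y)).
      have h0 : height j g (T (x, y)) = 0.
        by rewrite -[LHS]mul1r -bb -mulrA hT yE mulr0.
      by apply/(on_graph ch zj) => //; rewrite h0 normr0; exact: lt_le_trans rh.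
    have [e e0 he] := inf _ ST B; exists e => // w /Tsqr wT Uw.
    rewrite /P /Q exprMn (expr2 sg) sg2 mul1r; exact: he wT Uw.
  have cH : {for T (x, y), continuous (fun z => b * height j g z)}.
    by apply: (cS _ _ b); exact: (height_continuous ch zj).
  have [|e e0 he] := (continuous_sqrP _ _).1 cH (- (y - b * g x)).
    by rewrite oppr_gt0.
  exists e => // w /Tsqr /he; rewrite (hT x y) => wT [_ /andP[w0 _]].
  move: wT; rewrite ltr_distl => /andP[_]; rewrite subrr => wT.
  by have := lt_trans wT w0; rewrite ltxx.
- move=> x /andP[x1 x2]; rewrite UE => -[_ /andP[h3 _]].
  have xW : `|x - x0| <= W by rewrite ler_distl x1 x2.
  have := bg x xW; rewrite ler_distl => /andP[h1 h2].
  by move: h1 h3 r0; clear -r y0 b g x; lra.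
- move=> x /andP[x1 x2]; apply/UE.
  have xW : `|x - x0| <= W.
    by rewrite ler_distl; move: x1 x2 W0; clear -x x0 W => *; apply/andP; split; lra.
  have := bg x xW; rewrite ler_distl => /andP[h1 h2].
  split; first exact: le_lt_trans xW Wr.
  by move: h1 h2 r0; clear -r y0 b g x => *; apply/andP; split; lra.
Qed.

End NoInfinity.

(** * Gradient bound at the boundary *)
Section BoundaryGradient.
Variable R : realType.
Implicit Types (z w p q s : R * R) (i j : bool) (A : set (R * R)) (g m : R -> R).

Lemma side_mono j g (b x1 r x2 r' : R) z : `|x1 - x2| + r <= r' -> side j g b x1 r z ->
  side j g b x2 r' z.
Proof.
move=> rr [zx /andP[z0 zr]]; split.
  rewrite (_ : _ - _ = (pcoord j z - x1) + (x1 - x2)); last by ring.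
  apply: le_lt_trans (ler_normD _ _) _; apply: lt_le_trans rr.
  by rewrite addrC ltrD2l.
rewrite z0 /=; apply: (lt_le_trans zr); apply: le_trans rr.
by rewrite lerDr.
Qed.

Lemma side_closure S (a K L h : R) j p g m (b x1 r : R) z : graph_chart S a K L h j p g m ->
  `|b| = 1 -> `|x1 - pcoord j p| + r < h -> closure (side j g b x1 r) z ->
  [/\ `|pcoord j z - x1| <= r, `|pcoord j z - pcoord j p| < h & 0 <= b * height j g z <= r].
Proof.
move=> ch b1 xr /closure_sqrP clz; have L1 := chart_L ch.
have zx : `|pcoord j z - x1| <= r.
  rewrite leNgt; apply/negP => lt; have [|w [wx _]] := clz (`|pcoord j z - x1| - r).
    by rewrite subr_gt0.
  move=> /(sqr_nbhP j)[wz _]; have := ler_distD (pcoord j w) (pcoord j z) x1.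
  by rewrite (distrC (pcoord j z) (pcoord j w)); move: wx wz; clear; lra.
have zh : `|pcoord j z - pcoord j p| < h.
  apply: le_lt_trans xr; rewrite (_ : _ - _ = (pcoord j z - x1) + (x1 - pcoord j p)); last by ring.
  by apply: le_trans (ler_normD _ _) _; rewrite addrC lerD2l.
have near d : 0 < d -> exists2 w, side j g b x1 r w & `|b * height j g w - b * height j g z| < d.
  move=> d0; have L2 : 0 < 1 + L by apply: ltr_wpDr; rewrite ?(le_trans ler01).
  have [|w sw /(sqr_nbhP j)[w1 w2]] := clz (d / (1 + L)); first exact: divr_gt0.
  exists w => //; rewrite -mulrBr (normb b1).
  have wh : `|pcoord j w - pcoord j p| < h by apply: (side_in _ sw); exact: ltW.
  apply: le_lt_trans (height_lip ch zh wh) _.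
  have -> : d = d / (1 + L) + L * (d / (1 + L)) by field; rewrite gt_eqF.
  by apply: ltr_leD => //; rewrite ler_wpM2l ?ltW// (lt_le_trans _ L1).
split=> //; apply/andP; split; rewrite leNgt; apply/negP => lt.
  have [|w [_ /andP[w0 _]]] := near (- (b * height j g z)); first by rewrite oppr_gt0.
  by rewrite ltr_distl => /andP[_]; rewrite subrr => /(lt_trans w0); rewrite ltxx.
have [|w [_ /andP[_ wr]]] := near (b * height j g z - r); first by rewrite subr_gt0.
rewrite ltr_distl => /andP[+ _]; rewrite opprB addrC subrK => /lt_trans /(_ wr).
by rewrite ltxx.
Qed.

Variables (Om S : set (R * R)) (f : R * R -> R * R) (pi pii : bool -> R * R -> R)
  (pm : R * R -> R) (qi qii : bool -> R * R -> R) (qm : R * R -> R) (Kf M N : R).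
Hypothesis sq : smooth_qc Om f pi pii pm qi qii qm Kf M N.
Hypothesis oO : open Om.
Hypothesis nearS : forall p, boundary Om p -> forall B eps : R, 0 < eps ->
  exists2 e : R, 0 < e & forall z, sqr_nbh p e z -> Om z ->
    (exists2 s, S s & en (f z - s) < eps) \/ B < nsq (f z).
Hypothesis avoidS : forall z, Om z -> ~ S (f z).
Variable BS : R.
Hypothesis BS0 : 0 <= BS.
Hypothesis boundS : forall s, S s -> en s <= BS.

Let near_bounded z (eps : R) : (exists2 s, S s & en (f z - s) < eps) -> en (f z) <= BS + eps.
Proof.
case=> s Ss fs; have := en_tri (f z) s 0; rewrite !subr0 => h1.
by apply: (le_trans h1); rewrite addrC lerD ?boundS ?ltW.
Qed.

Section AtChart.
Variables (a K L h : R) (j : bool) (p : R * R) (g m : R -> R).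
Hypothesis ch : graph_chart (boundary Om) a K L h j p g m.
Hypothesis a01 : 0 < a <= 1.
Variable b : R.
Hypothesis b1 : `|b| = 1.

Lemma side_near_target (r0 eps : R) : 0 < r0 -> r0 <= h -> 0 < eps ->
  side j g b (pcoord j p) r0 `<=` Om -> exists r1 : R, [/\ 0 < r1, r1 <= r0 &
    forall z, side j g b (pcoord j p) r1 z -> exists2 s, S s & en (f z - s) < eps].
Proof.
move=> r00 r0h eps0 sO; have L0 : 0 < L := lt_le_trans ltr01 (chart_L ch).
have [B BE] : {x : R | x = expR 1 + (BS + 1) ^+ 2} by eexists.
have [d [d0 de d1]] : exists d : R, [/\ 0 < d, d <= eps & d <= 1].
  by exists (Num.min eps 1); rewrite lt_min eps0 ltr01 !ge_min !lexx ?orbT.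
have hp : `|pcoord j p - pcoord j p| < h by rewrite subrr normr0; exact: lt_le_trans r0h.
have Gp : boundary Om p.
  by apply/(on_graph ch hp); rewrite (height_center ch)// normr0; exact: lt_le_trans r0h.
have [e e0 he] := nearS Gp B d0.
have [r1 [r10 r1r r1e]] : exists r1, [/\ 0 < r1, r1 <= r0 & r1 <= e / (2 * L)].
  exists (Num.min r0 (e / (2 * L))); rewrite lt_min r00 divr_gt0 ?mulr_gt0//.
  by rewrite !ge_min !lexx ?orbT.
have r1h := le_trans r1r r0h.
have s1O z : side j g b (pcoord j p) r1 z -> Om z.
  by move=> sz; apply: sO; apply: side_mono sz; rewrite subrr normr0 add0r.
have alt z : side j g b (pcoord j p) r1 z ->
    (exists2 s, S s & en (f z - s) < d) \/ B < nsq (f z).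
  move=> sz; apply: he; last exact: s1O.
  apply: sub_sqr_nbh (side_sub_sqr ch b1 r10 r1h sz).
  by rewrite mulrC -ler_pdivlMr// mulr_gt0.
have nearB z : (exists2 s, S s & en (f z - s) < d) -> nsq (f z) < B.
  move=> /near_bounded h1; rewrite -sqr_en BE.
  have h2 : en (f z) ^+ 2 <= (BS + 1) ^+ 2.
    by rewrite ler_sqr ?nnegrE ?en_ge0 ?addr_ge0// (le_trans h1)// lerD2l.
  by apply: (le_lt_trans h2); rewrite ltrDr expR_gt0.
exists r1; split => // z1 sz1; have [[s Ss fs]|z1B] := alt z1 sz1.
  by exists s => //; exact: lt_le_trans de.
exfalso.
have xr : `|pcoord j p - pcoord j p| + r1 <= h by rewrite subrr normr0 add0r.
have big z : side j g b (pcoord j p) r1 z -> B < nsq (f z).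
  move=> sz; rewrite -subr_gt0.
  apply: (@connected_nonzero_sign _ _ (fun z => nsq (f z) - B) z1 z (side_connected ch b1 xr) _ _ sz1 sz).
  - apply: continuous_in_subspaceT => w; rewrite inE => /s1O Ow.
    have wO : w \in Om by rewrite inE.
    have c1 := qc_cont1 (smooth_qcmap sq) wO; have c2 := qc_cont2 (smooth_qcmap sq) wO.
    by apply: cvgB; [exact: (cvgD (cvgM c1 c1) (cvgM c2 c2))|exact: cvg_cst].
  - move=> w /alt[/nearB h1|h1]; first by rewrite subr_eq0 lt_eqF.
    by rewrite subr_eq0 gt_eqF.
  - by rewrite subr_gt0.
apply: (no_infinity_at_graph sq ch b1 r10 r1h (fun z => @s1O z)).
  move=> z /big /ltW; apply: le_trans; rewrite BE lerDl sqr_ge0//.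
move=> z Gz B'; have [e' e'0 he'] := nearS Gz B' d0; exists e' => // w wz sw.
have [/nearB h1|/ltW//] := he' w wz (s1O w sw).
by have := lt_trans h1 (big w sw); rewrite ltxx.
Qed.

Variables (rg eg Cg : R).
Hypotheses (geo : ball_geometry S rg eg Cg) (rg0 : 0 < rg) (eg0 : 0 < eg) (Cg0 : 0 <= Cg).

Ltac keep_section :=
  clear -geo rg0 eg0 Cg0 a01 b1 ch sq oO nearS avoidS BS0 boundS.

Lemma side_distance (r0 : R) : 0 < r0 -> r0 <= h -> side j g b (pcoord j p) r0 `<=` Om ->
  exists r1 Cd : R, [/\ 0 < r1, r1 <= r0, 0 <= Cd &
    forall z, side j g b (pcoord j p) r1 z ->
      exists2 s, S s & en (f z - s) <= Cd * (b * height j g z)].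
Proof.
move=> r00 r0h sO; have L1 := chart_L ch; have K1 := chart_K ch.
have L0 : 0 < L := lt_le_trans ltr01 L1.
have bb : b * b = 1 by rewrite -expr2 -real_normK ?num_real// b1 expr1n.
have [a0 a1] := andP a01.
have [d [d0 d1 d2]] : exists d : R, [/\ 0 < d, d <= rg / 2 & d <= eg].
  by exists (Num.min (rg / 2) eg); rewrite lt_min divr_gt0// eg0 !ge_min !lexx ?orbT.
have [rA [rA0 rA1 nA]] := side_near_target r00 r0h d0 sO.
have rAh := le_trans rA1 r0h.
have L11 : 1 <= 1 + L by rewrite lerDl ltW.
have [rb rb0 bar] := exp_barrier_estimate a01 K1 L11.
have L2 : 0 < 2 + L by apply: ltr_wpDr => //; exact: ltW.
have [t [t0 tA t1 tb]] : exists t, [/\ 0 < t, t <= rA / 3, (2 + L) * t <= 1 & (2 + L) * t <= rb].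
  exists (Num.min (rA / 3) (Num.min 1 rb / (2 + L))).
  rewrite lt_min !divr_gt0 ?lt_min ?ltr01//=; split=> //.
  - by rewrite ge_min lexx.
  - by rewrite mulrC -ler_pdivlMr// ge_min ler_pM2r ?invr_gt0// !ge_min lexx ?orbT.
  - by rewrite mulrC -ler_pdivlMr// ge_min ler_pM2r ?invr_gt0// !ge_min lexx ?orbT.
have [rho rhoE] : {x : R | x = 2 * (BS + d) + rg} by eexists.
have rho0 : 0 <= rho by rewrite rhoE addr_ge0 ?mulr_ge0 ?addr_ge0// ltW.
have M0 := qc_M (smooth_qcmap sq); have N0 := qc_N (smooth_qcmap sq).
have [c0 c0E] : {x : R | x = Kf ^+ 2 * (2 + 4 * rho * M)} by eexists.
have c00 : 0 <= c0 by rewrite c0E mulr_ge0 ?sqr_ge0// addr_ge0// !mulr_ge0.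
have [e eE] : {x : R | x = c0 / rg ^+ 2 + 1} by eexists.
have e0 : 0 < e by rewrite eE ltr_wpDl// divr_ge0// sqr_ge0.
have ce : Kf ^+ 2 * (2 + 4 * rho * M) <= e * (4 * (rg / 2) ^+ 2).
  have rgn : rg != 0 by rewrite gt_eqF.
  rewrite -c0E (_ : e * _ = c0 + rg ^+ 2); first by rewrite lerDl sqr_ge0.
  by rewrite eE; field.
have [r2 r2E] : {x : R | x = (t / (1 + L)) ^+ 2} by eexists.
have L10 : 0 < 1 + L := lt_le_trans ltr01 L11.
have r20 : 0 < r2 by rewrite r2E exprn_gt0// divr_gt0.
have [C C0 H] := bar Kf M N rg rho e r2 rg0 rho0 e0 ce r20 N0.
have [E [E0 EE]] : {x : R | 0 < x /\ x = expR (- e * rg ^+ 2)}.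
  by exists (expR (- e * rg ^+ 2)); rewrite expR_gt0.
exists t, (C * (1 + 2 * K) / (E * e * rg)).
have t3 : 3 * t <= rA by rewrite mulrC -ler_pdivlMr.
split=> //.
- by move: t3 rA1 t0; keep_section; lra.
- by rewrite divr_ge0 ?mulr_ge0 ?addr_ge0 ?mulr_ge0//; [exact: ltW|exact: le_trans K1|
    exact: ltW|exact: ltW|exact: ltW].
move=> z1 sz1; have [x1 x1E] : {x : R | x = pcoord j z1} by eexists.
have [z1p _] := sz1; rewrite -x1E in z1p.
have x1h : `|x1 - pcoord j p| < h by move: z1p t3 rAh t0; keep_section; lra.
have x1t : `|x1 - pcoord j p| + t < h by move: z1p t3 rAh t0; keep_section; lra.
have AA z : side j g b x1 t z -> side j g b (pcoord j p) rA z.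
  by apply: side_mono; move: z1p t3 t0; keep_section; lra.
have AO z : side j g b x1 t z -> Om z.
  by move=> /AA sz; apply: sO; apply: side_mono sz; rewrite subrr normr0 add0r.
have Az1 : side j g b x1 t z1.
  by have [_ z1h] := sz1; split=> //; rewrite x1E subrr normr0.
have Oz1 := AO _ Az1.
have [s0 Ss0 fs0] := nA _ (AA _ Az1).
have [|delta [c [dl0 wc Sc [_ [s1 Ss1 fs1]] _]]] := geo (avoidS Oz1).
  by exists s0 => //; exact: lt_le_trans d2.
exists s1 => //; rewrite fs1.
pose q := of_pcoords j x1 (g x1); pose n := of_pcoords j (- (b * m x1)) b.
have [q1 q2] : pcoord j q = x1 /\ pcoord (~~ j) q = g x1 by exact: pcoord_of_pcoords.
have [n1 n2] : pcoord j n = - (b * m x1) /\ pcoord (~~ j) n = b by exact: pcoord_of_pcoords.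
have nsqz z : nsq (z - q) = (pcoord j z - x1) ^+ 2 + (pcoord (~~ j) z - g x1) ^+ 2.
  by rewrite (nsq_pcoord j) !pcoordB q1 q2.
have dotz z : dot n (z - q) = b * height j g z + b * (g (pcoord j z) - g x1 - m x1 * (pcoord j z - x1)).
  rewrite (dot_pcoord j) n1 n2 !pcoordB q1 q2 /height; ring.
have hq : height j g q = 0 by rewrite /height q1 q2 subrr.
have nsqn : nsq n = 1 + m x1 ^+ 2.
  by rewrite (nsq_pcoord j) n1 n2 sqrrN exprMn !(expr2 b) bb mul1r addrC.
have mL := chart_slope ch x1h.
have m2 : m x1 ^+ 2 <= L ^+ 2.
  by rewrite -(real_normK (num_real (m x1))) ler_sqr ?nnegrE ?(ltW L0).
clearbody q n.
have jA z : side j g b x1 t z -> `|pcoord j z - pcoord j p| < h.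
  by apply: (side_in _); exact: ltW.
have res : expR (- e * nsq (f z1 - c)) <= expR (- e * rg ^+ 2) +
    C * (dot n (z1 - q) + 2 * K * nsq (z1 - q) `^ ((1 + a) / 2)).
  apply: (H (side j g b x1 t) S f pi pii qi qii q n c) => //.
  - by apply: (side_open ch); exact: ltW.
  - exists (`|p.1| + `|p.2| + 2 * L * rA) => z /AA sz.
    have [h1 h2] := side_sub_sqr ch b1 rA0 rAh sz.
    have := ler_normD (z.1 - p.1) p.1; have := ler_normD (z.2 - p.2) p.2; rewrite !subrK.
    have := normr_ge0 p.1; have := normr_ge0 p.2; move: h1 h2; keep_section.
    by move=> *; split; lra.
  - exact: qcmapW AO (smooth_qcmap sq).
  - by rewrite nsqn lerDl sqr_ge0.
  - rewrite nsqn; move: m2 L0; keep_section; nra.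
  - move=> z Az; have zj := jA z Az; have [zx /andP[zh0 zht]] := Az.
    have zo := side_dist ch b1 (ltW x1t) t0 Az.
    split.
      apply/andP; split.
        rewrite lt_neqAle nsq_ge0 andbT eq_sym nsq_eq0 subr_eq0; apply/eqP => zq.
        by move: zh0; rewrite zq hq mulr0 ltxx.
      have h1 : en (z - q) <= (2 + L) * t.
        have := en_le_sum (z - q).
        have -> : `|(z - q).1| + `|(z - q).2| = `|pcoord j z - x1| + `|pcoord (~~ j) z - g x1|.
          have -> : pcoord j z - x1 = pcoord j (z - q) by rewrite pcoordB q1.
          have -> : pcoord (~~ j) z - g x1 = pcoord (~~ j) (z - q) by rewrite pcoordB q2.
          by case: (j) => //; rewrite addrC.
        by move: zx zo; keep_section; lra.
      have Lt0 : 0 <= (2 + L) * t by rewrite mulr_ge0// ltW.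
      have h2 : nsq (z - q) <= ((2 + L) * t) ^+ 2.
        by rewrite -sqr_en ler_sqr ?nnegrE ?en_ge0.
      apply: (le_trans h2); rewrite expr2; apply: le_trans tb.
      by rewrite ler_piMr.
    rewrite dotz; have hold := chart_holder ch x1h zj.
    have h1 : `|pcoord j z - x1| `^ (1 + a) <= nsq (z - q) `^ ((1 + a) / 2).
      have -> : `|pcoord j z - x1| `^ (1 + a) = (`|pcoord j z - x1| ^+ 2) `^ ((1 + a) / 2).
        by rewrite -powR_mulrn// -powRrM; congr (_ `^ _); field.
      have g0 : 0 <= (1 + a) / 2 by move: a0; keep_section; lra.
      apply: (ge0_ler_powR g0); rewrite ?nnegrE ?nsq_ge0 ?sqr_ge0//.
      by rewrite real_normK ?num_real// nsqz lerDl sqr_ge0.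
    have h2 : K * `|pcoord j z - x1| `^ (1 + a) <= K * nsq (z - q) `^ ((1 + a) / 2).
      by rewrite ler_wpM2l// (le_trans ler01).
    rewrite -(normb b1) in hold; have := ler_norml (b * (g (pcoord j z) - g x1 - m x1 * (pcoord j z - x1)))
      (K * `|pcoord j z - x1| `^ (1 + a)); rewrite hold => /esym/andP[h3 _].
    by move: h2 h3 zh0; keep_section; lra.
  - move=> z /AA Az; have [s Ss fs] := nA z Az; have rs := Sc s Ss.
    have h1 := en_tri s (f z) c; rewrite en_distC in fs.
    have h2 : rg / 2 <= en (f z - c) by move: rs fs h1 d1; keep_section; lra.
    have h3 := en_tri (f z) (f z1) c.
    have h4 : en (f z) <= BS + d by apply: near_bounded; exists s => //; rewrite en_distC.
    have h5 : en (f z1) <= BS + d by apply: near_bounded; exists s0.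
    have h6 := en_tri (f z) 0 (f z1); rewrite subr0 sub0r enN in h6.
    have h7 : en (f z - c) <= rho by rewrite rhoE; move: h3 h4 h5 h6 wc dl0; keep_section; lra.
    by rewrite -sqr_en !ler_sqr ?nnegrE ?en_ge0// ?divr_ge0 ?h2 ?h7// ltW.
  - move=> z cz nz; have [zx zh zht] := side_closure ch b1 x1t cz.
    have hqz : `|height j g z| <= `|pcoord (~~ j) z - g x1| + L * `|pcoord j z - x1|.
      have qh : `|pcoord j q - pcoord j p| < h by rewrite q1.
      by have := height_lip ch qh zh; rewrite hq subr0 q1 q2.
    have [zxt|zxt] := ltP `|pcoord j z - x1| t; last first.
      left; rewrite nsqz r2E; have h1 : t ^+ 2 <= (pcoord j z - x1) ^+ 2.
        by rewrite -(real_normK (num_real (pcoord j z - x1))) ler_sqr ?nnegrE ?(ltW t0).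
      apply: le_trans (_ : t ^+ 2 <= _); last by apply: (le_trans h1); rewrite lerDl sqr_ge0.
      rewrite ler_sqr ?nnegrE ?divr_ge0 ?(ltW t0) ?(ltW L10)//.
      by rewrite ler_pdivrMr// ler_peMr// ltW.
    have [zt|zt] := ltP (b * height j g z) t; last first.
      left; rewrite r2E -sqr_en ler_sqr ?nnegrE ?en_ge0 ?divr_ge0 ?(ltW t0) ?(ltW L10)//.
      rewrite ler_pdivrMr//; have h1 := le_trans zt (ler_norm _); rewrite (normb b1) in h1.
      have h2 := pcoord_en j (z - q); have h3 := pcoord_en (~~ j) (z - q).
      rewrite !pcoordB q1 q2 in h2 h3.
      have h4 : L * `|pcoord j z - x1| <= L * en (z - q) by rewrite ler_wpM2l// ltW.
      by move: h1 h3 h4 hqz; rewrite mulrDr mulr1 mulrC; keep_section; lra.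
    right=> eta eta0; have hz0 : height j g z = 0.
      have : b * height j g z = 0.
        apply/eqP; move: zht => /andP[h0 _]; rewrite eq_le h0 andbT leNgt.
        by apply/negP => h1; apply: nz; split=> //; rewrite h1.
      by move=> /(congr1 ( *%R b)); rewrite mulrA bb mul1r mulr0.
    have Gz : boundary Om z.
      by apply/(on_graph ch zh) => //; rewrite hz0 normr0; exact: lt_le_trans r0h.
    have [e' e'0 he'] := nearS Gz ((BS + d) ^+ 2) eta0; exists e' => // w wz Aw.
    have [//|] := he' w wz (AO _ Aw).
    have h1 : en (f w) <= BS + d by apply: near_bounded; exact: nA (AA _ Aw).
    by rewrite -sqr_en ltNge ler_sqr ?nnegrE ?en_ge0 ?addr_ge0 ?(ltW d0)// h1.
have [y yE] : {x : R | x = b * height j g z1} by eexists.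
have [_ /andP[y0 yt]] := sz1; rewrite -yE in y0 yt *.
have d1E : dot n (z1 - q) = y.
  by rewrite dotz -x1E -yE !subrr mulr0 subrr mulr0 addr0.
have nE : nsq (z1 - q) `^ ((1 + a) / 2) <= y.
  have -> : nsq (z1 - q) = y ^+ 2.
    rewrite nsqz -x1E subrr expr0n add0r yE /height -x1E exprMn (expr2 b) bb mul1r//.
  rewrite -powR_mulrn ?(ltW y0)// -powRrM (_ : 2%:R * _ = 1 + a); last by field.
  rewrite -[leRHS]powRr1 ?(ltW y0)//; apply: ger_powR; last by rewrite lerDl ltW.
  have tt : t <= (2 + L) * t by rewrite ler_peMl ?(ltW t0)// -addrA lerDl addr_ge0 ?(ltW L0).
  by rewrite y0 (le_trans (ltW yt)) ?(le_trans tt).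
have cE : nsq (f z1 - c) = (rg - delta) ^+ 2 by rewrite -sqr_en wc.
have dr : 0 <= rg - delta by rewrite -wc en_ge0.
have up : expR (- e * nsq (f z1 - c)) <= E + C * ((1 + 2 * K) * y).
  rewrite EE; apply: (le_trans res); rewrite lerD2l ler_pM2l// d1E.
  rewrite (_ : (1 + 2 * K) * y = y + 2 * K * y) ?lerD2l; last by ring.
  by rewrite ler_pM2l// mulr_gt0// (lt_le_trans ltr01).
have lo : E * (1 + e * (delta * rg)) <= expR (- e * nsq (f z1 - c)).
  have -> : - e * nsq (f z1 - c) = - e * rg ^+ 2 + e * (rg ^+ 2 - (rg - delta) ^+ 2).
    by rewrite cE; ring.
  rewrite expRD -EE ler_pM2l//; apply: le_trans (expR_ge1Dx _).
  rewrite lerD2l ler_pM2l// (_ : rg ^+ 2 - _ = delta * rg + delta * (rg - delta)); last by ring.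
  by rewrite lerDl mulr_ge0.
rewrite mulrAC ler_pdivlMr ?mulr_gt0//.
by move: up lo; keep_section; lra.
Qed.

Lemma side_gradient (r0 : R) : 0 < r0 -> r0 <= h -> side j g b (pcoord j p) r0 `<=` Om ->
  exists r1 B : R, [/\ 0 < r1, r1 <= r0 &
    forall z, side j g b (pcoord j p) r1 z -> grad2 pi qi z <= B].
Proof.
move=> r00 r0h sO; have L1 := chart_L ch; have L0 : 0 < L := lt_le_trans ltr01 L1.
have [rd [Cd [rd0 rdr Cd0 dist]]] := side_distance r00 r0h sO.
have rdh := le_trans rdr r0h.
have [k [k0 kE]] : {k : R | 0 < k /\ k = 4 * (1 + L)}.
  by exists (4 * (1 + L)); rewrite mulr_gt0// addr_gt0.
have Ck0 : 0 <= Cd * (3 / 2) * k by rewrite !mulr_ge0// ?divr_ge0// ltW.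
have [db db0 [B H]] := bernstein_estimate geo rg0 eg0 Cg0 (qc_K (smooth_qcmap sq))
  (qc_M (smooth_qcmap sq)) (qc_N (smooth_qcmap sq)) Ck0.
have [r1 [r10 r1d r1b]] : exists r1, [/\ 0 < r1, r1 <= rd / 2 & r1 <= db].
  by exists (Num.min (rd / 2) db); rewrite lt_min db0 divr_gt0// !ge_min !lexx orbT.
exists r1, B; split=> //; first by move: r1d rdr rd0; keep_section; lra.
move=> z0 sz0; have [y yE] : {x : R | x = b * height j g z0} by eexists.
have [z0x /andP[y0 yr]] := sz0; rewrite -yE in y0 yr.
have [d [d0 dk]] : {d : R | 0 < d /\ k * d = y}.
  by exists (y / k); rewrite divr_gt0//; split=> //; field; rewrite gt_eqF.
have k4 : 4 <= k by rewrite kE ler_peMr// lerDl ltW.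
have d4 : 4 * d <= y by rewrite -dk ler_wpM2r// ltW.
have inner z : sqr_nbh z0 (2 * d) z -> side j g b (pcoord j p) rd z /\
    b * height j g z <= 3 / 2 * (k * d).
  move=> /(sqr_nbhP j)[zj zo]; rewrite dk.
  have z0h : `|pcoord j z0 - pcoord j p| < h by move: z0x r1d rdh rd0; keep_section; lra.
  have zp : `|pcoord j z - pcoord j p| < rd.
    have := ler_distD (pcoord j z0) (pcoord j z) (pcoord j p).
    by move: zj z0x d4 yr r1d rd0; keep_section; lra.
  have h1 := height_lip ch z0h (lt_le_trans zp rdh).
  have h2 : L * `|pcoord j z - pcoord j z0| <= L * (2 * d) by rewrite ler_wpM2l ?ltW.
  have h3 : `|b * height j g z - y| <= y / 2.
    rewrite yE -mulrBr (normb b1); apply: (le_trans h1).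
    have : 2 * (1 + L) * d = y / 2 by rewrite -dk kE; field.
    by rewrite -yE; move: h2 zo; keep_section; lra.
  move: h3; rewrite ler_distl => /andP[h3 h4].
  split; last by move: h4; keep_section; lra.
  by split=> //; apply/andP; split; move: h3 h4 y0 yr r1d; keep_section; lra.
have sub z : side j g b (pcoord j p) rd z -> Om z.
  by move=> sz; apply: sO; apply: side_mono sz; rewrite subrr normr0 add0r.
have d_db : d <= db by move: d4 yr r1b d0; keep_section; lra.
have dd : d < 2 * d by rewrite ltr_pMl// ltr1n.
apply: (H f pi pii qi qii z0 d (2 * d) d0 d_db dd).
- by apply: qcmapW (smooth_qcmap sq) => z /inner[/sub].
- by move=> z /inner[/sub Oz _]; exact: avoidS.
- move=> z /inner[sz hz]; have [s Ss fs] := dist z sz; exists s => //.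
  apply: (le_trans fs); rewrite -!mulrA ler_wpM2l// mulrA.
  by [].
Qed.

End AtChart.

Lemma boundary_gradient (a : R) p : 0 < a <= 1 -> Cla_curve 1 a (boundary Om) ->
  (exists r eps C : R, [/\ 0 < r, 0 < eps, 0 <= C & ball_geometry S r eps C]) ->
  boundary Om p -> exists e B : R, 0 < e /\
    forall z, sqr_nbh p e z -> Om z -> grad2 pi qi z <= B.
Proof.
move=> a01 cO [rg [eg [Cg [rg0 eg0 Cg0 geo]]]] Gp; have [a0 a1] := andP a01.
have [K [L [h [j [g [m ch]]]]]] := graph_chart_exists a0 a1 cO Gp.
have h0 := chart_h ch; have L0 : 0 < L := lt_le_trans ltr01 (chart_L ch).
have one (b : R) : `|b| = 1 -> exists r B : R, [/\ 0 < r, r <= h &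
    forall z, side j g b (pcoord j p) r z -> Om z -> grad2 pi qi z <= B].
  move=> b1; have xr : `|pcoord j p - pcoord j p| + h <= h by rewrite subrr normr0 add0r.
  have [sO|sO] := side_dichotomy ch b1 xr oO (erefl _).
    have [r [B [r0 rh H]]] := side_gradient ch a01 b1 geo rg0 eg0 Cg0 h0 (lexx h) sO.
    by exists r, B; split=> // z sz _; exact: H.
  by exists h, 0; split=> // z /sO.
have [r1 [B1 [r10 r1h H1]]] := one 1 (normr1 _).
have [r2 [B2 [r20 r2h H2]]] := one (-1) (etrans (normrN _) (normr1 _)).
have [r [r0 rr1 rr2]] : exists r, [/\ 0 < r, r <= r1 & r <= r2].
  by exists (Num.min r1 r2); rewrite lt_min r10 r20 !ge_min !lexx orbT.
exists (r / (2 * L)), (Num.max B1 B2); split; first by rewrite divr_gt0// mulr_gt0.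
move=> z zp Oz; have nG : ~ boundary Om z by move=> /(notin_boundary oO).
have [b b1 sz] := near_chart_center ch r0 (le_trans rr1 r1h) zp nG.
rewrite le_max; have : b = 1 \/ b = -1.
  have : b ^+ 2 = 1 by rewrite -real_normK ?num_real// b1 expr1n.
  by move=> /eqP; rewrite sqrf_eq1 => /orP[] /eqP ->; [left|right].
case=> bE; rewrite bE in sz.
  by rewrite H1//; apply: side_mono sz; rewrite subrr normr0 add0r.
by rewrite (H2 z) ?orbT//; apply: side_mono sz; rewrite subrr normr0 add0r.
Qed.

End BoundaryGradient.

(** * One-sidedness of the boundary *)
Section OneSided.
Variable R : realType.
Implicit Types (x y z w p q : R * R) (i j : bool) (A E Gam Om : set (R * R)) (g m : R -> R).

Definition linked Gam (rho : R) y z : Prop := exists E, [/\ connected E, E y, E z &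
  forall w, E w -> ~ Gam w /\ sqr_nbh y rho w].

Lemma linked_local Gam (a r0 : R) : 0 < a <= 1 -> compact Gam -> Cla_curve 1 a Gam -> 0 < r0 ->
  exists rho d : R, [/\ 0 < rho, rho <= r0, 0 < d &
    forall x, exists s : R * R -> bool, forall y z, sqr_nbh x d y -> sqr_nbh x d z ->
      ~ Gam y -> ~ Gam z -> (linked Gam rho y z <-> s y = s z)].
Proof.
move=> /andP[a0 a1] cG curveG r00.
have [t [t1 tP]] : exists t : R, 1 <= t /\ forall q, Gam q ->
    exists p K L h j g m, [/\ graph_chart Gam a K L h j p g m, L <= t, t^-1 <= h &
      sqr_nbh p (h / 8) q].
  apply: uniform_on_compact => // p Gp.
  have [K [L [h [j [g [m ch]]]]]] := graph_chart_exists a0 a1 curveG Gp.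
  have h0 := chart_h ch.
  exists (Num.max L h^-1), (h / 8); split; first by rewrite divr_gt0.
  move=> t q; rewrite ge_max => /andP[Lt ht] qp Gq.
  exists p, K, L, h, j, g, m; split=> //.
  have t0 : 0 < t by apply: lt_le_trans ht; rewrite invr_gt0.
  by rewrite -[h]invrK lef_pV2 ?posrE ?invr_gt0.
have t0 : 0 < t := lt_le_trans ltr01 t1.
have [rho [rho0 rhor rhot]] : exists rho, [/\ 0 < rho, rho <= r0 & rho <= t^-1 / 8].
  by exists (Num.min r0 (t^-1 / 8)); rewrite lt_min r00 divr_gt0 ?invr_gt0// !ge_min !lexx orbT.
have t10 : 0 < 1 + t by rewrite addr_gt0.
have [d [d0 dE]] : {d : R | 0 < d /\ 32 * ((1 + t) * ((1 + t) * d)) = rho}.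
  exists (rho / (32 * ((1 + t) * (1 + t)))); split; first by rewrite divr_gt0// !mulr_gt0.
  by field; rewrite gt_eqF.
have [r [r0' rE]] : {r : R | 0 < r /\ r = 4 * ((1 + t) * d)}.
  by exists (4 * ((1 + t) * d)); rewrite !mulr_gt0.
have dr : 4 * d <= r by rewrite rE ler_pM2l// ler_peMl ?(ltW d0)// lerDl ltW.
have rr : 4 * r <= rho.
  have : (1 + t) * d <= (1 + t) * ((1 + t) * d).
    by rewrite ler_peMl ?mulr_ge0 ?(ltW t10) ?(ltW d0)// lerDl ltW.
  have : 0 < (1 + t) * d by rewrite mulr_gt0.
  by rewrite rE -dE; clear; lra.
have rr2 : (2 + t) * r <= rho.
  have : (2 + t) * r <= (2 * (1 + t)) * r by rewrite ler_pM2r//; move: t0; clear; lra.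
  have : 0 < (1 + t) * ((1 + t) * d) by rewrite !mulr_gt0.
  rewrite -dE rE; clear; lra.
exists rho, d; split=> // x.
have [[q [Gq qx]]|far] := pselect (exists q, Gam q /\ sqr_nbh x d q); last first.
  exists (fun=> true) => y z xy xz _ _; split=> // _.
  exists (sqr_nbh x d); split=> //; first exact: sqr_nbh_connected.
  move=> w xw; split; first by move=> Gw; apply: far; exists w.
  move: xy xw => [y1 y2] [w1 w2]; split.
    by have := ler_distD x.1 w.1 y.1; rewrite (distrC x.1); move: y1 w1 dr rr d0; clear; lra.
  by have := ler_distD x.2 w.2 y.2; rewrite (distrC x.2); move: y2 w2 dr rr d0; clear; lra.
have [p [K [L [h [j [g [m [ch Lt th qp]]]]]]]] := tP q Gq.
have h0 := chart_h ch; have L1 := chart_L ch; have L0 : 0 < L := lt_le_trans ltr01 L1.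
have rh : 8 * rho <= h by move: rhot th; clear; lra.
have hL : h <= 2 * L * h by rewrite ler_peMl ?(ltW h0)//; move: L1; clear; lra.
have near i w : sqr_nbh x d w -> `|pcoord i w - pcoord i q| < 2 * d.
  move=> /(sqr_nbhP i)[xw _]; have [xq _] := (sqr_nbhP i _ _ _).1 qx.
  have := ler_distD (pcoord i x) (pcoord i w) (pcoord i q).
  by rewrite (distrC (pcoord i x)); move: xw xq; clear; lra.
have nearp i w : sqr_nbh x d w -> `|pcoord i w - pcoord i p| < h / 8 + 2 * d.
  move=> /(near i) xw; have [xq _] := (sqr_nbhP i _ _ _).1 qp.
  have := ler_distD (pcoord i q) (pcoord i w) (pcoord i p).
  by move: xw xq; clear; lra.
have graph w : `|pcoord j w - pcoord j p| < h -> `|pcoord (~~ j) w - pcoord (~~ j) p| < h ->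
    ~ Gam w -> height j g w != 0.
  move=> w1 w2 nG; apply: contra_notN nG; rewrite subr_eq0 => /eqP e1.
  by apply/(chart_mem ch w1 (lt_le_trans w2 hL)).
have small : h / 8 + 2 * d < h by move: d0 dr rr rh rho0 h0; clear; lra.
have inh i w : sqr_nbh x d w -> `|pcoord i w - pcoord i p| < h.
  by move=> xw; exact: lt_trans (nearp i w xw) small.
have hgt w : sqr_nbh x d w -> `|height j g w| < r.
  move=> xw; have qh : `|pcoord j q - pcoord j p| < h.
    by have [xq _] := (sqr_nbhP j _ _ _).1 qp; move: xq h0; clear; lra.
  have qo : `|pcoord (~~ j) q - pcoord (~~ j) p| < 2 * L * h.
    by have [_ xq] := (sqr_nbhP j _ _ _).1 qp; move: xq h0 hL; clear; lra.
  have hq : height j g q = 0 by rewrite /height ((chart_mem ch qh qo).1 Gq) subrr.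
  have := height_lip ch qh (inh j w xw); rewrite hq subr0 => h1.
  have h2 : L * `|pcoord j w - pcoord j q| <= L * (2 * d).
    by rewrite ler_wpM2l ?(ltW L0)// ltW// near.
  have h3 : L * d <= t * d by rewrite ler_pM2r.
  have h4 : 0 < t * d by rewrite mulr_gt0.
  by have := near (~~ j) w xw; move: h1 h2 h3 h4 d0; rewrite rE; clear; lra.
exists (fun w => 0 < height j g w) => y z xy xz ny nz.
have hy0 := graph y (inh j y xy) (inh (~~ j) y xy) ny.
have hz0 := graph z (inh j z xz) (inh (~~ j) z xz) nz.
split.
  move=> [E [cE Ey Ez Ein]].
  have Eh i w : E w -> `|pcoord i w - pcoord i p| < h.
    move=> /Ein[_ /(sqr_nbhP i)[yw _]]; have := nearp i y xy.
    have := ler_distD (pcoord i y) (pcoord i w) (pcoord i p).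
    by move: yw rh d0 dr rr rho0; clear; lra.
  have sgn (b : R) : b ^+ 2 = 1 -> 0 < b * height j g y -> 0 < b * height j g z.
    move=> b2; apply: (@connected_nonzero_sign _ E (fun w => b * height j g w)) => //.
      apply: continuous_in_subspaceT => w /[!inE] Ew.
      by apply: cvgM; [exact: cvg_cst|exact: (height_continuous ch (Eh j w Ew))].
    move=> w Ew; rewrite mulf_neq0//; first by rewrite -sqrf_eq0 b2 oner_eq0.
    by apply: graph; [exact: Eh|exact: Eh|case: (Ein w Ew)].
  have := sgn 1 (expr1n _ _); rewrite !mul1r => s1.
  have := sgn (-1); rewrite sqrrN expr1n !mulN1r !oppr_gt0 => /(_ erefl) s2.
  have [hy|hy|hy] := ltrgt0P (height j g y); first by rewrite s1.
    by apply/esym/negbTE; rewrite -leNgt ltW// s2.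
  by rewrite hy eqxx in hy0.
move=> syz; pose b := Num.sg (height j g y).
have b1 : `|b| = 1 by rewrite normr_sg hy0.
have by0 : 0 < b * height j g y by rewrite -normrEsg normr_gt0.
have bz0 : 0 < b * height j g z.
  move: syz; rewrite /b; have [hy|hy|hy] := ltrgt0P (height j g y).
  - by rewrite gtr0_sg// !mul1r => <-.
  - rewrite ltr0_sg// !mulN1r !oppr_gt0 => hz.
    by rewrite lt_neqAle hz0 leNgt -hz.
  - by rewrite hy eqxx in hy0.
have xr : `|pcoord j y - pcoord j p| + r <= h.
  by have := nearp j y xy; move: rr rh dr rho0 h0; clear; lra.
have bh (w : R * R) : 0 < b * height j g w -> sqr_nbh x d w -> b * height j g w < r.
  by move=> w0 /hgt; rewrite -(normb b1) gtr0_norm.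
clearbody b.
exists (side j g b (pcoord j y) r); split.
- exact: (side_connected ch b1 xr).
- by split; rewrite ?subrr ?normr0// by0 bh.
- split; last by rewrite bz0 bh.
  have := near j y xy; have := near j z xz; have := ler_distD (pcoord j q) (pcoord j z) (pcoord j y).
  by rewrite (distrC (pcoord j q)); move: dr; clear; lra.
- move=> w sw; split; first exact: (side_off ch b1 xr sw).
  have wo := side_dist ch b1 xr r0' sw; have [wj _] := sw.
  apply/(sqr_nbhP j); split; first by move: wj rr r0'; clear; lra.
  have hy := hgt y xy; rewrite /height in hy.
  have := ler_distD (g (pcoord j y)) (pcoord (~~ j) w) (pcoord (~~ j) y).
  rewrite (distrC (g _)).
  have : (2 + L) * r <= (2 + t) * r by rewrite ler_pM2r// lerD2l.
  by move: wo hy rr2; clear; lra.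
Qed.

Lemma connected_locally_constant Om (k : R * R -> bool) : open Om -> connected Om ->
  (forall z, Om z -> exists2 e : R, 0 < e & forall w, sqr_nbh z e w -> Om w -> k w = k z) ->
  forall y z, Om y -> Om z -> k y = k z.
Proof.
move=> oO cO lc y z Oy Oz.
have open_val (v : bool) : open (Om `&` [set w | k w = v]).
  rewrite openE => w [Ow /= kw]; have [e e0 H] := lc w Ow.
  have [e' e'0 wO] := open_sqrP oO Ow; apply/nbhs_sqrP.
  exists (Num.min e e'); first by rewrite lt_min e0.
  move=> u uw; have Ou : Om u by apply: wO; apply: sub_sqr_nbh uw; rewrite ge_min lexx orbT.
  split=> //=; rewrite -kw; apply: H => //; apply: sub_sqr_nbh uw.
  by rewrite ge_min lexx.
have E : Om `&` [set w | k w = k y] = Om.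
  apply: cO; first by exists y.
    by exists (Om `&` [set w | k w = k y]) => //; rewrite setIA setIid.
  exists (~` (Om `&` [set w | k w = ~~ k y])); first exact: open_closedC.
  apply/seteqP; split=> w [Ow /= kw]; split=> //=.
    by move=> [_ /= kw']; move: kw; rewrite kw'; case: (k y).
  apply: contrapT => kw'; apply: kw; split=> //=.
  by move: kw'; case: (k w); case: (k y).
by move: Oz; rewrite -E => -[].
Qed.

(* The relation "not linked" is a cocycle with values in the two element group; telescoping it
   along the segments issuing from a base point trivializes it, since the plane is star-shaped. *)
Lemma nearby_linked Om (a r0 : R) : 0 < a <= 1 -> open Om -> connected Om -> box_bounded Om ->
  compact (boundary Om) -> Cla_curve 1 a (boundary Om) -> 0 < r0 ->
  exists rho e : R, [/\ 0 < rho, rho <= r0, 0 < e &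
    forall y z, Om y -> Om z -> sqr_nbh y e z -> linked (boundary Om) rho y z].
Proof.
move=> a01 oO cO [B OB] cG curveG r00.
have [rho [d [rho0 rhor d0 loc]]] := linked_local a01 cG curveG r00.
have [e [e0 e8]] : {e : R | 0 < e /\ 8 * e = d}.
  by exists (d / 8); rewrite divr_gt0//; split=> //; field.
have nG w : Om w -> ~ boundary Om w by move=> Ow /(notin_boundary oO).
have /choice[T TP] : forall w, exists v, [/\ ~ boundary Om v, sqr_nbh w e v &
    (~ boundary Om w -> v = w)].
  move=> w.
  have [Gw|nw] := pselect (boundary Om w); last by exists w; split=> //; exact: sqr_nbh_refl.
  by have [/closure_sqrP/(_ e e0)[v Ov wv] _] := Gw; exists v; split=> //; exact: nG.
pose c y z := ~~ `[< linked (boundary Om) rho y z >].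
have cE x : exists s : R * R -> bool, forall y z, sqr_nbh x d y -> sqr_nbh x d z ->
    ~ boundary Om y -> ~ boundary Om z -> c y z = s y (+) s z.
  have [s sP] := loc x; exists s => y z xy xz ny nz; rewrite /c.
  have [h1 h2] := sP y z xy xz ny nz; case: asboolP => [/h1 ->|h]; first by rewrite addbb.
  by case E1 : (s y); case E2 : (s z) => //; exfalso; apply: h; apply: h2; rewrite E1 E2.
have [[w0 Ow0]|no] := pselect (exists w0, Om w0); last first.
  by exists rho, e; split=> // y z Oy; exfalso; apply: no; exists y.
have [n n0 nP] : exists2 n : nat, (0 < n)%N & forall i z, Om z -> `|pcoord i z - pcoord i w0| / n%:R < e.
  have B0 : 0 <= B by have [h _] := OB w0 Ow0; exact: le_trans h.
  exists (Num.truncn (2 * B / e)).+1 => // i z Oz.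
  rewrite ltr_pdivrMr ?ltr0n// mulrC -ltr_pdivrMr//.
  have h1 : `|pcoord i z - pcoord i w0| <= 2 * B.
    apply: le_trans (ler_normB _ _) _.
    by have [z1 z2] := OB z Oz; have [v1 v2] := OB w0 Ow0; case: (i) => /=; move: z1 z2 v1 v2; clear; lra.
  apply: le_lt_trans (_ : 2 * B / e < _); first by rewrite ler_pM2r// invr_gt0.
  by apply: truncnS_gt.
have nR : 0 < n%:R :> R by rewrite ltr0n.
pose P (l : nat) z : R * R := (w0.1 + l%:R / n%:R * (z.1 - w0.1), w0.2 + l%:R / n%:R * (z.2 - w0.2)).
have Pc i l z : pcoord i (P l z) = pcoord i w0 + l%:R / n%:R * (pcoord i z - pcoord i w0).
  by case: i.
have P0 z : P 0%N z = w0 by rewrite /P !mul0r !addr0 -surjective_pairing.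
have Pn z : P n z = z.
  by rewrite /P divff ?gt_eqF// !mul1r !(addrC _ (_ - _)) !subrK -surjective_pairing.
have Pstep i l z : Om z -> `|pcoord i (P l.+1 z) - pcoord i (P l z)| < e.
  move=> /(nP i) h1; rewrite !Pc -natr1.
  rewrite [X in `|X|](_ : _ = (pcoord i z - pcoord i w0) / n%:R); last by field; rewrite gt_eqF.
  by rewrite normrM normfV (gtr0_norm nR).
have Pdiff i l z z' : (l <= n)%N -> sqr_nbh z e z' -> `|pcoord i (P l z') - pcoord i (P l z)| < e.
  move=> ln zz; rewrite !Pc.
  rewrite [X in `|X|](_ : _ = (l%:R / n%:R) * (pcoord i z' - pcoord i z)); last by ring.
  have [h1 _] := (sqr_nbhP i _ _ _).1 zz.
  apply: le_lt_trans h1; rewrite normrM ger0_norm ?divr_ge0//.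
  by rewrite ler_piMl// ler_pdivrMr// mul1r ler_nat.
pose A l z := T (P l z).
have nA l z : ~ boundary Om (A l z) by have [] := TP (P l z).
have close l z x : (forall i, `|pcoord i (P l z) - pcoord i x| < 2 * e) -> sqr_nbh x d (A l z).
  move=> h; have [_ TPz _] := TP (P l z); apply/(sqr_nbhP true).
  have [t1 t2] := (sqr_nbhP true _ _ _).1 TPz.
  have := ler_distD (pcoord true (P l z)) (pcoord true (A l z)) (pcoord true x).
  have := ler_distD (pcoord (~~ true) (P l z)) (pcoord (~~ true) (A l z)) (pcoord (~~ true) x).
  have := h true; have := h (~~ true); rewrite /A -e8; move: t1 t2 e0; clear.
  by move=> *; split; lra.
pose k l z := \big[addb/false]_(i < l) c (A i z) (A i.+1 z).
have kE l z z' : Om z -> Om z' -> sqr_nbh z e z' -> (l <= n)%N ->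
    k l z (+) k l z' = c (A l z) (A l z').
  move=> Oz Oz' zz; elim: l => [|l IH] ln.
    rewrite /k !big_ord0 /A !P0; have [s sP] := cE w0.
    have [_ _ To] := TP w0; rewrite (To (nG _ Ow0)).
    by rewrite (sP w0 w0) ?addbb//; (exact: nG || exact: sqr_nbh_refl).
  have kS z1 : k l.+1 z1 = k l z1 (+) c (A l z1) (A l.+1 z1) by rewrite /k big_ord_recr.
  rewrite !kS; have := IH (ltnW ln).
  have [s sP] := cE (P l z).
  have h1 : sqr_nbh (P l z) d (A l z).
    by apply: close => i; rewrite subrr normr0 mulr_gt0.
  have h2 : sqr_nbh (P l z) d (A l z').
    by apply: close => i; have := Pdiff i l z z' (ltnW ln) zz; move: e0; clear; lra.
  have h3 : sqr_nbh (P l z) d (A l.+1 z).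
    by apply: close => i; have := Pstep i l z Oz; move: e0; clear; lra.
  have h4 : sqr_nbh (P l z) d (A l.+1 z').
    apply: close => i; have := Pstep i l z Oz; have := Pdiff i l.+1 z z' ln zz.
    by have := ler_distD (pcoord i (P l.+1 z)) (pcoord i (P l.+1 z')) (pcoord i (P l z)); clear; lra.
  rewrite !sP//; case: (k l z); case: (k l z'); case: (s (A l z)); case: (s (A l z'));
    by case: (s (A l.+1 z)); case: (s (A l.+1 z')).
have kc z z' : Om z -> Om z' -> sqr_nbh z e z' -> k n z (+) k n z' = c z z'.
  move=> Oz Oz' zz; rewrite kE// /A !Pn.
  by have [_ _ ->] := TP z; [have [_ _ ->] := TP z'; last exact: nG|exact: nG].
have kconst := @connected_locally_constant Om (k n) oO cO _.
exists rho, e; split=> // y z Oy Oz yz; apply: contrapT => nl.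
have := kc y z Oy Oz yz; rewrite /c (asboolF nl) (kconst _ y z Oy Oz) ?addbb//.
move=> z1 Oz1; have [e1 e10 zO] := open_sqrP oO Oz1.
have [e2 [e20 h1 h2 h3]] : exists e2, [/\ 0 < e2, e2 <= e1, e2 <= e & e2 <= rho].
  exists (Num.min e1 (Num.min e rho)).
  by rewrite !lt_min e10 e0 rho0 !ge_min !lexx !orbT.
exists e2 => // w zw Ow; have := kc z1 w Oz1 Ow (sub_sqr_nbh h2 zw).
rewrite /c asboolT; first by case: (k n z1); case: (k n w).
exists (sqr_nbh z1 e2); split=> //; [exact: sqr_nbh_connected|exact: sqr_nbh_refl|].
by move=> u zu; split; [apply: nG; apply: zO; exact: sub_sqr_nbh zu|exact: sub_sqr_nbh zu].
Qed.

End OneSided.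

(** * Lipschitz estimate *)
Section Lipschitz.
Variable R : realType.
Implicit Types (z w p q s : R * R) (i j : bool) (Om : set (R * R)) (g m : R -> R).
Implicit Types (u : R * R -> R) (ui : bool -> R * R -> R).

(* Two points on the same side of the graph are joined by climbing vertically from each of them
   to a common height, above the graph, at which one crosses horizontally. *)
Lemma lipschitz_up_across_down S (a K L h : R) j p g m (b e : R) u ui (B : R) z w :
  graph_chart S a K L h j p g m -> `|b| = 1 -> 4 * L * e < h ->
  sqr_nbh p e z -> sqr_nbh p e w -> 0 < b * height j g z -> 0 < b * height j g w ->
  (forall i v, side j g b (pcoord j p) h v -> pd i u v (ui i v)) ->
  (forall i v, side j g b (pcoord j p) h v -> `|ui i v| <= B) ->
  `|u w - u z| <= B * ((2 * L + 3) * en (w - z)).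
Proof.
move=> ch b1 eh zp wp z0 w0 du uB.
have L1 := chart_L ch; have L0 : 0 < L := lt_le_trans ltr01 L1.
have bb : b * b = 1 by rewrite -expr2 -real_normK ?num_real// b1 expr1n.
have [zj zo] := (sqr_nbhP j p e z).1 zp; have [wj wo] := (sqr_nbhP j p e w).1 wp.
have e0 : 0 < e := le_lt_trans (normr_ge0 _) zj.
have eL : e <= L * e by rewrite ler_peMl// ltW.
have d1 := pcoord_en j (w - z); have d2 := pcoord_en (~~ j) (w - z).
rewrite !pcoordB in d1 d2; set D := en (w - z) in d1 d2 *.
pose d := `|pcoord j w - pcoord j z|; rewrite -/d in d1.
have d0 : 0 <= d := normr_ge0 _.
have bE : b = 1 \/ b = -1.
  have : b ^+ 2 = 1 by rewrite expr2 bb.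
  by move=> /eqP; rewrite sqrf_eq1 => /orP[] /eqP ->; [left|right].
have bnd v : `|b * v| = `|v| by exact: normb.
have de : d < 2 * e.
  have := ler_distD (pcoord j p) (pcoord j w) (pcoord j z).
  by rewrite (distrC (pcoord j p)) -/d; move: zj wj; clear; lra.
have [M [Mz Mw MzD MwD Mp]] : exists M, [/\ b * pcoord (~~ j) z <= M, b * pcoord (~~ j) w <= M,
    M <= b * pcoord (~~ j) z + D, M <= b * pcoord (~~ j) w + D & M < b * pcoord (~~ j) p + e].
  exists (Num.max (b * pcoord (~~ j) z) (b * pcoord (~~ j) w)).
  have D0 : 0 <= D := en_ge0 _.
  have h1 : `|b * pcoord (~~ j) w - b * pcoord (~~ j) z| <= D by rewrite -mulrBr bnd.
  rewrite -bnd mulrBr ltr_distl in zo; rewrite -bnd mulrBr ltr_distl in wo.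
  move: h1 zo wo; rewrite ler_distl => /andP[h1 h2] /andP[_ h3] /andP[_ h4].
  split; rewrite ?le_max ?lexx ?orbT// ?ge_max ?gt_max; last by rewrite h3 h4.
    by rewrite h2 andbT lerDl.
  by rewrite lerDl D0 andbT; move: h1; clear; lra.
pose Y := M + L * d.
have gp x : `|x - pcoord j p| < e -> b * pcoord (~~ j) p - L * e <= b * g x.
  move=> xe; have eh' : e < h by move: eh eL e0; rewrite -mulrA; clear; lra.
  have hp : `|pcoord j p - pcoord j p| < h by rewrite subrr normr0; exact: lt_trans eh'.
  have := chart_lip ch hp (lt_trans xe eh'); rewrite (chart_center ch) -bnd mulrBr.
  have : L * `|x - pcoord j p| <= L * e by rewrite ler_wpM2l// ltW.
  by rewrite ler_distl => h1 /andP[h2 _]; move: h1 h2; clear; lra.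
have Ld : L * d <= L * (2 * e) by rewrite ler_wpM2l ?(ltW L0)// ltW.
have Ytop x : `|x - pcoord j p| < e -> Y - b * g x < h.
  by move=> /gp; move: Mp Ld eL eh; rewrite /Y -mulrA; clear; lra.
have inside v (y : R) : `|pcoord j v - pcoord j p| < e -> b * pcoord (~~ j) v = y -> y <= Y ->
    0 < y - b * g (pcoord j v) -> side j g b (pcoord j p) h v.
  move=> vp vy yY h1; have eh' : e < h by move: eh eL e0; rewrite -mulrA; clear; lra.
  split; first exact: lt_trans eh'.
  have -> : b * height j g v = y - b * g (pcoord j v) by rewrite /height mulrBr vy.
  by rewrite h1 /=; apply: le_lt_trans (Ytop _ vp); rewrite lerD2r.
have btwn (x y t : R) : Num.min x y <= t <= Num.max x y -> `|t - x| <= `|y - x| /\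
    (forall c r, `|x - c| < r -> `|y - c| < r -> `|t - c| < r).
  rewrite ge_min le_max => /andP[/orP h1 /orP h2]; split.
    have := ler_norm (y - x); have := ler_norm (- (y - x)); rewrite normrN => h3 h4.
    by rewrite ler_norml; case: h1; case: h2; move: h3 h4; clear; move=> *; apply/andP; split; lra.
  move=> c r; rewrite !ltr_distl => /andP[h3 h4] /andP[h5 h6].
  by case: h1; case: h2; move: h3 h4 h5 h6; clear; move=> *; apply/andP; split; lra.
have up v : `|pcoord j v - pcoord j p| < e -> 0 < b * height j g v -> b * pcoord (~~ j) v <= Y ->
    `|u (slide (~~ j) v (b * Y)) - u v| <= B * (Y - b * pcoord (~~ j) v).
  move=> vp v0 vY.
  have seg t : Num.min (pcoord (~~ j) v) (b * Y) <= t <= Num.max (pcoord (~~ j) v) (b * Y) ->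
      side j g b (pcoord j p) h (slide (~~ j) v t).
    rewrite ge_min le_max => /andP[/orP t1 /orP t2].
    have sj : pcoord j (slide (~~ j) v t) = pcoord j v by case: (j).
    have [h1 h2] : b * pcoord (~~ j) v <= b * t /\ b * t <= Y.
      move: vY t1 t2; case: bE => ->; rewrite ?mul1r ?mulN1r => vY [] t1 [] t2;
        by split; move: vY t1 t2; clear; lra.
    apply: (inside _ (b * t)) => //; rewrite ?sj ?pcoord_slide//.
    by rewrite /height mulrBr in v0; move: v0 h1; clear; lra.
  have := @mvt_slide R (~~ j) u (ui (~~ j)) v (pcoord (~~ j) v) (b * Y) B
    (fun t ht => du (~~ j) _ (seg t ht)) (fun t ht => uB (~~ j) _ (seg t ht)).
  rewrite slide_pcoord => /le_trans; apply; rewrite -bnd mulrBr mulrA bb mul1r.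
  by rewrite ger0_norm// subr_ge0.
have zY : b * pcoord (~~ j) z <= Y by rewrite /Y ler_wpDr// mulr_ge0// ltW.
have wY : b * pcoord (~~ j) w <= Y by rewrite /Y ler_wpDr// mulr_ge0// ltW.
have across : `|u (slide (~~ j) w (b * Y)) - u (slide (~~ j) z (b * Y))| <= B * d.
  have E1 : slide j (slide (~~ j) z (b * Y)) (pcoord j z) = slide (~~ j) z (b * Y) by case: (j).
  have E2 : slide j (slide (~~ j) z (b * Y)) (pcoord j w) = slide (~~ j) w (b * Y) by case: (j).
  have seg x : Num.min (pcoord j z) (pcoord j w) <= x <= Num.max (pcoord j z) (pcoord j w) ->
      side j g b (pcoord j p) h (slide j (slide (~~ j) z (b * Y)) x).
    move=> /btwn[h1 /(_ _ _ zj wj) xp].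
    apply: (inside _ Y); rewrite ?pcoord_slide ?lexx//; first by case: (j) => /=; rewrite mulrA bb mul1r.
    have eh' : e < h by move: eh eL e0; rewrite -mulrA; clear; lra.
    have := chart_lip ch (lt_trans zj eh') (lt_trans xp eh'); rewrite -bnd mulrBr ler_distl.
    have : L * `|x - pcoord j z| <= L * d by rewrite ler_wpM2l// ltW.
    move=> h2 /andP[_ h3]; move: h2 h3 Mz z0; rewrite /Y /height mulrBr; clear; lra.
  have := @mvt_slide R j u (ui j) (slide (~~ j) z (b * Y)) (pcoord j z) (pcoord j w) B
    (fun t ht => du j _ (seg t ht)) (fun t ht => uB j _ (seg t ht)).
  by rewrite E1 E2.
have B0 : 0 <= B.
  have sz : side j g b (pcoord j p) h z.
    apply: (inside _ _ zj (erefl _) zY); move: z0; rewrite /height mulrBr; clear; lra.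
  exact: le_trans (normr_ge0 _) (uB true z sz).
have h1 := up z zj z0 zY; have h2 := up w wj w0 wY.
have h3 := ler_distD (u (slide (~~ j) z (b * Y))) (u w) (u z).
have h4 := ler_distD (u (slide (~~ j) w (b * Y))) (u w) (u (slide (~~ j) z (b * Y))).
rewrite (distrC (u w) (u (slide (~~ j) w (b * Y)))) in h4.
have h5 : Y - b * pcoord (~~ j) z + (Y - b * pcoord (~~ j) w) + d <= (2 * L + 3) * D.
  have : L * d <= L * D by rewrite ler_wpM2l// ltW.
  by move: MzD MwD d1; rewrite /Y; clear; lra.
have h6 : B * (Y - b * pcoord (~~ j) z + (Y - b * pcoord (~~ j) w) + d) <= B * ((2 * L + 3) * D).
  by rewrite ler_wpM2l.
apply: le_trans h6; rewrite !(mulrDr B); move: h1 h2 h3 h4 across; rewrite !mulrDr; clear; lra.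
Qed.

Lemma lipschitz_boundary Om (a : R) p : 0 < a <= 1 -> open Om -> connected Om ->
  box_bounded Om -> compact (boundary Om) -> Cla_curve 1 a (boundary Om) -> boundary Om p ->
  exists e C : R, 0 < e /\ forall u ui B z w,
    (forall i v, Om v -> pd i u v (ui i v)) -> (forall i v, Om v -> `|ui i v| <= B) ->
    Om z -> Om w -> sqr_nbh p e z -> sqr_nbh p e w -> `|u w - u z| <= B * (C * en (w - z)).
Proof.
move=> a01 oO cO bO cG curveG Gp; have [a0 a1] := andP a01.
have [K [L [h [j [g [m ch]]]]]] := graph_chart_exists a0 a1 curveG Gp.
have h0 := chart_h ch; have L1 := chart_L ch; have L0 : 0 < L := lt_le_trans ltr01 L1.
have h20 : 0 < h / 2 by rewrite divr_gt0.
have [rho [d [rho0 rhoh d0 link]]] := nearby_linked a01 oO cO bO cG curveG h20.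
have [e [e0 ed eh]] : exists e, [/\ 0 < e, e <= d / 2 & e <= h / (8 * L)].
  by exists (Num.min (d / 2) (h / (8 * L))); rewrite lt_min !divr_gt0 ?mulr_gt0// !ge_min !lexx orbT.
have eL : 8 * L * e <= h by rewrite mulrC -ler_pdivlMr ?mulr_gt0.
have eL1 : e <= L * e by rewrite ler_peMl// ltW.
rewrite -mulrA in eL.
exists e, (2 * L + 3); split=> // u ui B z w du uB Oz Ow zp wp.
have zw : sqr_nbh z d w.
  move: zp wp => [z1 z2] [w1 w2]; split.
    by have := ler_distD p.1 w.1 z.1; rewrite (distrC p.1); move: z1 w1 ed; clear; lra.
  by have := ler_distD p.2 w.2 z.2; rewrite (distrC p.2); move: z2 w2 ed; clear; lra.
have [E [cE Ez Ew EP]] := link z w Oz Ow zw.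
have Ej i v : E v -> `|pcoord i v - pcoord i p| < h.
  move=> /EP[_ /(sqr_nbhP i)[vz _]]; have [zi _] := (sqr_nbhP i p e z).1 zp.
  have := ler_distD (pcoord i z) (pcoord i v) (pcoord i p).
  by move: vz zi rhoh eL eL1 e0; clear; lra.
have E0 v : E v -> height j g v != 0.
  move=> Ev; have [nG _] := EP v Ev; apply: contra_notN nG; rewrite subr_eq0 => /eqP e1.
  have hL : h <= 2 * L * h by rewrite ler_peMl ?(ltW h0)//; move: L1; clear; lra.
  by apply/(chart_mem ch (Ej j v Ev) (lt_le_trans (Ej (~~ j) v Ev) hL)).
pose b := Num.sg (height j g z).
have b1 : `|b| = 1 by rewrite normr_sg E0.
have bz : 0 < b * height j g z by rewrite -normrEsg normr_gt0 E0.
clearbody b.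
have bw : 0 < b * height j g w.
  apply: (@connected_nonzero_sign _ E (fun w => b * height j g w) z w) => //.
    apply: continuous_in_subspaceT => v /[!inE] Ev.
    by apply: cvgM; [exact: cvg_cst|exact: (height_continuous ch (Ej j v Ev))].
  by move=> v Ev; rewrite mulf_neq0 ?E0// -normr_gt0 b1.
have xr : `|pcoord j p - pcoord j p| + h <= h by rewrite subrr normr0 add0r.
have hp : `|pcoord j p - pcoord j p| < h by rewrite subrr normr0.
have [zj zo] := (sqr_nbhP j p e z).1 zp.
have bzh : b * height j g z < h.
  apply: le_lt_trans (ler_norm _) _; rewrite (normb b1).
  have zjh : `|pcoord j z - pcoord j p| < h by apply: lt_le_trans zj _; move: eL eL1 e0; clear; lra.
  have := height_lip ch hp zjh; rewrite (height_center ch) subr0.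
  have : L * `|pcoord j z - pcoord j p| <= L * e by rewrite ler_wpM2l ?(ltW L0)// ltW.
  by move: zo eL eL1 e0; clear; lra.
have sO : side j g b (pcoord j p) h `<=` Om.
  have [//|sO] := side_dichotomy ch b1 xr oO (erefl _); exfalso; apply: (sO z) => //.
  split; last by rewrite bz bzh.
  by apply: lt_le_trans zj _; move: eL eL1 e0; clear; lra.
apply: (lipschitz_up_across_down ch b1 _ zp wp bz bw) => [|i v /sO|i v /sO].
- by rewrite -mulrA; move: eL eL1 e0; clear; lra.
- exact: du.
- exact: uB.
Qed.

Lemma lipschitz_interior Om p : open Om -> Om p ->
  exists e C : R, 0 < e /\ forall u ui B z w,
    (forall i v, Om v -> pd i u v (ui i v)) -> (forall i v, Om v -> `|ui i v| <= B) ->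
    Om z -> Om w -> sqr_nbh p e z -> sqr_nbh p e w -> `|u w - u z| <= B * (C * en (w - z)).
Proof.
move=> oO Op; have [e1 e10 pO] := open_sqrP oO Op.
have [e [e0 e3]] : {e : R | 0 < e /\ 3 * e = e1}.
  by exists (e1 / 3); rewrite divr_gt0//; split=> //; field.
exists e, 2; split=> // u ui B z w du uB Oz Ow [z1 z2] [w1 w2].
have zO v : sqr_nbh z (2 * e) v -> Om v.
  move=> [v1 v2]; apply: pO; rewrite -e3; split.
    by have := ler_distD z.1 v.1 p.1; move: v1 z1; clear; lra.
  by have := ler_distD z.2 v.2 p.2; move: v2 z2; clear; lra.
have B0 : 0 <= B := le_trans (normr_ge0 _) (uB true z Oz).
have zw : sqr_nbh z (2 * e) w.
  split.
    by have := ler_distD p.1 w.1 z.1; rewrite (distrC p.1); move: z1 w1; clear; lra.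
  by have := ler_distD p.2 w.2 z.2; rewrite (distrC p.2); move: z2 w2; clear; lra.
have h := @lipschitz_square R u ui z w (2 * e) B (fun i v hv => du i v (zO v hv))
  (fun i v hv => uB i v (zO v hv)) zw.
apply: (le_trans h); rewrite ler_wpM2l//.
by have := fst_le_en (w - z); have := snd_le_en (w - z); rewrite /=; clear; lra.
Qed.

End Lipschitz.

Section Global.
Variable R : realType.
Implicit Types (z w p q s : R * R) (i j : bool) (Om : set (R * R)).
Implicit Types (f : R * R -> R * R).

Lemma bounded_set_box (A : set (R * R)) : bounded_set A -> box_bounded A.
Proof.
move=> [M [_ MA]]; exists (`|M| + 1) => z Az.
have := MA (`|M| + 1) _ z Az; rewrite (le_lt_trans (ler_norm M)) ?ltrDl// => /(_ erefl) /= h.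
by split; apply: le_trans h; rewrite prod_normE le_max lexx ?orbT.
Qed.

Lemma compact_en_bounded (A : set (R * R)) : compact A ->
  exists2 B : R, 0 <= B & forall s, A s -> en s <= B.
Proof.
move=> cA; have [t [t1 tP]] : exists t : R, 1 <= t /\ forall q, A q -> en q <= t.
  apply: uniform_on_compact => // p Ap; exists (en p + 2), 1; split=> // t q tp [q1 q2] Aq.
  have := en_tri q p 0; rewrite !subr0; have := en_le_sum (q - p).
  by move: q1 q2 tp; rewrite /=; clear; lra.
by exists t => //; exact: le_trans t1.
Qed.

Lemma box_bounded_closure (A : set (R * R)) : box_bounded A -> compact (closure A).
Proof.
move=> [B AB]; apply: compact_closed_bounded; first exact: closed_closure.
exists (B + 1) => z /closure_sqrP /(_ 1 ltr01)[w /AB[w1 w2] [h1 h2]].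
have := ler_normB z.1 (z.1 - w.1); have := ler_normB z.2 (z.2 - w.2).
have e1 : z.1 = w.1 - (w.1 - z.1) by ring.
have e2 : z.2 = w.2 - (w.2 - z.2) by ring.
have h3 := ler_normB w.1 (w.1 - z.1); have h4 := ler_normB w.2 (w.2 - z.2).
by rewrite -e1 in h3; rewrite -e2 in h4; move: w1 w2 h1 h2 h3 h4; clear; split; lra.
Qed.

Lemma gradient_locally_bounded Om f pi pii qi qii (K M N : R) p : open Om ->
  qcmap Om f pi pii qi qii K M N -> Om p ->
  exists e B : R, 0 < e /\ forall z, sqr_nbh p e z -> Om z -> grad2 pi qi z <= B.
Proof.
move=> oO qcf Op; have pO : p \in Om by rewrite inE.
have cg := sqrt_grad2_continuous (fun i => qc_conti1 qcf (i := i) pO)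
  (fun i => qc_conti2 qcf (i := i) pO).
have [e e0 H] := (continuous_sqrP _ _).1 cg 1 ltr01.
exists e, ((Num.sqrt (grad2 pi qi p) + 1) ^+ 2); split=> // z /H; rewrite ltr_distl => /andP[_ h] _.
rewrite -[leLHS]sqr_sqrtr ?grad2_ge0// ler_sqr ?nnegrE ?sqrtr_ge0 ?addr_ge0 ?sqrtr_ge0//.
exact: ltW.
Qed.

Lemma lipschitz_global Om f : box_bounded Om ->
  (forall p, closure Om p -> exists e C : R, 0 < e /\ forall z w, Om z -> Om w ->
     sqr_nbh p e z -> sqr_nbh p e w -> en (f w - f z) <= C * en (w - z)) ->
  exists L : R, forall z w, Om z -> Om w -> en (f z - f w) <= L * en (z - w).
Proof.
move=> bO loc.
have [t [t1 tP]] : exists t : R, 1 <= t /\ forall q, closure Om q ->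
    (forall z w, Om z -> Om w -> sqr_nbh q t^-1 z -> sqr_nbh q t^-1 w ->
       en (f w - f z) <= t * en (w - z)) /\
    (forall z, Om z -> sqr_nbh q t^-1 z -> en (f z) <= t).
  apply: uniform_on_compact; first exact: box_bounded_closure.
  move=> p cp; have [e [C [e0 H]]] := loc p cp.
  have [B HB] : exists B, forall z, Om z -> sqr_nbh p e z -> en (f z) <= B.
    have [[z0 [Oz0 pz0]]|no] := pselect (exists z0, Om z0 /\ sqr_nbh p e z0); last first.
      by exists 0 => z Oz pz; exfalso; apply: no; exists z.
    exists (en (f z0) + `|C| * (4 * e)) => z Oz pz.
    have h1 := H z0 z Oz0 Oz pz0 pz; have := en_tri (f z) (f z0) 0; rewrite !subr0 => h2.
    apply: (le_trans h2); rewrite addrC lerD2l; apply: (le_trans h1).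
    apply: le_trans (ler_wpM2r (en_ge0 _) (ler_norm C)) _; rewrite ler_wpM2l//.
    apply: le_trans (en_le_sum _) _; move: pz0 pz => [a1 a2] [b1 b2].
    have := ler_distD p.1 z.1 z0.1; have := ler_distD p.2 z.2 z0.2.
    rewrite (distrC p.1) (distrC p.2) /=; move: a1 a2 b1 b2; clear; lra.
  exists (Num.max (e / 2)^-1 (Num.max C B)), (e / 2); split; first by rewrite divr_gt0.
  move=> t q; rewrite !ge_max => /and3P[te tC tB] pq _.
  have t0 : 0 < t by apply: lt_le_trans te; rewrite invr_gt0 divr_gt0.
  have te' : t^-1 <= e / 2 by rewrite -[leRHS]invrK lef_pV2 ?posrE// invr_gt0 divr_gt0.
  have sub z : sqr_nbh q t^-1 z -> sqr_nbh p e z.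
    move=> [z1 z2]; move: pq => [q1 q2]; split.
      by have := ler_distD q.1 z.1 p.1; move: z1 q1 te'; clear; lra.
    by have := ler_distD q.2 z.2 p.2; move: z2 q2 te'; clear; lra.
  split=> [z w Oz Ow /sub qz /sub qw|z Oz /sub qz].
    by apply: le_trans (H z w Oz Ow qz qw) _; rewrite ler_wpM2r ?en_ge0.
  exact: le_trans (HB z Oz qz) tB.
have t0 : 0 < t := lt_le_trans ltr01 t1.
have ti0 : 0 < t^-1 by rewrite invr_gt0.
exists (t + 2 * t ^+ 2) => z w Oz Ow; rewrite en_distC (en_distC z).
have [lip bz] := tP z (subset_closure Oz); have [_ bw] := tP w (subset_closure Ow).
have E0 := en_ge0 (w - z); have t20 : 0 <= 2 * t ^+ 2 by rewrite mulr_ge0 ?sqr_ge0.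
have [zw|nzw] := pselect (sqr_nbh z t^-1 w).
  apply: le_trans (lip z w Oz Ow (sqr_nbh_refl _ ti0) zw) _.
  by rewrite ler_wpM2r// lerDl.
have far : t^-1 <= en (w - z).
  rewrite leNgt; apply/negP => h; apply: nzw; split.
    exact: le_lt_trans (fst_le_en (w - z)) h.
  exact: le_lt_trans (snd_le_en (w - z)) h.
have h1 := bz z Oz (sqr_nbh_refl _ ti0); have h2 := bw w Ow (sqr_nbh_refl _ ti0).
have h3 : en (f w - f z) <= 2 * t.
  have := en_tri (f w) 0 (f z); rewrite subr0 sub0r enN.
  by move: h1 h2; clear; lra.
apply: (le_trans h3); have h4 : 2 * t ^+ 2 * t^-1 <= 2 * t ^+ 2 * en (w - z) by rewrite ler_wpM2l.
have h5 : 2 * t ^+ 2 * t^-1 = 2 * t by field; rewrite gt_eqF.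
have h6 : 0 <= t * en (w - z) by rewrite mulr_ge0// ltW.
by rewrite mulrDl; move: h4 h5 h6; clear; lra.
Qed.

End Global.

Theorem theorem3p4 (R : realType) (alpha : R) (Omega G : set (R * R))
    (f : R * R -> R * R) :
  0 < alpha <= 1 ->
  plane_domain Omega -> bounded_set Omega -> Cla_compact_boundary 1 alpha Omega ->
  plane_domain G -> Cla_compact_boundary 2 alpha G ->
  Ck_diffeomorphism 2 Omega G f ->
  quasiconformal Omega f ->
  (exists M N : R, forall z, Omega z ->
     modulus (laplacian f z) <= M * sqr_grad f z + N) ->
  (exists B : R, forall z, Omega z ->
     modulus (dx f z) <= B /\ modulus (dy f z) <= B) /\
  (exists L : R, forall z w, Omega z -> Omega w ->
     modulus (f z - f w) <= L * modulus (z - w)).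
Proof.
move=> a01 [oO cO _] /bounded_set_box bO [cbO curveO] [oG _ _] [cbG curveG].
move=> [[fG _ fS] Ckf [f' [cf' _ _ _] fK]] qcf lapf; have [a0 _] := andP a01.
have [K [M [N sq]]] := smooth_qc_exists oO Ckf qcf lapf.
pose pi i z := (dir i f z).1; pose qi i z := (dir i f z).2.
have {}fG z : Omega z -> G (f z) by move=> Oz; apply: fG.
have {}fS w : G w -> exists2 z, Omega z & f z = w by move=> /fS[z Oz <-]; exists z.
have nearS p : boundary Omega p -> forall B eps : R, 0 < eps ->
    exists2 e : R, 0 < e & forall z, sqr_nbh p e z -> Omega z ->
      (exists2 s, boundary G s & en (f z - s) < eps) \/ B < nsq (f z).
  move=> /(notin_boundary oO) nO B eps eps0.
  exact: (near_boundary oG fG fK fS cf').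
have avoidS z : Omega z -> ~ boundary G (f z) by move=> /fG Gz /(notin_boundary oG).
have [BS BS0 boundS] := compact_en_bounded cbG.
have geo := ball_geometry_exists (Cla_curve_lipschitz a0 curveG) cbG.
have closureE p : closure Omega p -> Omega p \/ boundary Omega p.
  by move=> cp; have [Op|nO] := pselect (Omega p); [left|right; split=> //; rewrite (interior_id Omega).1].
have [t [t1 tP]] : exists t : R, 1 <= t /\ forall q, closure Omega q -> Omega q -> grad2 pi qi q <= t.
  apply: uniform_on_compact; first exact: box_bounded_closure.
  move=> p /closureE Gp; have [e [B [e0 H]]] : exists e B : R, 0 < e /\
      forall z, sqr_nbh p e z -> Omega z -> grad2 pi qi z <= B.
    case: Gp => Gp; first exact: (gradient_locally_bounded oO (smooth_qcmap sq) Gp).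
    exact: (boundary_gradient sq oO nearS avoidS BS0 boundS a01 curveO geo Gp).
  by exists B, e; split=> // t q Bt pq _ Oq; exact: le_trans (H q pq Oq) Bt.
have t0 : 0 <= t := le_trans ler01 t1.
have tt : t <= t ^+ 2 by rewrite expr2 ler_peMl.
have gradt z : Omega z -> grad2 pi qi z <= t ^+ 2.
  by move=> Oz; apply: le_trans (tP z (subset_closure Oz) Oz) tt.
split.
  exists t => z Oz; have := gradt z Oz; rewrite grad2_dir /sqr_grad => h.
  have mod_le v : modulus v ^+ 2 <= t ^+ 2 -> modulus v <= t.
    by rewrite modulusE ler_sqr ?nnegrE ?en_ge0.
  move: (dx f z) (dy f z) h => v w h.
  split; apply: mod_le; apply: le_trans h; first by rewrite lerDl sqr_ge0.
  by rewrite lerDr sqr_ge0.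
have lip p : closure Omega p -> exists e C : R, 0 < e /\ forall u ui B z w,
    (forall i v, Omega v -> pd i u v (ui i v)) -> (forall i v, Omega v -> `|ui i v| <= B) ->
    Omega z -> Omega w -> sqr_nbh p e z -> sqr_nbh p e w -> `|u w - u z| <= B * (C * en (w - z)).
  move=> /closureE[Op|Gp]; first exact: lipschitz_interior.
  exact: lipschitz_boundary a01 oO cO bO cbO curveO Gp.
apply: (lipschitz_global bO) => p /lip[e [C [e0 H]]].
exists e, (2 * t * C); split=> // z w Oz Ow pz pw.
have pB i v : Omega v -> `|pi i v| <= t by move=> /gradt /(grad2_comp i t0)[].
have qB i v : Omega v -> `|qi i v| <= t by move=> /gradt /(grad2_comp i t0)[].
have h1 := H (fun z => (f z).1) pi t z w
  (fun i v Ov => (qc_jet1 (smooth_qcmap sq) i Ov).1) pB Oz Ow pz pw.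
have h2 := H (fun z => (f z).2) qi t z w
  (fun i v Ov => (qc_jet2 (smooth_qcmap sq) i Ov).1) qB Oz Ow pz pw.
apply: le_trans (en_le_sum _) _; move: h1 h2; rewrite /= -mulrA; clear; lra.
Qed.
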